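(* Let $G$ be a positive random variable with $E(|\log G|)<\infty$. Then: 1) $F_{1/G}^{-1}(y)\cdot F_G^{-1}(1-y)=1$ for a.e. $y\in[0,1]$. 2) For every $\lambda>0$, $$\psi_{1/G}(\lambda)-\psi_G(1/\lambda)=E(\log G)+\log\lambda .$$ 3) For every $t>0$: (i) the density $f_{\Gamma_t(1/G)}$ of the random variable $\Gamma_t(1/G)$ equals, for $x>0$, $$f_{\Gamma_t(1/G)}(x)=e^{-tE(\log G)}\,E\left\{\left(\frac{\Gamma_t(G)}{x}\right)^{\frac{1-t}{2}}J_{t-1}\left(2\sqrt{x\,\Gamma_t(G)}\right)\right\};$$ (ii) $$f_{\Gamma_t(1/G)}(x)=\frac{x^{t-1}}{\Gamma(t)}\,e^{-tE(\log G)}\,E\left(e^{-xD_t(G)}\right)\qquad(x>0);$$ (iii) $$E\left(\frac{1}{(D_t(G))^t}\right)=e^{tE(\log G)} .$$ 4) For every $t>0$: (i) for every $\lambda\ge 0$, $$E\left(\frac{1}{(\lambda+D_t(G))^t}\right)=\exp\left\{-t\left(\psi_{1/G}(\lambda)-E(\log G)\right)\right\};$$ (ii) the densities $f_{D_t(G)}$ and $f_{D_t(1/G)}$ of, respectively, $D_t(G)$ and $D_t(1/G)$ are related by $$f_{D_t(1/G)}(x)=x^{t-2}\,e^{-tE(\log G)}\,f_{D_t(G)}(1/x)\qquad(x>0).$$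
   Context: For a positive random variable $G$, $F_G$ is its cumulative distribution function and $F_G^{-1}$ is the right-continuous inverse of $F_G$ in the sense of composition of functions. For a positive random variable $G$ with $E(\log^+(1/G))<\infty$, $(\Gamma_t(G),\,t\ge0)$ denotes the subordinator characterized by $$E(e^{-\lambda\Gamma_t(G)})=\exp\{-t\,\psi_G(\lambda)\},\qquad \psi_G(\lambda):=\int_0^\infty(1-e^{-\lambda x})\frac{dx}{x}E(e^{-xG})=E\left(\log\left(1+\frac{\lambda}{G}\right)\right)\quad(\lambda\ge0).$$ $\psi_{1/G}$ and $\Gamma_t(1/G)$ are defined in the same way with $1/G$ in place of $G$; both subordinators are well defined when $E(|\log G|)<\infty$. For $t>0$, $D_t(G)$ is the positive random variable whose law is characterized by $\Gamma_t(G)\stackrel{(law)}{=}\gamma_t\cdot D_t(G)$, where $\gamma_t$ is a gamma variable with parameter $t$ (density $e^{-a}a^{t-1}/\Gamma(t)$ on $(0,\infty)$), independent of $D_t(G)$. Such a variable exists and its law is unique. $J_\nu(z)=\sum_{k\ge0}\frac{(-1)^k}{\Gamma(k+1)\Gamma(k+\nu+1)}\left(\frac z2\right)^{\nu+2k}$ is the Bessel function of index $\nu$.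
   Formalization: In 3(i) with t<1/2 the expectation may fail to converge absolutely; the formula is stated when it does, and for all t>0 as the limit of E over {Γ_t(G)≤A}, A→∞. In 4(ii), D_t(G) has a density only if G is not a.s. constant; existence is stated then. *)

(* Defs.v *)
From HB Require Import structures.
From mathcomp Require Export all_boot all_order all_algebra.
From mathcomp Require Export all_classical all_reals all_analysis.
From mathcomp Require Export measurable_realfun.
Export Order.TTheory GRing.Theory Num.Theory.
Export numFieldNormedType.Exports.

Set Implicit Arguments.
Unset Strict Implicit.
Unset Printing Implicit Defensive.

Local Open Scope classical_set_scope.
Local Open Scope ring_scope.

Lemma measurable_invr (R : realType) :
  measurable_fun [set: R] (fun x : R => x^-1).
Proof.
have cl0 : closed [set (0 : R)].
  by apply: accessible_closed_set1; apply: hausdorff_accessible; exact: Rhausdorff.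
have m0 : measurable [set (0 : R)] by exact: measurable_set1.
rewrite -(setvU [set (0 : R)]).
apply/measurable_funU; [exact: measurableC|exact: m0|split].
- apply: open_continuous_measurable_fun; first exact: closed_openC.
  by move=> x /set_mem /= /eqP x0; exact: inv_continuous.
- apply: (eq_measurable_fun (cst (0 : R))) => [x|]; last exact: measurable_cst.
  by move=> /set_mem /= ->; rewrite invr0.
Qed.

Section random_variables.
Context {R : realType} {d : measure_display} {T : measurableType d}.
Implicit Types P : probability T R.

(* Positivity holds almost surely; on the null set where G <= 0, the functions
   ln, powR and x^-1 take their conventional values. *)
Definition positive_rv P (X : T -> R) : Prop := {ae P, forall w, 0 < X w}.

Definition inv_fun P (G : {RV P >-> R}) : T -> R := fun w => (G w)^-1.

Lemma measurable_inv_fun P (G : {RV P >-> R}) :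
  measurable_fun [set: T] (inv_fun G).
Proof.
exact: (measurableT_comp (@measurable_invr R)
  (@measurable_funPT _ _ _ _ (G : {mfun T >-> R}))).
Qed.

HB.instance Definition _ P (G : {RV P >-> R}) :=
  isMeasurableFun.Build _ _ _ _ (inv_fun G) (measurable_inv_fun G).

Definition inv_rv P (G : {RV P >-> R}) : {RV P >-> R} := inv_fun G.

Definition has_density P (X : T -> R) (f : R -> R) : Prop :=
  [/\ measurable_fun [set: R] f, forall x, 0 <= f x
    & forall B : set R, measurable B ->
        P (X @^-1` B) = (\int[lebesgue_measure]_(x in B) (f x)%:E)%E].

Definition independent_rv P (X Y : T -> R) : Prop :=
  forall A B : set R, measurable A -> measurable B ->
    P (X @^-1` A `&` Y @^-1` B) = (P (X @^-1` A) * P (Y @^-1` B))%E.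

(* The right-continuous inverse of F_X. At y = 1 the set may be empty, and inf
   then returns 0. *)
Definition cdf_inv P (X : {RV P >-> R}) (y : R) : R :=
  inf [set x : R | (y%:E < cdf X x)%E].

Definition mean_log P (G : T -> R) : R := fine 'E_P[fun w => ln (G w)].

Definition psi P (G : T -> R) (l : R) : \bar R :=
  (\int[lebesgue_measure]_(x in `]0%R, +oo[)
     (((1 - expR (- (l * x))) / x)%:E * 'E_P[fun w => expR (- (x * G w))%R]))%E.

End random_variables.

Definition law_eq {R : realType}
    {d1 d2 : measure_display} {T1 : measurableType d1} {T2 : measurableType d2}
    (P1 : probability T1 R) (X1 : T1 -> R)
    (P2 : probability T2 R) (X2 : T2 -> R) : Prop :=
  forall B : set R, measurable B -> P1 (X1 @^-1` B) = P2 (X2 @^-1` B).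

Section subordinators.
Context {R : realType} {d : measure_display} {T : measurableType d}.
Variable P : probability T R.

Definition increment (X : R -> {RV P >-> R}) (s t : R) : T -> R :=
  fun w => X t w - X s w.

(* Processes are indexed by R, but only the times t >= 0 matter. Left limits
   come for free from monotonicity. *)
Definition subordinator (X : R -> {RV P >-> R}) : Prop :=
  [/\ {ae P, forall w, X 0 w = 0},
      {ae P, forall w,
         (forall s t, 0 <= s -> s <= t -> X s w <= X t w) /\
         (forall s, 0 <= s -> X u w @[u --> s^'+] --> X s w)},
      forall s h, 0 <= s -> 0 <= h ->
        law_eq P (increment X s (s + h)) P (X h)
    & forall (n : nat) (s : nat -> R), 0 <= s 0%N ->
        {homo s : i j / (i <= j)%N >-> i <= j} ->
        forall B : nat -> set R, (forall i, measurable (B i)) ->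
          (P (\bigcap_(i in `I_n) increment X (s i) (s i.+1) @^-1` B i) =
           \prod_(0 <= i < n) P (increment X (s i) (s i.+1) @^-1` B i))%E].

End subordinators.

Definition is_Gamma_subordinator {R : realType}
    {d d' : measure_display} {T : measurableType d} {T' : measurableType d'}
    (P : probability T R) (G : T -> R)
    (P' : probability T' R) (X : R -> {RV P' >-> R}) : Prop :=
  subordinator X /\
  forall t l : R, 0 <= t -> 0 <= l ->
    ('E_P'[fun w => expR (- (l * X t w))] = expeR (- (t%:E * psi P G l)))%E.

(* Euler's integral, for s > 0 *)
Definition Gamma_fun {R : realType} (s : R) : R :=
  \int[lebesgue_measure]_(a in `]0, +oo[) (a `^ (s - 1) * expR (- a)).

Definition gamma_pdf {R : realType} (t : R) (a : R) : R :=
  if 0 < a then expR (- a) * a `^ (t - 1) / Gamma_fun t else 0.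

(* For nu > -1 and z > 0: the Gamma function is then only evaluated at positive
   arguments. *)
Definition bessel_J {R : realType} (nu z : R) : R :=
  limn (series (fun k : nat =>
    (-1) ^+ k / (Gamma_fun (k%:R + 1) * Gamma_fun (k%:R + nu + 1))
      * (z / 2) `^ (nu + 2 * k%:R))).

(* [is_D t P Y P' D] : D is a positive variable with Y equal in law to g * D,
   where g is gamma(t) distributed and independent of D. *)
Definition is_D {R : realType} (t : R)
    {d d' : measure_display} {T : measurableType d} {T' : measurableType d'}
    (P : probability T R) (Y : T -> R)
    (P' : probability T' R) (D : {RV P' >-> R}) : Prop :=
  positive_rv P' D /\
  exists g : {RV P' >-> R},
    [/\ has_density P' g (gamma_pdf t), independent_rv P' g D
      & law_eq P Y P' (fun w => g w * D w)].

(* Main.v *)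
Require Import Defs.
From HB Require Import structures.
From mathcomp Require Import ring lra.

Set Implicit Arguments.
Unset Strict Implicit.
Unset Printing Implicit Defensive.

Local Open Scope classical_set_scope.
Local Open Scope ring_scope.

(** Put W = 1/G and S(l) = exp (- t E log (l + W)).  By Frullani's integral
    psi_G(l) = log l + E log (1/l + W) and psi_{1/G}(l) = E log (l + W) + E log G,
    which gives 2), and a positive variable D has the law of D_t(G) if and only if
    E (l + D)^(-t) = S(l) for all l > 0.  Such a law exists: it is the limit of the
    iteration X |-> V X + (1 - V) W, V = U^(1/t), started at 0.  On the order-t
    Stieltjes transform one step is the map sending f to the function
    l |-> int_l^oo t E[1/(s + W)] f(s) ds, which fixes S, and S is the only fixed
    point equivalent to l^(-t) at infinity.  The fixed-point equation
    D = V D + (1 - V) W also shows that, for W not constant, D has no atom, and then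
    no mass on Lebesgue-null sets.

    The other identities compare transforms.  Gamma_t(1/G) has Laplace transform
    e^(-t E log G) S(l), whence 3)(ii); 4)(i) is the definition of S and gives 3)(iii)
    at l = 0; 4)(ii) holds because 1/D_t(G), weighted by e^(-t E log G) D_t(G)^(-t),
    has the Stieltjes transform of D_t(1/G).  For 3)(i), write Gamma_t(G) as a
    gamma variable times D_t(G): with phi_t(u) = sum_k (-u)^k / (k! Gamma(k + t)),
    the integrals of phi_t(u a) a^(t-1) e^(-a) over ]0, c[ are bounded uniformly in u
    and c, by an integration by parts, and tend to e^(-u) as c grows.
    In 1), the exceptional y are those for which 1 - y is a value of F_G at a
    rational point. *)

(** The density in 3) is claimed even when no variable [D] is supplied, and it is read off a law of
    [D]; hence such a law is constructed. The choice [V = U ^ (1/t)] comes from beta-gamma algebra: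
    [V] is beta(t, 1), so for [g] gamma(t + 1) independent of [V], the products [g V] and
    [g (1 - V)] are independent, gamma(t) and exponential. Therefore [E (V p + (1 - V) q)^(-t-1) =
    p^(-t) q^(-1)]: the transform of order t + 1 of one step factors, and integrating in [l] brings
    it back to order t. Convergence is monotone: 0 is the smallest starting point, so the cdfs
    decrease, and [S(l) ~ l^(-t)] at infinity forbids a loss of mass. In 3)(i) the obstacle is
    absolute convergence: for [t < 1/2] the function [phi_t] is unbounded, so the expectation is
    taken as a limit of truncations of [Gamma_t(G)] at a level [A]. Given [D], this cuts the gamma
    variable at [A / D], and [phi_t] is evaluated at [x D] times that variable; a bound uniform in
    both parameters is what dominated convergence requires. Passing from order t to t + 1 reaches
    the range [s >= 1/2] where [phi_s] is bounded. *)

Section tonelli.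
Local Open Scope ereal_scope.
Context {R : realType} d1 d2 (T1 : measurableType d1) (T2 : measurableType d2).
Variables (m1 : {sigma_finite_measure set T1 -> \bar R})
  (m2 : {sigma_finite_measure set T2 -> \bar R}).
Variables (A : set T1) (B : set T2) (f : T1 -> T2 -> \bar R).
Hypotheses (mA : measurable A) (mB : measurable B)
  (mf : measurable_fun [set: T1 * T2] (fun z => f z.1 z.2))
  (f0 : forall x y, A x -> B y -> 0 <= f x y).

Let g (z : T1 * T2) := ((fun z => f z.1 z.2) \_ (A `*` B)) z.

Let mg : measurable_fun setT g.
Proof.
by apply/(measurable_restrictT _ (measurableX mA mB)); exact: measurable_funS mf.
Qed.

Let g0 z : 0 <= g z.
Proof.
rewrite /g patchE; case: ifPn => // /set_mem[/= Az Bz]; exact: f0.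
Qed.

Let gE x y : g (x, y) = ((fun x => (f x \_ B) y) \_ A) x.
Proof.
rewrite /g !patchE in_setX /=.
by case: (x \in A) => //=; case: (y \in B).
Qed.

(** Extending the integrand by zero outside [A * B] turns both iterated integrals into full ones, so
    that signs only have to be controlled on the rectangle. *)
Lemma tonelli_in :
  \int[m1]_(x in A) \int[m2]_(y in B) f x y =
  \int[m2]_(y in B) \int[m1]_(x in A) f x y.
Proof.
transitivity (\int[m1]_x \int[m2]_y g (x, y)).
  rewrite integral_mkcond; apply: eq_integral => x _; rewrite patchE.
  under [RHS]eq_integral do rewrite gE patchE.
  by case: ifPn => xA; [exact: integral_mkcond|rewrite integral0_eq].
rewrite fubini_tonelli//.
rewrite [RHS]integral_mkcond; apply: eq_integral => y _; rewrite [RHS]patchE.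
under [LHS]eq_integral do rewrite gE patchE patchE.
case: ifPn => yB; last first.
  by rewrite integral0_eq// => x _; case: ifP.
by rewrite [RHS]integral_mkcond; apply: eq_integral => x _; rewrite patchE.
Qed.

Lemma measurable_integral_param : (forall x y, 0 <= f x y) ->
  measurable_fun [set: T1] (fun x => \int[m2]_(y in B) f x y).
Proof.
move=> f0'; pose h (z : T1 * T2) := ((fun z => f z.1 z.2) \_ (setT `*` B)) z.
have mh : measurable_fun setT h.
  apply/(measurable_restrictT _ (measurableX measurableT mB)).
  exact: measurable_funS mf.
have h0 z : 0 <= h z by rewrite /h patchE; case: ifPn.
have := measurable_fun_fubini_tonelli_F (m2 := m2) h mh h0.
apply: eq_measurable_fun => x _; rewrite /fubini_F [RHS]integral_mkcond.
by apply: eq_integral => y _; rewrite /h !patchE in_setX in_setT.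
Qed.

End tonelli.
Arguments tonelli_in {R d1 d2 T1 T2} m1 m2 {A B} f.
Arguments measurable_integral_param {R d1 d2 T1 T2} m2 {B} f.

(** * Weighted laws and their determination by half-lines *)

Section weighted_law.
Local Open Scope ereal_scope.
Context {R : realType}.

(** The image under [X] of the measure with density [w], kept as a bare set function. Ordinary laws
    ([w = 1]), densities on the line ([X = id]) and the reweighted law of [1/D] are all instances,
    so one uniqueness statement serves them all. *)
Definition wlaw d (T : measurableType d) (mu : {measure set T -> \bar R})
    (w X : T -> R) (B : set R) :=
  \int[mu]_(x in X @^-1` B) (w x)%:E.

Lemma preimage_measurable d (T : measurableType d) (X : T -> R) (B : set R) :
  measurable_fun [set: T] X -> measurable B -> measurable (X @^-1` B).
Proof. by move=> mX mB; rewrite -[X in measurable X]setTI; exact: mX. Qed.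

Lemma wlawE d (T : measurableType d) (mu : {measure set T -> \bar R})
    (w X : T -> R) B : measurable_fun [set: T] X -> measurable B ->
  (forall x, 0 <= w x)%R ->
  wlaw mu w X B = \int[mu]_x (w x * \1_B (X x))%:E.
Proof.
move=> mX mB w0; rewrite /wlaw integral_mkcond; apply: eq_integral => x _.
rewrite patchE indicE; have [xB|xB] := boolP (x \in _).
  by rewrite mem_set ?mulr1//; exact: set_mem xB.
rewrite memNset ?mulr0//; move: xB; rewrite notin_setE; exact.
Qed.

Lemma wlaw_prob d (T : measurableType d) (P : probability T R) (X : T -> R) B :
  measurable_fun [set: T] X -> measurable B ->
  wlaw P (fun=> 1%R) X B = P (X @^-1` B).
Proof.
by move=> mX mB; rewrite /wlaw integral_cst ?mul1e//; exact: preimage_measurable.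
Qed.

(** The rays []a, +oo[] form a pi-system generating the Borel sets, so Dynkin induction applies.
    Equal and finite total masses permit the subtraction in the complement step. *)
Lemma eq_wlaw_rays d1 d2 (T1 : measurableType d1) (T2 : measurableType d2)
    (mu1 : {measure set T1 -> \bar R}) (mu2 : {measure set T2 -> \bar R})
    (w1 X1 : T1 -> R) (w2 X2 : T2 -> R) :
  measurable_fun setT w1 -> measurable_fun setT X1 -> (forall x, 0 <= w1 x)%R ->
  measurable_fun setT w2 -> measurable_fun setT X2 -> (forall x, 0 <= w2 x)%R ->
  \int[mu1]_x (w1 x)%:E < +oo ->
  \int[mu1]_x (w1 x)%:E = \int[mu2]_x (w2 x)%:E ->
  (forall a, wlaw mu1 w1 X1 `]a, +oo[ = wlaw mu2 w2 X2 `]a, +oo[) ->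
  forall B, measurable B -> wlaw mu1 w1 X1 B = wlaw mu2 w2 X2 B.
Proof.
move=> mw1 mX1 w10 mw2 mX2 w20 foo tot rays.
have E : @measurable _ R = <<s @RGenOInfty.G R >> := RGenOInfty.measurableE R.
have split d (T : measurableType d) (mu : {measure set T -> \bar R})
    (w X : T -> R) (mw : measurable_fun setT w) (mX : measurable_fun setT X)
    (w0 : forall x, (0 <= w x)%R) B :
    measurable B -> \int[mu]_x (w x)%:E = wlaw mu w X (~` B) + wlaw mu w X B.
  move=> mB; rewrite /wlaw -ge0_integral_setU//=.
  - by rewrite -preimage_setU setUC setUv.
  - exact/preimage_measurable/measurableC.
  - exact/preimage_measurable.
  - by apply/measurable_EFinP; exact: measurable_funS mw.
  - by move=> x _; rewrite lee_fin.
  - by rewrite disj_set2E -preimage_setI setIC setICr.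
have wge0 d (T : measurableType d) (mu : {measure set T -> \bar R})
    (w X : T -> R) (w0 : forall x, (0 <= w x)%R) B : 0 <= wlaw mu w X B.
  by apply: integral_ge0 => x _; rewrite lee_fin.
have wU d (T : measurableType d) (mu : {measure set T -> \bar R})
    (w X : T -> R) (mw : measurable_fun setT w) (mX : measurable_fun setT X)
    (w0 : forall x, (0 <= w x)%R) (F : (set R)^nat) :
    (forall n, measurable (F n)) -> trivIset setT F ->
    wlaw mu w X (\bigcup_k F k) = \sum_(k <oo) wlaw mu w X (F k).
  move=> mF tF; rewrite /wlaw preimage_bigcup ge0_integral_bigcup//.
  - by move=> k; exact: preimage_measurable.
  - by apply/measurable_EFinP; exact: measurable_funS mw.
  - by move=> x _; rewrite lee_fin.
  - apply/trivIsetP => i j _ _ ij; rewrite -preimage_setI.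
    by move/trivIsetP : tF => /(_ i j I I ij) ->; rewrite preimage_set0.
move=> B mB.
apply: (@dynkin_induction _ R (@RGenOInfty.G R)
  (fun B => wlaw mu1 w1 X1 B = wlaw mu2 w2 X2 B)) => //.
- move=> _ _ [a ->] [b ->]; exists (Num.max a b).
  by rewrite predeqE => x; rewrite /= !in_itv/= !andbT gt_max; split => /andP.
- by move=> _ [a ->]; exact: rays.
- move=> S mS h.
  have := tot; rewrite (split _ _ _ _ _ mw1 mX1 w10 S mS).
  rewrite (split _ _ _ _ _ mw2 mX2 w20 S mS) -h.
  have fin : wlaw mu1 w1 X1 S \is a fin_num.
    rewrite ge0_fin_numE ?wge0//; apply: le_lt_trans foo.
    by rewrite (split _ _ _ _ _ mw1 mX1 w10 S mS) leeDr// wge0.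
  by move/(congr1 (fun z => z - wlaw mu1 w1 X1 S)); rewrite !addeK.
- by move=> F mF tF FE; rewrite !wU//; apply: eq_eseriesr => k _; exact: FE.
- by rewrite -E.
Qed.

(* Layer cake: [h] is the integral over [s > 0] of the indicators of the
   superlevel sets [{h > s}], so only the laws of these sets matter. *)
Lemma eq_wlaw_integral d1 d2 (T1 : measurableType d1) (T2 : measurableType d2)
    (mu1 : {sigma_finite_measure set T1 -> \bar R})
    (mu2 : {sigma_finite_measure set T2 -> \bar R})
    (w1 X1 : T1 -> R) (w2 X2 : T2 -> R) (h : R -> R) :
  measurable_fun setT w1 -> measurable_fun setT X1 -> (forall x, 0 <= w1 x)%R ->
  measurable_fun setT w2 -> measurable_fun setT X2 -> (forall x, 0 <= w2 x)%R ->
  measurable_fun setT h -> (forall x, 0 <= h x)%R ->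
  (forall B, measurable B -> wlaw mu1 w1 X1 B = wlaw mu2 w2 X2 B) ->
  \int[mu1]_x (w1 x * h (X1 x))%:E = \int[mu2]_x (w2 x * h (X2 x))%:E.
Proof.
move=> mw1 mX1 w10 mw2 mX2 w20 mh h0 weq.
have layer d (T : measurableType d) (mu : {sigma_finite_measure set T -> \bar R})
    (w X : T -> R) (mw : measurable_fun setT w) (mX : measurable_fun setT X)
    (w0 : forall x, (0 <= w x)%R) :
    \int[mu]_x (w x * h (X x))%:E = \int[lebesgue_measure]_(s in `[0%R, +oo[)
       wlaw mu w X (h @^-1` `]s, +oo[).
  transitivity (\int[mu]_x \int[lebesgue_measure]_(s in `[0%R, +oo[)
      (w x * \1_(h @^-1` `]s, +oo[) (X x))%:E).
    apply: eq_integral => x _.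
    transitivity (\int[lebesgue_measure]_(s in `[0%R, +oo[)
        ((w x)%:E * (\1_(`[0%R, h (X x)[%classic) s)%:E)).
      rewrite ge0_integralZl//=; last 2 first.
      - by apply/measurable_EFinP; exact: measurable_indic.
      - by rewrite lee_fin.
      rewrite integral_indic//= setIidl; last first.
        by move=> s /=; rewrite !in_itv/= => /andP[-> _].
      by rewrite lebesgue_measure_itv/= lte_fin; case: ltP => [_|hx];
        rewrite ?sube0// ?EFinM//; have -> : h (X x) = 0%R by
        apply/eqP; rewrite eq_le hx h0.
    apply: eq_integral => s; rewrite inE/= in_itv/= andbT => s0.
    rewrite -EFinM !indicE; congr (w x * (nat_of_bool _)%:R)%:E.
    apply/idP/idP; rewrite !inE/= !in_itv/= andbT.
    - by case/andP.
    - by move=> ->; rewrite s0.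
  rewrite (tonelli_in mu lebesgue_measure (fun (x : T) (s : R) => (w x * \1_(h @^-1` `]s, +oo[%classic) (X x))%:E))//.
  - apply: eq_integral => s _; rewrite wlawE//.
    exact: preimage_measurable.
  - apply/measurable_EFinP/measurable_funM; first exact: measurableT_comp.
    rewrite (_ : (fun z => _) = \1_[set z : T * R | (z.2 < h (X z.1))%R]); last first.
      apply/funext => z; rewrite !indicE; congr (nat_of_bool _)%:R.
      by apply/idP/idP; rewrite !inE/= in_itv/= andbT.
    apply: measurable_indic; rewrite -[X in measurable X]setTI.
    have := @measurable_fun_ltr _ _ _ setT (fun z : T * R => z.2)
      (fun z => h (X z.1)) measurable_snd
      (measurableT_comp mh (measurableT_comp mX measurable_fst)).
    by move/(_ measurableT [set true] _); exact.
  - by move=> x s _ _; rewrite lee_fin mulr_ge0.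
rewrite !layer//; apply: eq_integral => s _; apply: weq.
exact: preimage_measurable.
Qed.

End weighted_law.

(** * Dominated convergence for real-valued integrands *)

Section dominated.
Local Open Scope ereal_scope.
Context {R : realType} d (T : measurableType d) (mu : {measure set T -> \bar R}).

Lemma dominated_cvg_in (D : set T) (f_ : nat -> T -> R) (f g : T -> R) :
  measurable D -> (forall n, measurable_fun D (f_ n)) ->
  (forall x, D x -> f_ n x @[n --> \oo] --> f x) ->
  mu.-integrable D (EFin \o g) -> (forall n x, D x -> (`|f_ n x| <= g x)%R) ->
  \int[mu]_(x in D) (f_ n x)%:E @[n --> \oo] --> \int[mu]_(x in D) (f x)%:E.
Proof.
move=> mD mf cf ig fg.
have mEf n : measurable_fun D (EFin \o f_ n) by exact/measurable_EFinP.
have mEf' : measurable_fun D (EFin \o f).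
  by apply/measurable_EFinP; exact: (measurable_fun_cvg mf).
have cEf : {ae mu, forall x, D x -> (EFin \o f_ n) x @[n --> \oo] --> (EFin \o f) x}.
  by apply: aeW => x Dx; apply: cvg_EFin; [exact: nearW|exact: cf].
have dEf : {ae mu, forall x n, D x -> `|(EFin \o f_ n) x| <= (EFin \o g) x}.
  by apply: aeW => x n Dx /=; rewrite lee_fin fg.
by have [_ _] := dominated_convergence mD mEf mEf' cEf ig dEf.
Qed.

Lemma ge0_integrable_in (D : set T) (g : T -> R) : measurable D -> measurable_fun D g ->
  (forall x, D x -> (0 <= g x)%R) -> \int[mu]_(x in D) (g x)%:E < +oo ->
  mu.-integrable D (EFin \o g).
Proof.
move=> mD mg g0 goo; apply/integrableP; split; first exact/measurable_EFinP.
rewrite (eq_integral (fun x => (g x)%:E))// => x /set_mem Dx /=.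
by rewrite ger0_norm// g0.
Qed.

Lemma dominated_cvg_fin (f_ : nat -> T -> R) (f g : T -> R) :
  (forall n, measurable_fun setT (f_ n)) ->
  (forall x, f_ n x @[n --> \oo] --> f x) ->
  mu.-integrable setT (EFin \o g) -> (forall n x, (`|f_ n x| <= g x)%R) ->
  \int[mu]_x (f_ n x)%:E @[n --> \oo] --> \int[mu]_x (f x)%:E.
Proof.
by move=> mf cf ig fg; apply: (@dominated_cvg_in setT f_ f g).
Qed.

Lemma integrable_weight (w : T -> R) : measurable_fun setT w ->
  (forall x, 0 <= w x)%R -> \int[mu]_x (w x)%:E < +oo ->
  mu.-integrable setT (EFin \o w).
Proof. by move=> mw w0 woo; exact: ge0_integrable_in. Qed.

Lemma integrable_bounded_weight (w h : T -> R) : measurable_fun setT w ->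
  measurable_fun setT h -> (forall x, 0 <= w x)%R ->
  \int[mu]_x (w x)%:E < +oo -> (forall x, `|h x| <= 1)%R ->
  mu.-integrable setT (fun x => (w x * h x)%:E).
Proof.
move=> mw mh w0 woo h1.
apply: (le_integrable measurableT _ _ (integrable_weight mw w0 woo)).
  by apply/measurable_EFinP; exact: measurable_funM.
by move=> x _ /=; rewrite lee_fin normrM ler_piMr.
Qed.

End dominated.

(** * Powers of [1 - e^(-nx)] that approximate indicators of rays *)

Section power_limits.
Context {R : realType}.
Implicit Types (x y a : R).

Lemma onem_expn_ge y N : 0 <= y <= 1 -> 1 - N%:R * y <= (1 - y) ^+ N.
Proof.
move=> /andP[y0 y1]; elim: N => [|N IH]; first by rewrite mul0r subr0 expr0.
rewrite exprS; apply: le_trans (ler_wpM2l _ IH); last by rewrite subr_ge0.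
have N0 : 0 <= N%:R :> R by [].
by rewrite -natr1; nra.
Qed.

Lemma onem_expn_le y N : 0 <= y <= 1 -> (1 - y) ^+ N <= expR (- (N%:R * y)).
Proof.
move=> /andP[y0 y1]; rewrite -mulrN expRM_natl.
by rewrite lerXn2r ?nnegrE ?subr_ge0 ?expR_ge0// expR_ge1Dx.
Qed.

Let N_ a n := Num.truncn (n.+1%:R * expR (n.+1%:R * a)).

(** The exponent times [expR (- (n.+1 * x))] is about [n.+1 * expR (n.+1 * (a - x))]: it tends to 0
    for [x > a] and to infinity for [x <= a]. The factor [n.+1] in [N_] decides the boundary case
    [x = a], where the limit would otherwise be [1/e]. *)
Lemma cvg_onem_expR_gt x a : 0 <= x -> 0 <= a ->
  (1 - expR (- (n.+1%:R * x))) ^+ N_ a n @[n --> \oo] -->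
    (\1_(`]a, +oo[%classic : set R) x : R).
Proof.
move=> x0 a0.
have y01 n : 0 <= expR (- (n.+1%:R * x)) <= 1.
  by rewrite expR_ge0 -expR0 ler_expR oppr_le0 mulr_ge0.
have pw0 n : 0 <= (1 - expR (- (n.+1%:R * x))) ^+ N_ a n.
  by rewrite exprn_ge0// subr_ge0; case/andP: (y01 n).
have pw1 n : (1 - expR (- (n.+1%:R * x))) ^+ N_ a n <= 1.
  by have /andP[h1 h2] := y01 n; rewrite exprn_ile1 ?subr_ge0// lerBlDr lerDl.
have M0 n : 0 <= n.+1%:R * expR (n.+1%:R * a) by rewrite mulr_ge0 ?expR_ge0.
have cvgC (C : R) : C * harmonic n @[n --> \oo] --> (0 : R).
  by rewrite -[X in _ --> X](mulr0 C); apply: cvgMr; exact: cvg_harmonic.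
rewrite indicE; have [ax|xa] := ltP a x.
- rewrite mem_set/=; last by rewrite in_itv/= andbT.
  pose dl := x - a; have dl0 : 0 < dl by rewrite subr_gt0.
  apply: (@squeeze_cvgr _ _ _ _ (fun n => 1 - 4 / dl ^+ 2 * harmonic n) (cst 1)).
  + apply: nearW => n; rewrite pw1 andbT.
    apply: le_trans (onem_expn_ge _ (y01 n)); rewrite lerD2l lerN2.
    apply: le_trans (_ : n.+1%:R * expR (- (n.+1%:R * dl)) <= _).
      rewrite (_ : - (n.+1%:R * dl) = n.+1%:R * a + - (n.+1%:R * x)); last by rewrite /dl; ring.
      by rewrite expRD mulrA ler_wpM2r ?expR_ge0// truncn_le.
    (* The square of [y / 2 <= expR (y / 2)]: the exponential beats the linear factor and leaves
       [4 / (dl ^ 2 * n.+1)]. *)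
    have e4 : (n.+1%:R * dl / 2) ^+ 2 <= expR (n.+1%:R * dl).
      rewrite (_ : n.+1%:R * dl = n.+1%:R * dl / 2 + n.+1%:R * dl / 2); last by field.
      rewrite expRD -expr2 lerXn2r ?nnegrE ?expR_ge0//.
        by rewrite -splitr divr_ge0// mulr_ge0// ltW.
      rewrite -splitr; apply: le_trans (expR_ge1Dx _); by rewrite lerDr.
    have n0 : 0 < n.+1%:R :> R by [].
    rewrite expRN /harmonic ler_pdivrMr ?expR_gt0//.
    apply: le_trans (ler_wpM2l _ e4).
      rewrite le_eqVlt; apply/orP; left; apply/eqP => /=; field.
      by rewrite nat1r !gt_eqF.
    by rewrite mulr_ge0 ?invr_ge0// divr_ge0// exprn_ge0// ltW.
  + by rewrite -[X in _ --> X]subr0; apply: cvgB; [exact: cvg_cst|exact: cvgC].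
  + exact: cvg_cst.
- rewrite memNset/=; last by rewrite /= in_itv/= andbT; apply/negP; rewrite -leNgt.
  apply: (@squeeze_cvgr _ _ _ _ (cst 0) (fun n => 1 * harmonic n)).
  + apply: nearW => n; rewrite pw0/= mul1r.
    apply: le_trans (onem_expn_le _ (y01 n)) _.
    rewrite expRN /harmonic lef_pV2 ?posrE ?expR_gt0//.
    (* Truncation loses less than one in the exponent, so the product is at least [n.+1 - 1]; the
       summand 1 in [1 + z <= expR z] makes up for the loss. *)
    apply: le_trans (expR_ge1Dx _).
    rewrite -lerBlDl (_ : n.+1%:R - 1 = n%:R); last by rewrite -natr1 addrK.
    apply: le_trans (_ : (n.+1%:R * expR (n.+1%:R * a) - 1) * expR (- (n.+1%:R * x)) <= _); last first.
      by rewrite ler_wpM2r ?expR_ge0// lerBlDr natr1 ltW// truncnS_gt.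
    rewrite mulrBl mul1r -mulrA -expRD -mulrBr -natr1.
    have [_ h1] := andP (y01 n).
    have h2 : 1 <= expR ((n%:R + 1) * (a - x)).
      by rewrite -expR0 ler_expR mulr_ge0// subr_ge0.
    have : n%:R + 1 <= (n%:R + 1) * expR ((n%:R + 1) * (a - x)) by rewrite ler_peMr.
    rewrite -natr1 in h1; lra.
  + exact: cvg_cst.
  + exact: cvgC.
Qed.

End power_limits.

(** * Uniqueness of Laplace transforms of finite weighted laws *)

Section laplace.
Local Open Scope ereal_scope.
Context {R : realType} d1 d2 (T1 : measurableType d1) (T2 : measurableType d2).
Variables (mu1 : {measure set T1 -> \bar R}) (mu2 : {measure set T2 -> \bar R}).
Variables (w1 X1 : T1 -> R) (w2 X2 : T2 -> R).
Hypotheses (mw1 : measurable_fun setT w1) (mX1 : measurable_fun setT X1)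
  (w10 : forall x, (0 <= w1 x)%R) (X10 : forall x, (0 <= X1 x)%R)
  (mw2 : measurable_fun setT w2) (mX2 : measurable_fun setT X2)
  (w20 : forall x, (0 <= w2 x)%R) (X20 : forall x, (0 <= X2 x)%R).
Hypotheses (fin1 : \int[mu1]_x (w1 x)%:E < +oo)
  (fin2 : \int[mu2]_x (w2 x)%:E < +oo).

Let expX_bound d (T : measurableType d) (X : T -> R) (l : R) :
  (forall x, 0 <= X x)%R -> (0 <= l)%R -> forall x, (`|expR (- (l * X x))| <= 1)%R.
Proof.
by move=> X0 l0 x; rewrite ger0_norm ?expR_ge0// -expR0 ler_expR oppr_le0 mulr_ge0.
Qed.

Let mexpX d (T : measurableType d) (X : T -> R) (l : R) :
  measurable_fun setT X -> measurable_fun setT (fun x => expR (- (l * X x))).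
Proof.
by move=> mX; apply: measurableT_comp => //; apply: measurableT_comp => //; exact: measurable_funM.
Qed.

Let mass_lim d (T : measurableType d) (mu : {measure set T -> \bar R})
    (w X : T -> R) : measurable_fun setT w -> measurable_fun setT X ->
  (forall x, 0 <= w x)%R -> (forall x, 0 <= X x)%R ->
  \int[mu]_x (w x)%:E < +oo ->
  \int[mu]_x (w x * expR (- (harmonic n * X x)))%:E @[n --> \oo] -->
  \int[mu]_x (w x)%:E.
Proof.
move=> mw mX w0 X0 fin.
apply: (dominated_cvg_fin (g := w)).
- by move=> n; apply: measurable_funM => //; exact: mexpX.
- move=> x; rewrite -[X in _ --> X]mulr1; apply: cvgM; first exact: cvg_cst.
  rewrite -expR0; apply: continuous_cvg; first exact: continuous_expR.
  rewrite -[X in _ --> X]oppr0; apply: cvgN.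
  rewrite -[X in _ --> X](mul0r (X x)); apply: cvgM; last exact: cvg_cst.
  exact: cvg_harmonic.
- exact: integrable_weight.
- move=> n x; rewrite normrM (ger0_norm (w0 x)) ler_piMr//.
  by apply: expX_bound => //; rewrite /harmonic invr_ge0.
Qed.

Hypothesis eq_laplace : forall l : R, (0 < l)%R ->
  \int[mu1]_x (w1 x * expR (- (l * X1 x)))%:E =
  \int[mu2]_x (w2 x * expR (- (l * X2 x)))%:E.

(** Equality of the transforms is assumed only for [l > 0]; the total masses are their limits along
    [l = harmonic n]. *)
Lemma laplace_mass : \int[mu1]_x (w1 x)%:E = \int[mu2]_x (w2 x)%:E.
Proof.
have h1 := mass_lim mw1 mX1 w10 X10 fin1.
have h2 := mass_lim mw2 mX2 w20 X20 fin2.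
apply: (cvg_unique _ h1) => //.
rewrite (_ : (fun n => _) = (fun n =>
  \int[mu2]_x (w2 x * expR (- (harmonic n * X2 x)))%:E))//.
by apply/funext => n; rewrite eq_laplace// /harmonic invr_gt0.
Qed.

Let eq_laplace0 (l : R) : (0 <= l)%R ->
  \int[mu1]_x (w1 x * expR (- (l * X1 x)))%:E =
  \int[mu2]_x (w2 x * expR (- (l * X2 x)))%:E.
Proof.
rewrite le_eqVlt => /predU1P[<-|]; last exact: eq_laplace.
under eq_integral do rewrite mul0r oppr0 expR0 mulr1.
under [RHS]eq_integral do rewrite mul0r oppr0 expR0 mulr1.
exact: laplace_mass.
Qed.

Let pol d (T : measurableType d) (X : T -> R) (n l : R) N x :=
  (expR (- (l * X x)) * (1 - expR (- (n * X x))) ^+ N)%R.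

(** From [(1 - z) ^ (N + 1) = (1 - z) ^ N - z (1 - z) ^ N] with [z = expR (- (n * X))]. This
    recursion, which moves [l] to [l + n], takes the place of a binomial expansion. *)
Let pol_step d (T : measurableType d) (mu : {measure set T -> \bar R})
    (w X : T -> R) (n l : R) N : measurable_fun setT w -> measurable_fun setT X ->
  (forall x, 0 <= w x)%R -> (forall x, 0 <= X x)%R ->
  \int[mu]_x (w x)%:E < +oo -> (0 <= n)%R -> (0 <= l)%R ->
  \int[mu]_x (w x * pol X n l N.+1 x)%:E =
  \int[mu]_x (w x * pol X n l N x)%:E - \int[mu]_x (w x * pol X n (l + n) N x)%:E.
Proof.
move=> mw mX w0 X0 fin n0 l0.
have mpol k : measurable_fun setT (pol X n k N).
  apply: measurable_funM; first exact: mexpX.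
  apply: measurable_funX; apply: measurable_funB => //; exact: mexpX.
have ipol k : (0 <= k)%R -> mu.-integrable setT (fun x => (w x * pol X n k N x)%:E).
  move=> k0; apply: integrable_bounded_weight => // x.
  have h z : (0 <= z)%R -> (0 <= expR (- (z * X x)) <= 1)%R.
    by move=> z0; rewrite expR_ge0 -expR0 ler_expR oppr_le0 mulr_ge0.
  rewrite normrM normrX; apply: mulr_ile1 => //; first exact: expX_bound.
  have /andP[h1 h2] := h _ n0.
  by apply: exprn_ile1 => //; rewrite ger0_norm ?subr_ge0// lerBlDr lerDl.
rewrite -integralB_EFin//; [|exact: ipol|by apply: ipol; rewrite addr_ge0].
apply: eq_integral => x _; rewrite -EFinB /pol exprS.
by rewrite (_ : - ((l + n) * X x) = - (l * X x) + - (n * X x))%R; [rewrite expRD; congr EFin; ring|ring].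
Qed.

Let eq_pol (n : R) N : (0 <= n)%R -> forall l : R, (0 <= l)%R ->
  \int[mu1]_x (w1 x * pol X1 n l N x)%:E = \int[mu2]_x (w2 x * pol X2 n l N x)%:E.
Proof.
move=> n0; elim: N => [|N IH] l l0.
  have := eq_laplace0 l0; rewrite /pol.
  under eq_integral do rewrite -[expR _]mulr1.
  under [X in _ = X -> _]eq_integral do rewrite -[expR _]mulr1.
  by move=> h; under eq_integral do rewrite expr0; rewrite h; apply: eq_integral => x _; rewrite expr0.
by rewrite !pol_step// !IH// addr_ge0.
Qed.

Let ray_lim d (T : measurableType d) (mu : {measure set T -> \bar R})
    (w X : T -> R) (a : R) : measurable_fun setT w -> measurable_fun setT X ->
  (forall x, 0 <= w x)%R -> (forall x, 0 <= X x)%R ->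
  \int[mu]_x (w x)%:E < +oo -> (0 <= a)%R ->
  \int[mu]_x (w x * pol X n.+1%:R 0 (Num.truncn (n.+1%:R * expR (n.+1%:R * a))%R) x)%:E
    @[n --> \oo] --> wlaw mu w X `]a, +oo[.
Proof.
move=> mw mX w0 X0 fin a0; rewrite wlawE//.
apply: (dominated_cvg_fin (g := w)).
- move=> n; apply: measurable_funM => //; apply: measurable_funM; first exact: mexpX.
  apply: measurable_funX; apply: measurable_funB => //; exact: mexpX.
- move=> x; apply: cvgM; first exact: cvg_cst.
  rewrite /pol; under eq_fun do rewrite mul0r oppr0 expR0 mul1r.
  exact: cvg_onem_expR_gt.
- exact: integrable_weight.
- move=> n x; rewrite normrM (ger0_norm (w0 x)) ler_piMr//.
  rewrite /pol mul0r oppr0 expR0 mul1r normrX.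
  have /andP[h1 h2] : (0 <= expR (- (n.+1%:R * X x)) <= 1)%R.
    by rewrite expR_ge0 -expR0 ler_expR oppr_le0 mulr_ge0.
  by apply: exprn_ile1 => //; rewrite ger0_norm ?subr_ge0// lerBlDr lerDl.
Qed.

(** Rays with [a >= 0] are limits of polynomials in exponentials, whose integrals agree; a ray with
    [a < 0] carries the whole mass because [X1] and [X2] are nonnegative. *)
Theorem laplace_unique B : measurable B -> wlaw mu1 w1 X1 B = wlaw mu2 w2 X2 B.
Proof.
move: B; apply: eq_wlaw_rays => //; first exact: laplace_mass.
move=> a; have [a0|a0] := leP 0%R a.
  have h1 := ray_lim mw1 mX1 w10 X10 fin1 a0.
  have h2 := ray_lim mw2 mX2 w20 X20 fin2 a0.
  apply: (cvg_unique _ h1) => //.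
  move: h2; under eq_fun do rewrite -eq_pol//.
  exact.
rewrite /wlaw (_ : X1 @^-1` _ = setT); last first.
  by apply/seteqP; split => // x _ /=; rewrite in_itv/= andbT (lt_le_trans a0).
rewrite (_ : X2 @^-1` _ = setT); first exact: laplace_mass.
by apply/seteqP; split => // x _ /=; rewrite in_itv/= andbT (lt_le_trans a0).
Qed.

End laplace.

(** * The fundamental theorem of calculus on open and unbounded intervals *)

Section open_ftc.
Local Open Scope ereal_scope.
Context {R : realType}.
Implicit Types (f F : R -> R) (a b A B : R).

(** Compact intervals increase to [D]. As the integrand is nonnegative, monotone convergence gives
    the integral over [D] without any prior integrability, even if [f] blows up at an end. *)
Let ftc_exhaust f F A B (D : set R) (u v : nat -> R) :
  D = \bigcup_n `[u n, v n]%classic -> (forall n, u n < v n)%R ->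
  nonincreasing_seq u -> nondecreasing_seq v ->
  (forall x, D x -> is_derive x 1%R F (f x)) ->
  (forall x, D x -> {for x, continuous f}) -> (forall x, D x -> 0 <= f x)%R ->
  F (u n) @[n --> \oo] --> A -> F (v n) @[n --> \oo] --> B ->
  \int[lebesgue_measure]_(x in D) (f x)%:E = (B - A)%:E.
Proof.
move=> DE uv ni nd dF cf f0 FA FB.
have sub n x : `[u n, v n]%classic x -> D x by move=> h; rewrite DE; exists n.
have cF x : D x -> {for x, continuous F}.
  move=> Dx; apply: differentiable_continuous; apply/derivable1_diffP.
  by have [] := dF _ Dx.
have cwf n : {within `[u n, v n], continuous f}.
  by apply: continuous_in_subspaceT => x /set_mem /sub /cf.
have int_n n : \int[lebesgue_measure]_(x in `[u n, v n]) (f x)%:E =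
    (F (v n) - F (u n))%:E.
  rewrite (continuous_FTC2 (uv n) (cwf n) (F := F)) ?EFinB//.
  - split.
    + by move=> x /subset_itv_oo_cc /sub /dF [].
    + apply: cvg_at_right_filter; apply: cF; apply: (sub n).
      by rewrite /= in_itv/= lexx ltW.
    + apply: cvg_at_left_filter; apply: cF; apply: (sub n).
      by rewrite /= in_itv/= lexx ltW.
  - move=> x /subset_itv_oo_cc /sub /dF df.
    by rewrite derive1E; exact: derive_val.
apply: (@cvg_unique _ _ (\int[lebesgue_measure]_(x in `[u n, v n]) (f x)%:E @[n --> \oo])) => //.
- rewrite DE; apply: ge0_nondecreasing_set_cvg_integral => //.
  + move=> m n mn; rewrite subsetEset => x /=; rewrite !in_itv/= => /andP[ux xv].
    by rewrite (le_trans (ni _ _ mn) ux) (le_trans xv (nd _ _ mn)).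
  + move=> n; apply/measurable_EFinP.
    exact: subspace_continuous_measurable_fun.
  + by move=> n x /sub /f0; rewrite lee_fin.
- rewrite (_ : (fun n => _) = (fun n => (F (v n) - F (u n))%:E)); last exact/funext.
  apply: cvg_EFin; first exact: nearW.
  exact: cvgB.
Qed.

Lemma ftc_oo f F a b A B : (a < b)%R ->
  (forall x, a < x < b -> is_derive x 1%R F (f x))%R ->
  (forall x, a < x < b -> {for x, continuous f})%R ->
  (forall x, a < x < b -> 0 <= f x)%R ->
  F x @[x --> a^'+] --> A -> F x @[x --> b^'-] --> B ->
  \int[lebesgue_measure]_(x in `]a, b[) (f x)%:E = (B - A)%:E.
Proof.
move=> ab dF cf f0 FA FB.
have ba0 : (0 < b - a)%R by rewrite subr_gt0.
(* Each end is moved by at most a third of the length, so the compact intervals are never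
   degenerate. *)
pose e n : R := ((b - a) / 3 * harmonic n)%R.
have e0 n : (0 < e n)%R by rewrite /e !mulr_gt0 ?invr_gt0.
have e3 n : (e n <= (b - a) / 3)%R.
  by rewrite /e ler_piMr ?divr_ge0 ?(ltW ba0)//= invf_le1// ler1n.
have ecvg : e n @[n --> \oo] --> (0:R)%R.
  rewrite -[X in _ --> X](mulr0 ((b - a) / 3)%R); apply: cvgMr; exact: cvg_harmonic.
have eni m n : (m <= n)%N -> (e n <= e m)%R.
  move=> mn; rewrite /e ler_wpM2l ?divr_ge0 ?(ltW ba0)//.
  by rewrite /= lef_pV2 ?posrE ?ltr0n// ler_nat.
apply: (@ftc_exhaust f F A B _ (fun n => a + e n)%R (fun n => b - e n)%R).
- apply/seteqP; split => x /=.
  + rewrite in_itv/= => /andP[ax xb].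
    pose m := Num.min (x - a)%R (b - x)%R.
    have m0 : (0 < m)%R by rewrite lt_min !subr_gt0 ax.
    have /cvgrPdist_lt /(_ _ m0) [n _ /(_ n (leqnn n))] := ecvg.
    rewrite /= sub0r normrN gtr0_norm// lt_min => /andP[h1 h2].
    by exists n => //=; rewrite in_itv/=; lra.
  + move=> [n _ /=]; rewrite !in_itv/= => /andP[h1 h2].
    by have := e0 n; lra.
- by move=> n; have := e3 n; lra.
- by move=> m n mn /=; rewrite lerD2l eni.
- by move=> m n mn /=; rewrite lerD2l lerN2 eni.
- by move=> x /=; rewrite in_itv/=; exact: cf.
- by move=> x /=; rewrite in_itv/=; exact: f0.
- move/cvg_at_rightP : FA; apply; split; first by move=> n; rewrite ltrDl.
  by rewrite -[X in _ --> X]addr0; apply: cvgD; [exact: cvg_cst|exact: ecvg].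
- move/cvg_at_leftP : FB; apply; split; first by move=> n; rewrite ltrBlDr ltrDl.
  by rewrite -[X in _ --> X]subr0; apply: cvgB; [exact: cvg_cst|exact: ecvg].
Qed.

Lemma ftc_oy f F a A B :
  (forall x, a < x -> is_derive x 1%R F (f x))%R ->
  (forall x, a < x -> {for x, continuous f})%R ->
  (forall x, a < x -> 0 <= f x)%R ->
  F x @[x --> a^'+] --> A -> F x @[x --> +oo%R] --> B ->
  \int[lebesgue_measure]_(x in `]a, +oo[) (f x)%:E = (B - A)%:E.
Proof.
move=> dF cf f0 FA FB.
(* At most [1/2], while the right end lies at distance at least 1 from [a]. *)
pose e n : R := (harmonic n / 2)%R.
have e0 n : (0 < e n)%R by rewrite /e divr_gt0// invr_gt0.
have e1 n : (e n <= 1 / 2)%R.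
  by rewrite /e ler_wpM2r ?invr_ge0// /= invf_le1// ler1n.
have ecvg : e n @[n --> \oo] --> (0:R)%R.
  rewrite -[X in _ --> X](mul0r (2^-1)%R); apply: cvgMl; exact: cvg_harmonic.
have eni m n : (m <= n)%N -> (e n <= e m)%R.
  move=> mn; rewrite /e ler_wpM2r ?invr_ge0//.
  by rewrite /= lef_pV2 ?posrE ?ltr0n// ler_nat.
apply: (@ftc_exhaust f F A B _ (fun n => a + e n)%R (fun n => a + n.+1%:R)%R).
- apply/seteqP; split => x /=.
  + rewrite in_itv/= andbT => ax.
    have m0 : (0 < x - a)%R by rewrite subr_gt0.
    have /cvgrPdist_lt /(_ _ m0) [n _ hn] := ecvg.
    pose N := maxn n (Num.truncn (x - a)).
    exists N => //=; rewrite in_itv/=; apply/andP; split.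
      have := hn N (leq_maxl _ _); rewrite /= sub0r normrN gtr0_norm//; lra.
    rewrite -lerBlDl; apply: (le_trans (ltW (truncnS_gt _))).
    by rewrite ler_nat ltnS leq_maxr.
  + move=> [n _ /=]; rewrite !in_itv/= => /andP[h1 h2].
    by have := e0 n; rewrite andbT; lra.
- move=> n; rewrite ltrD2l; apply: (le_lt_trans (e1 n)).
  by apply: (@lt_le_trans _ _ 1%R); [lra|rewrite ler1n].
- by move=> m n mn /=; rewrite lerD2l eni.
- by move=> m n mn /=; rewrite lerD2l ler_nat.
- by move=> x /=; rewrite in_itv/= andbT; exact: dF.
- by move=> x /=; rewrite in_itv/= andbT; exact: cf.
- by move=> x /=; rewrite in_itv/= andbT; exact: f0.
- move/cvg_at_rightP : FA; apply; split; first by move=> n; rewrite ltrDl.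
  by rewrite -[X in _ --> X]addr0; apply: cvgD; [exact: cvg_cst|exact: ecvg].
- move/cvg_pinftyP : FB; apply; apply/cvgryPge => M.
  exists (Num.truncn (M - a)) => // n /= hn.
  rewrite -lerBlDl; apply: (le_trans (ltW (truncnS_gt _))).
  by rewrite ler_nat ltnS.
Qed.

End open_ftc.

(** * Affine change of variables for Lebesgue measure *)

Section affine.
Local Open Scope ereal_scope.
Context {R : realType}.

Let affine (c b x : R) : R := (c * x + b)%R.

Let maffine c b : measurable_fun setT (affine c b : _ -> measurableTypeR R).
Proof. by apply: measurable_funD => //; exact: measurable_funM. Qed.

(** The rescaled image measure agrees with Lebesgue measure on half-open intervals, and these
    determine it. *)
Lemma lebesgue_affine (c b : R) (B : set R) : (0 < c)%R -> measurable B ->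
  lebesgue_measure B = c%:E * lebesgue_measure (affine c b @^-1` B).
Proof.
move=> c0.
have cnn : (0 <= c)%R by exact: ltW.
move: B; apply: (@lebesgue_measure_unique R
  (mscale (NngNum cnn) (pushforward lebesgue_measure (affine c b : _ -> measurableTypeR R)))).
  exact: maffine.
move=> ? _ [[x y] _ <-] /=.
rewrite /mscale/= /pushforward.
have -> : affine c b @^-1` `]x, y] = `]((x - b) / c)%R, ((y - b) / c)%R]%classic.
  apply/seteqP; split => z /=; rewrite !in_itv/= /affine ltr_pdivrMr// ler_pdivlMr//;
    by rewrite ltrBlDr lerBrDr mulrC.
rewrite !lebesgue_measure_itv/= !lte_fin ltr_pM2r ?invr_gt0// ltrD2r.
case: ltP => _; last by rewrite mule0.
by rewrite -!EFinB -EFinM; congr EFin; field; rewrite gt_eqF.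
Qed.

Lemma integral_affine (c b : R) (f : R -> \bar R) : (0 < c)%R ->
  measurable_fun setT f -> (forall x, 0 <= f x) ->
  \int[lebesgue_measure]_x f x = c%:E * \int[lebesgue_measure]_x f (c * x + b)%R.
Proof.
move=> c0 mf f0; have cnn : (0 <= c)%R by exact: ltW.
have [cinn cV0] : (0 <= c^-1)%R /\ c != 0%R by rewrite invr_ge0 gt_eqF.
rewrite -[RHS]/(c%:E * \int[lebesgue_measure]_x (f \o affine c b) x).
have := @ge0_integral_pushforward _ _ (measurableTypeR R) (measurableTypeR R) R
  (affine c b) (maffine c b) lebesgue_measure setT f measurableT mf (in1W f0).
rewrite preimage_setT => <-.
transitivity (c%:E * \int[mscale (NngNum cinn) lebesgue_measure]_x f x).
  by rewrite ge0_integral_mscale//= muleA -EFinM divff// mul1e.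
congr (_ * _); apply: eq_measure_integral => [|mA B mB _]; first exact: maffine.
rewrite -[LHS]/(c^-1%:E * lebesgue_measure B).
rewrite -[RHS]/(lebesgue_measure (affine c b @^-1` B)).
by rewrite (lebesgue_affine b c0 mB) muleA -EFinM mulVf// mul1e.
Qed.

End affine.

(** * Elementary integrals and the functional equation of the Gamma function *)

Section gamma.
Local Open Scope ereal_scope.
Context {R : realType}.
Implicit Types (s c a u : R).

Lemma is_derive_expRM c (x : R) :
  is_derive x 1%R (fun x : R => expR (c * x)) (c * expR (c * x))%R.
Proof.
have h : is_derive x 1%R (fun y : R => c * y)%R c.
  by apply: is_derive_eq; rewrite /GRing.scale/= mulr1.
have := is_derive1_comp (is_derive_expR (c * x)%R) h.
by rewrite mulrC.
Qed.

Lemma is_derive_powR (s x : R) : (0 < x)%R ->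
  is_derive x 1%R (fun x : R => x `^ s)%R (s * x `^ (s - 1))%R.
Proof. exact: is_derive1_powR. Qed.

Lemma continuous_powR (s x : R) : (0 < x)%R ->
  {for x, continuous (fun x : R => x `^ s)%R}.
Proof.
move=> x0; apply: differentiable_continuous; apply/derivable1_diffP.
by have [] := is_derive_powR s x0.
Qed.

Lemma cvg_expRN_pinfty c : (0 < c)%R -> expR (- (c * x)) @[x --> +oo%R] --> (0:R)%R.
Proof.
move=> c0; apply: (@squeeze_cvgr _ _ _ _ (cst 0%R) (fun x => (c * x)^-1)%R).
- near=> x; rewrite expR_ge0/= expRN lef_pV2 ?posrE ?expR_gt0//.
    by apply: le_trans (expR_ge1Dx _); rewrite lerDr.
  by rewrite mulr_gt0.
- exact: cvg_cst.
- rewrite gtr0_cvgV0; first exact: gt0_cvgMry.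
  by near=> x; rewrite mulr_gt0.
Unshelve. all: by end_near. Qed.

Lemma integral_expR_tail c u : (0 < c)%R ->
  \int[lebesgue_measure]_(a in `]u, +oo[) (expR (- (c * a)))%:E =
  (expR (- (c * u)) / c)%:E.
Proof.
move=> c0.
have dF (x : R) : is_derive x 1%R (fun x => - c^-1 * expR ((- c) * x))%R (expR (- (c * x))).
  have := is_deriveZ (- c^-1)%R (is_derive_expRM (- c)%R x).
  rewrite /GRing.scale/= mulrA mulrNN mulVf ?gt_eqF// mul1r mulNr; exact.
have cF (x : R) : {for x, continuous (fun x => - c^-1 * expR ((- c) * x))%R}.
  by apply: differentiable_continuous; apply/derivable1_diffP; have [] := dF x.
rewrite (@ftc_oy _ _ (fun x => - c^-1 * expR ((- c) * x))%R u (- c^-1 * expR (- c * u))%R 0%R).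
- by rewrite sub0r mulNr opprK mulrC mulNr.
- move=> x _.
  apply: differentiable_continuous; apply/derivable1_diffP.
  by have [h _] := is_derive_expRM (- c)%R x; move: h; under eq_fun do rewrite mulNr.
- by move=> x _; exact: expR_ge0.
- exact/cvg_at_right_filter/cF.
- rewrite -[X in _ --> X](mulr0 (- c^-1)%R); apply: cvgMr.
  by under eq_fun do rewrite mulNr; exact: cvg_expRN_pinfty.
Qed.

Lemma integral_powR_head s a : (0 < s)%R -> (0 < a)%R ->
  \int[lebesgue_measure]_(u in `]0%R, a[) (s * u `^ (s - 1))%:E = (a `^ s)%:E.
Proof.
move=> s0 a0.
have dF x : (0 < x < a)%R -> is_derive x 1%R (fun x => x `^ s)%R (s * x `^ (s - 1))%R.
  by move=> /andP[x0 _]; exact: is_derive_powR.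
rewrite (ftc_oo (A := 0%R) (B := (a `^ s)%R) a0 dF) ?subr0//.
- move=> x /andP[x0 _].
  by apply: continuousM; [exact: cst_continuous|exact: continuous_powR].
- by move=> x /andP[x0 _]; rewrite mulr_ge0 ?powR_ge0// ltW.
- exact: powR_cvg0.
- exact/cvg_at_left_filter/continuous_powR.
Qed.

(** Euler's integral in the extended reals: the functional equation is proved at this level, before
    finiteness is known. *)
Definition gammaE s : \bar R :=
  \int[lebesgue_measure]_(a in `]0%R, +oo[) (a `^ (s - 1) * expR (- a))%:E.

Lemma measurable_gamma_integrand s c :
  measurable_fun [set: R] (fun a : R => a `^ (s - 1) * expR (- (c * a)))%R.
Proof.
apply: measurable_funM; first exact: measurable_powR.
by apply: measurableT_comp => //; apply: measurableT_comp => //; exact: measurable_funM.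
Qed.

Lemma measurable_gamma_integrand1 s :
  measurable_fun [set: R] (fun a : R => a `^ (s - 1) * expR (- a))%R.
Proof.
have := measurable_gamma_integrand s 1%R.
by under eq_fun do rewrite mul1r.
Qed.

(* Tonelli applied to [a ^ s = \int_0^a s * u ^ (s - 1)]: no boundary terms. *)
Lemma gammaE_succ s : (0 < s)%R -> gammaE (s + 1) = s%:E * gammaE s.
Proof.
move=> s0; rewrite /gammaE.
transitivity (\int[lebesgue_measure]_(a in `]0%R, +oo[)
    \int[lebesgue_measure]_(u in `]0%R, +oo[)
     (s * u `^ (s - 1) * (\1_[set z : R * R | z.2 < z.1] (a, u) * expR (- a)))%R%:E).
  apply: eq_integral => a; rewrite inE/= in_itv/= andbT => a0.
  rewrite addrK EFinM -(integral_powR_head s0 a0) -ge0_integralZr//; last 2 first.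
  - apply/measurable_EFinP/measurable_funM => //.
    by apply: measurable_funS (measurable_powR _).
  - by move=> u _; rewrite lee_fin mulr_ge0 ?powR_ge0// ltW.
  rewrite integral_mkcond [RHS]integral_mkcond; apply: eq_integral => u _.
  rewrite !patchE !mem_setE !in_itv/= andbT indicE.
  rewrite (_ : ((a, u) \in _) = (u < a)%R); last by apply/idP/idP; rewrite inE.
  by case: ltP => //= u0; case: ltP => //= ua; rewrite ?mul1r ?mul0r ?mulr0.
rewrite (tonelli_in lebesgue_measure lebesgue_measure (fun a u : R =>
   (s * u `^ (s - 1) * (\1_[set z : R * R | z.2 < z.1] (a, u) * expR (- a)))%R%:E))//.
- rewrite -ge0_integralZl//; last 3 first.
  - apply/measurable_EFinP; apply: measurable_funS (measurable_gamma_integrand1 s) => //.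
  - by move=> u _; rewrite lee_fin mulr_ge0 ?powR_ge0 ?expR_ge0.
  - by rewrite lee_fin ltW.
  apply: eq_integral => u; rewrite inE/= in_itv/= andbT => u0.
  rewrite -EFinM mulrA EFinM (_ : expR (- u) = expR (- (1 * u)) / 1)%R; last by rewrite mul1r divr1.
  rewrite -integral_expR_tail// -ge0_integralZl//; last 2 first.
  - apply/measurable_EFinP/measurableT_comp => //; apply: measurableT_comp => //.
  - by rewrite lee_fin mulr_ge0 ?powR_ge0// ltW.
  rewrite [LHS]integral_mkcond [RHS]integral_mkcond; apply: eq_integral => a _.
  rewrite !patchE !mem_setE !in_itv/= !andbT mul1r indicE.
  rewrite (_ : ((a, u) \in _) = (u < a)%R); last by apply/idP/idP; rewrite inE.
  have [ua|ua] := ltP u a; first by rewrite (lt_trans u0 ua) mul1r.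
  by case: ifP => // _; rewrite mul0r mulr0.
- apply/measurable_EFinP; apply: measurable_funM.
    apply: measurable_funM => //.
    exact: (measurableT_comp (measurable_powR (s - 1)%R) measurable_snd).
  apply: measurable_funM.
    apply: measurable_indic; rewrite -[X in measurable X]setTI.
    have := @measurable_fun_ltr _ _ _ setT (fun z : R * R => z.2) (fun z : R * R => z.1)
      measurable_snd measurable_fst.
    by move/(_ measurableT [set true] _); exact.
  by apply: measurableT_comp => //; apply: measurableT_comp => //.
- move=> a u _ _; rewrite lee_fin mulr_ge0 ?mulr_ge0 ?powR_ge0 ?expR_ge0//; exact: ltW.
Qed.

End gamma.

(** * The Gamma function: finiteness, positivity, scaling *)

Section gamma_fun.
Local Open Scope ereal_scope.
Context {R : realType}.
Implicit Types (s c a u : R).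

Lemma gammaE_ge0 s : 0 <= gammaE s.
Proof. by apply: integral_ge0 => a _; rewrite lee_fin mulr_ge0 ?powR_ge0 ?expR_ge0. Qed.

Lemma gammaE1 : gammaE (1 : R) = 1.
Proof.
have := integral_expR_tail (0 : R)%R ltr01; rewrite mulr0 oppr0 expR0 divr1 => <-.
by apply: eq_integral => a _; rewrite subrr powRr0 !mul1r.
Qed.

Lemma gammaE_nat n : gammaE (n%:R + 1 : R) = (n`!%:R)%:E.
Proof.
elim: n => [|n IH]; first by rewrite add0r gammaE1.
by rewrite gammaE_succ ?ltr0n// -natr1 IH -EFinM factS natrM -natr1.
Qed.

(** By the functional equation it suffices to treat [s + 1], which removes the singularity at 0.
    There [a ^ s <= 1 + a ^ N] with [N] an integer above [s], and the two resulting integrals are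
    factorials. *)
Lemma gammaE_lty s : (0 < s)%R -> gammaE s < +oo.
Proof.
move=> s0.
suff : gammaE (s + 1) < +oo.
  rewrite gammaE_succ//.
  case E : (gammaE s) => [r| |].
  - by move=> _; exact: ltry.
  - by rewrite gt0_muley ?lte_fin.
  - by have := gammaE_ge0 s; rewrite E.
pose N := (Num.truncn s).+1.
have sN : (s <= N%:R)%R by exact/ltW/truncnS_gt.
apply: (@le_lt_trans _ _ (gammaE 1 + gammaE (N%:R + 1))); last first.
  by rewrite gammaE1 gammaE_nat -EFinD ltry.
rewrite /gammaE -ge0_integralD//; last 4 first.
- by move=> a _; rewrite lee_fin mulr_ge0 ?powR_ge0 ?expR_ge0.
- by apply/measurable_EFinP; apply: measurable_funS (measurable_gamma_integrand1 _).
- by move=> a _; rewrite lee_fin mulr_ge0 ?powR_ge0 ?expR_ge0.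
- by apply/measurable_EFinP; apply: measurable_funS (measurable_gamma_integrand1 _).
apply: ge0_le_integral => //.
- by move=> a _; rewrite lee_fin mulr_ge0 ?powR_ge0 ?expR_ge0.
- by apply/measurable_EFinP; apply: measurable_funS (measurable_gamma_integrand1 _).
- apply: emeasurable_funD; by apply/measurable_EFinP; apply: measurable_funS (measurable_gamma_integrand1 _).
move=> a /=; rewrite in_itv/= andbT => a0.
rewrite lee_fin -mulrDl ler_wpM2r ?expR_ge0// !addrK subrr powRr0.
have [a1|a1] := leP a 1%R.
  have : (a `^ s <= 1 `^ s)%R.
    by apply: ge0_ler_powR; rewrite ?nnegrE//; apply: ltW.
  by rewrite powR1; move: (powR_ge0 a N%:R); lra.
rewrite (le_trans _ (_ : a `^ N%:R <= _)%R) ?lerDr//.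
by rewrite ler_powR// ltW.
Qed.

Lemma Gamma_funE s : (0 < s)%R -> gammaE s = (Gamma_fun s)%:E.
Proof.
move=> s0; rewrite /Gamma_fun /Rintegral fineK// ge0_fin_numE ?gammaE_ge0//.
exact: gammaE_lty.
Qed.

Lemma Gamma_funS s : (0 < s)%R -> Gamma_fun (s + 1) = (s * Gamma_fun s)%R.
Proof.
move=> s0; apply: EFin_inj; rewrite EFinM -!Gamma_funE ?addr_gt0//.
exact: gammaE_succ.
Qed.

Lemma Gamma_fun_nat n : Gamma_fun (n%:R + 1 : R) = n`!%:R.
Proof. by apply: EFin_inj; rewrite -Gamma_funE ?ltr_wpDl// gammaE_nat. Qed.

Lemma Gamma_fun_gt0 s : (0 < s)%R -> (0 < Gamma_fun s)%R.
Proof.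
move=> s0; rewrite -lte_fin -Gamma_funE//.
(* A lower bound of the integrand on []1, 2[], where [0 <= ln a <= 1] and [a < 2]. *)
pose k := expR (- (`|s - 1| + 2))%R.
apply: (@lt_le_trans _ _ (\int[lebesgue_measure]_(a in `]1%R, 2%R[) k%:E)).
  rewrite integral_cst//= lebesgue_measure_itv/= lte_fin ltr1n/= -EFinB -EFinM.
  by rewrite lte_fin mulr_gt0 ?expR_gt0//; lra.
apply: (@le_trans _ _ (\int[lebesgue_measure]_(a in `]1%R, 2%R[) (a `^ (s - 1) * expR (- a))%:E)).
  apply: ge0_le_integral => //.
  - by move=> a _; rewrite lee_fin expR_ge0.
  - by apply/measurable_EFinP; apply: measurable_funS (measurable_gamma_integrand1 _).
  move=> a /=; rewrite in_itv/= => /andP[a1 a2].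
  have a0 : (0 < a)%R by lra.
  rewrite lee_fin /powR gt_eqF// -expRD ler_expR.
  have l0 : (0 <= ln a)%R by rewrite ln_ge0// ltW.
  have l1 : (ln a <= 1)%R.
    have : (ln (1 + (a - 1)) <= a - 1)%R by apply: le_ln1Dx; lra.
    rewrite (_ : 1 + (a - 1) = a)%R; [lra|ring].
  have : (- `|s - 1| <= (s - 1) * ln a)%R.
    rewrite lerNl -mulNr; apply: le_trans (ler_norm _) _.
    by rewrite normrM normrN ler_piMr// ger0_norm.
  by lra.
apply: ge0_subset_integral => //.
- by apply/measurable_EFinP; apply: measurable_funS (measurable_gamma_integrand1 _).
- by move=> a _; rewrite lee_fin mulr_ge0 ?powR_ge0 ?expR_ge0.
- by move=> a /=; rewrite !in_itv/= andbT; lra.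
Qed.

Lemma integral_gamma_scale s c : (0 < s)%R -> (0 < c)%R ->
  \int[lebesgue_measure]_(a in `]0%R, +oo[) (a `^ (s - 1) * expR (- (c * a)))%:E =
  (Gamma_fun s * c `^ (- s))%:E.
Proof.
move=> s0 c0.
pose f a : \bar R := (\1_(`]0%R, +oo[%classic : set R) a * (a `^ (s - 1) * expR (- a)))%:E.
have mf : measurable_fun setT f.
  apply/measurable_EFinP/measurable_funM; last exact: measurable_gamma_integrand1.
  exact: measurable_indic.
have f0 a : 0 <= f a by rewrite lee_fin !mulr_ge0 ?powR_ge0 ?expR_ge0.
have gE : gammaE s = \int[lebesgue_measure]_a f a.
  rewrite /gammaE integral_mkcond; apply: eq_integral => a _.
  by rewrite patchE /f indicE; case: ifP; rewrite ?mul1r ?mul0r.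
have := integral_affine 0%R c0 mf f0; rewrite -gE Gamma_funE// => h.
have c1 : (c != 0)%R by rewrite gt_eqF.
have -> : (Gamma_fun s * c `^ (- s))%:E = (c `^ (- (s - 1)) * c^-1)%:E * (Gamma_fun s)%:E.
  rewrite -EFinM mulrC; congr ((_ * _)%:E).
  rewrite -[X in (_ * X)%R]powR_inv1 ?ltW// -powRD; last by rewrite c1 implybT.
  by congr (c `^ _)%R; ring.
rewrite h muleA -EFinM -mulrA mulVf// mulr1.
rewrite -ge0_integralZl//; last 2 first.
- by apply: measurableT_comp => //; apply: measurable_funD => //; exact: measurable_funM.
- by rewrite lee_fin powR_ge0.
rewrite [LHS]integral_mkcond; apply: eq_integral => a _.
rewrite patchE addr0 /f -EFinM indicE !mem_setE !in_itv/= !andbT pmulr_rgt0//.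
case: ltP => a0; last by rewrite mul0r mulr0.
rewrite mul1r powRM ?ltW// !mulrA -powRD; last by rewrite c1 implybT.
by rewrite addNr powRr0 mul1r.
Qed.

End gamma_fun.

(** * Uniqueness of generalized Stieltjes transforms *)

Section stieltjes.
Local Open Scope ereal_scope.
Context {R : realType}.

(** A null set contains no interval of positive length. Together with continuity this turns an
    almost everywhere equality into an equality at every point. *)
Lemma negligible_dense (A : set R) (x e : R) : (0 < e)%R ->
  lebesgue_measure.-negligible A -> exists2 y, (x < y < x + e)%R & ~ A y.
Proof.
move=> e0 [N [mN N0 AN]]; apply: contrapT => h.
have sub : `]x, (x + e)%R[ `<=` N.
  move=> y /=; rewrite in_itv/= => yx; apply: AN; apply: contrapT => nA.
  by apply: h; exists y.
have : lebesgue_measure (`]x, (x + e)%R[%classic : set R) <= lebesgue_measure N.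
  by apply: le_measure => //; rewrite inE.
rewrite N0 lebesgue_measure_itv/= lte_fin ltrDl e0 -EFinB lee_fin.
by rewrite addrAC subrr add0r leNgt e0.
Qed.

Lemma measurable_expR_weight d (T : measurableType d) (w X : T -> R) (l : R) :
  measurable_fun setT w -> measurable_fun setT X ->
  measurable_fun setT (fun x => w x * expR (- (l * X x)))%R.
Proof.
move=> mw mX; apply: measurable_funM => //.
by apply: measurableT_comp => //; apply: measurableT_comp => //; exact: measurable_funM.
Qed.

Lemma expRN_le1 (l x : R) : (0 <= l)%R -> (0 <= x)%R -> (`|expR (- (l * x))| <= 1)%R.
Proof.
by move=> l0 x0; rewrite ger0_norm ?expR_ge0// -expR0 ler_expR oppr_le0 mulr_ge0.
Qed.

Definition wlaplace d (T : measurableType d) (mu : {measure set T -> \bar R})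
  (w X : T -> R) (l : R) : R := fine (\int[mu]_x (w x * expR (- (l * X x)))%:E).

Section one_weight.
Context d (T : measurableType d) (mu : {sigma_finite_measure set T -> \bar R}).
Variables (w X : T -> R).
Hypotheses (mw : measurable_fun setT w) (mX : measurable_fun setT X)
  (w0 : forall x, (0 <= w x)%R) (X0 : forall x, (0 <= X x)%R)
  (fin : \int[mu]_x (w x)%:E < +oo).

Lemma wlaplaceE l : (0 <= l)%R ->
  \int[mu]_x (w x * expR (- (l * X x)))%:E = (wlaplace mu w X l)%:E.
Proof.
move=> l0; rewrite /wlaplace fineK// ge0_fin_numE; last first.
  by apply: integral_ge0 => x _; rewrite lee_fin mulr_ge0 ?expR_ge0.
apply: le_lt_trans fin; apply: ge0_le_integral => //.
- by move=> x _; rewrite lee_fin mulr_ge0 ?expR_ge0.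
- exact/measurable_EFinP/measurable_expR_weight.
- exact/measurable_EFinP.
- move=> x _; rewrite lee_fin ler_piMr//.
  by apply: le_trans (ler_norm _) _; exact: expRN_le1.
Qed.

Lemma wlaplace_ge0 l : (0 <= wlaplace mu w X l)%R.
Proof.
by apply/fine_ge0/integral_ge0 => x _; rewrite lee_fin mulr_ge0 ?expR_ge0.
Qed.

Lemma measurable_wlaplace : measurable_fun setT (fun l => wlaplace mu w X l).
Proof.
suff h : measurable_fun setT (fun l : R => \int[mu]_x (w x * expR (- (l * X x)))%:E).
  exact: (measurableT_comp (fine_measurable measurableT) h).
apply: (measurable_integral_param mu (fun (l : R) x => (w x * expR (- (l * X x)))%:E)) => //.
  apply/measurable_EFinP; apply: measurable_funM; first exact: measurableT_comp.
  apply: measurableT_comp => //; apply: measurableT_comp => //.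
  apply: measurable_funM => //; exact: measurableT_comp.
by move=> l x; rewrite lee_fin mulr_ge0 ?expR_ge0.
Qed.

Lemma wlaplace_cvg (u : nat -> R) (l : R) : (forall n, 0 <= u n)%R ->
  u n @[n --> \oo] --> l ->
  wlaplace mu w X (u n) @[n --> \oo] --> wlaplace mu w X l.
Proof.
move=> u0 ul.
have l0 : (0 <= l)%R 
  by rewrite -(cvg_lim (@Rhausdorff R) ul); apply: limr_ge; [exact: cvgP ul|exact: nearW].
apply: fine_cvg; rewrite -wlaplaceE//.
apply: (dominated_cvg_fin (g := w)).
- by move=> n; exact: measurable_expR_weight.
- move=> x; apply: cvgM; first exact: cvg_cst.
  apply: continuous_cvg; first exact: continuous_expR.
  by apply: cvgN; apply: cvgM => //; exact: cvg_cst.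
- exact: integrable_weight.
- move=> n x; rewrite normrM (ger0_norm (w0 x)) ler_piMr//.
  exact: expRN_le1.
Qed.

(** Euler's integral writes [Gamma(s) (l + X)^(-s)] as the integral of [a^(s-1) e^(-(l+X)a)];
    Tonelli does the rest. *)
Lemma stieltjes_laplace (s l : R) : (0 < s)%R -> (0 < l)%R ->
  \int[lebesgue_measure]_(a in `]0%R, +oo[)
     (a `^ (s - 1) * expR (- (l * a)) * wlaplace mu w X a)%:E =
  (Gamma_fun s)%:E * \int[mu]_x (w x * (l + X x) `^ (- s))%:E.
Proof.
move=> s0 l0.
transitivity (\int[lebesgue_measure]_(a in `]0%R, +oo[) \int[mu]_x
    (a `^ (s - 1) * expR (- (l * a)) * (w x * expR (- (a * X x))))%:E).
  apply: eq_integral => a; rewrite inE/= in_itv/= andbT => a0.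
  rewrite EFinM -wlaplaceE ?ltW// -ge0_integralZl//.
  - exact/measurable_EFinP/measurable_expR_weight.
  - by move=> x _; rewrite lee_fin mulr_ge0 ?expR_ge0.
  - by rewrite lee_fin mulr_ge0 ?powR_ge0 ?expR_ge0.
rewrite (tonelli_in lebesgue_measure mu (fun (a : R) x =>
   (a `^ (s - 1) * expR (- (l * a)) * (w x * expR (- (a * X x))))%:E))//; last 2 first.
- apply/measurable_EFinP; apply: measurable_funM.
    exact: (measurableT_comp (measurable_gamma_integrand s l) measurable_fst).
  apply: measurable_funM; first exact: measurableT_comp.
  apply: measurableT_comp => //; apply: measurableT_comp => //.
  apply: measurable_funM => //; exact: measurableT_comp.
- by move=> a x _ _; rewrite lee_fin !mulr_ge0 ?powR_ge0 ?expR_ge0.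
rewrite -ge0_integralZl//; last 3 first.
- apply/measurable_EFinP/measurable_funM => //.
  apply: (measurableT_comp (measurable_powR (- s)%R)); exact: measurable_funD.
- by move=> x _; rewrite lee_fin mulr_ge0 ?powR_ge0.
- by rewrite lee_fin ltW// Gamma_fun_gt0.
apply: eq_integral => x _.
rewrite -EFinM mulrCA EFinM -(integral_gamma_scale s0 (c := l + X x)%R); last first.
  by rewrite ltr_pwDl.
rewrite -ge0_integralZl//.
- apply: eq_integral => a _; rewrite -EFinM; congr EFin.
  rewrite mulrDl opprD expRD [(X x * a)%R]mulrC; ring.
- apply/measurable_EFinP; apply: measurable_funS (measurable_gamma_integrand _ _) => //.
- by move=> a _; rewrite lee_fin mulr_ge0 ?powR_ge0 ?expR_ge0.
- by rewrite lee_fin.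
Qed.

(** The damping [expR (- (1 * a))] shifts the transform from [l] to [l + 1]. It makes the total mass
    finite even if [w * X ^ (- s)] is not integrable, so Laplace uniqueness is applicable. *)
Definition stieltjes_weight (s a : R) : R :=
  (\1_(`]0%R, +oo[%classic : set R) a *
     (a `^ (s - 1) * expR (- (1 * a)) * wlaplace mu w X a))%R.

Lemma stieltjes_weight_ge0 s a : (0 <= stieltjes_weight s a)%R.
Proof. by rewrite !mulr_ge0 ?powR_ge0 ?expR_ge0// wlaplace_ge0. Qed.

Lemma measurable_stieltjes_weight s : measurable_fun setT (stieltjes_weight s).
Proof.
apply: measurable_funM; first exact: measurable_indic.
apply: measurable_funM; [exact: measurable_gamma_integrand|exact: measurable_wlaplace].
Qed.

Lemma laplace_stieltjes_weight s l : (0 < s)%R -> (0 <= l)%R ->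
  \int[lebesgue_measure]_a (stieltjes_weight s a * expR (- (l * `|a|)))%:E =
  (Gamma_fun s)%:E * \int[mu]_x (w x * (l + 1 + X x) `^ (- s))%:E.
Proof.
move=> s0 l0; rewrite -stieltjes_laplace ?ltr_wpDl//.
rewrite [RHS]integral_mkcond; apply: eq_integral => a _.
rewrite patchE /stieltjes_weight indicE !mem_setE !in_itv/= andbT.
case: ltP => a0; last by rewrite !mul0r.
rewrite !mul1r gtr0_norm// mulrDl opprD expRD mul1r; congr EFin; ring.
Qed.

Lemma stieltjes_weight_lty s : (0 < s)%R ->
  \int[lebesgue_measure]_a (stieltjes_weight s a)%:E < +oo.
Proof.
move=> s0; have := laplace_stieltjes_weight s0 (lexx 0%R).
under eq_integral do rewrite mul0r oppr0 expR0 mulr1.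
move=> ->; apply: lte_mul_pinfty; rewrite ?lee_fin ?ltW ?Gamma_fun_gt0//.
apply: le_lt_trans fin; apply: ge0_le_integral => //.
- by move=> x _; rewrite lee_fin mulr_ge0 ?powR_ge0.
- apply/measurable_EFinP/measurable_funM => //.
  apply: (measurableT_comp (measurable_powR (- s)%R)); exact: measurable_funD.
- exact/measurable_EFinP.
- move=> x _; rewrite lee_fin ler_piMr// add0r powRN invf_le1.
    have : (1 `^ s <= (1 + X x) `^ s)%R.
      by apply: ge0_ler_powR; rewrite ?nnegrE ?addr_ge0 ?(ltW s0) ?lerDl.
    by rewrite powR1.
  by rewrite powR_gt0// ltr_pwDl.
Qed.

End one_weight.

Section two_weights.
Context d1 d2 (T1 : measurableType d1) (T2 : measurableType d2).
Variables (mu1 : {sigma_finite_measure set T1 -> \bar R})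
  (mu2 : {sigma_finite_measure set T2 -> \bar R}).
Variables (w1 X1 : T1 -> R) (w2 X2 : T2 -> R).
Hypotheses (mw1 : measurable_fun setT w1) (mX1 : measurable_fun setT X1)
  (w10 : forall x, (0 <= w1 x)%R) (X10 : forall x, (0 <= X1 x)%R)
  (mw2 : measurable_fun setT w2) (mX2 : measurable_fun setT X2)
  (w20 : forall x, (0 <= w2 x)%R) (X20 : forall x, (0 <= X2 x)%R).
Hypotheses (fin1 : \int[mu1]_x (w1 x)%:E < +oo)
  (fin2 : \int[mu2]_x (w2 x)%:E < +oo).
Variable s : R.
Hypothesis s0 : (0 < s)%R.
Hypothesis eq_stieltjes : forall l : R, (0 < l)%R ->
  \int[mu1]_x (w1 x * (l + X1 x) `^ (- s))%:E =
  \int[mu2]_x (w2 x * (l + X2 x) `^ (- s))%:E.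

(* The transform of order [s] is the Laplace transform of
   [a ^ (s - 1) * wlaplace a], so Laplace uniqueness applies twice. *)
Let eq_wlaplace a : (0 < a)%R -> wlaplace mu1 w1 X1 a = wlaplace mu2 w2 X2 a.
Proof.
move=> a0.
have mabs : measurable_fun [set: R] (fun a : R => `|a|%R) by exact: measurableT_comp.
have weq B : measurable B -> wlaw lebesgue_measure (stieltjes_weight mu1 w1 X1 s) (fun a : R => `|a|%R) B =
   wlaw lebesgue_measure (stieltjes_weight mu2 w2 X2 s) (fun a : R => `|a|%R) B.
  move=> mB; apply: laplace_unique => //.
  - exact: measurable_stieltjes_weight.
  - by move=> x; exact: stieltjes_weight_ge0.
  - exact: measurable_stieltjes_weight.
  - by move=> x; exact: stieltjes_weight_ge0.
  - exact: stieltjes_weight_lty.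
  - exact: stieltjes_weight_lty.
  - by move=> l l0; rewrite !laplace_stieltjes_weight ?ltW// eq_stieltjes ?addr_gt0.
have ae : ae_eq lebesgue_measure `]0%R, +oo[%classic
    (EFin \o stieltjes_weight mu1 w1 X1 s) (EFin \o stieltjes_weight mu2 w2 X2 s).
  apply: integral_ae_eq => //.
  - apply: (integrableS measurableT) => //.
    apply: integrable_weight; [exact: measurable_stieltjes_weight|
      exact: stieltjes_weight_ge0|exact: stieltjes_weight_lty].
  - apply/measurable_EFinP; apply: measurable_funS (measurable_stieltjes_weight mu2 mw2 mX2 w20 s) => //.
  - move=> E sE mE.
    have EE : E = (fun a : R => `|a|%R) @^-1` E `&` `]0%R, +oo[.
      apply/seteqP; split=> x /=.
        move=> Ex; have := sE _ Ex; rewrite /= in_itv/= andbT => x0.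
        by rewrite gtr0_norm.
      by rewrite in_itv/= andbT => -[+ x0]; rewrite gtr0_norm.
    have mE' : measurable ((fun a : R => `|a|%R) @^-1` E) by exact: preimage_measurable.
    have := weq _ mE; rewrite /wlaw => h.
    have red (W : R -> R) : (forall a, a <= 0 -> W a = 0)%R ->
        \int[lebesgue_measure]_(x in E) (EFin \o W) x =
        \int[lebesgue_measure]_(x in (fun a : R => `|a|%R) @^-1` E) (W x)%:E.
      move=> W0; rewrite {1}EE integral_mkcondr.
      apply: eq_integral => x _; rewrite patchE mem_setE in_itv/= andbT.
      by case: ltP => // /W0 ->.
    have sw0 d (T : measurableType d) (mu : {sigma_finite_measure set T -> \bar R}) w X x :
      (x <= 0 -> stieltjes_weight mu w X s x = 0)%R.
      by move=> x0; rewrite /stieltjes_weight indicE mem_setE in_itv/= ltNge x0 mul0r.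
    by rewrite !red// => x; exact: sw0.
(* The weights agree almost everywhere on []0, +oo[]. Points of equality are picked to the right of
   [a] and arbitrarily close to it, and the continuity of both transforms is used at [a]. *)
have pt e : (0 < e)%R -> exists2 y, (a < y < a + e)%R &
    wlaplace mu1 w1 X1 y = wlaplace mu2 w2 X2 y.
  move=> e0; have [y yae hy] := negligible_dense a e0 ae.
  exists y => //; move: hy => /contrapT /= /(_ _).
  have y0 : (0 < y)%R by case/andP: yae => ? _; exact: lt_trans a0 _.
  rewrite in_itv/= andbT y0 => /(_ isT) [].
  rewrite /stieltjes_weight indicE mem_setE in_itv/= y0 !mul1r.
  apply: mulfI; rewrite mulf_neq0// gt_eqF ?expR_gt0// powR_gt0//.
pose u n := sval (cid2 (pt (harmonic n) (harmonic_gt0 n))).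
have u1 n : (a < u n < a + harmonic n)%R by rewrite /u; case: cid2.
have u2 n : wlaplace mu1 w1 X1 (u n) = wlaplace mu2 w2 X2 (u n).
  by rewrite /u; case: cid2.
have ua : u n @[n --> \oo] --> a.
  apply: (@squeeze_cvgr _ _ _ _ (cst a) (fun n => a + harmonic n)%R).
  - by apply: nearW => n; have /andP[h1 h2] := u1 n; rewrite !ltW.
  - exact: cvg_cst.
  - rewrite -[X in _ --> X]addr0; apply: cvgD; [exact: cvg_cst|exact: cvg_harmonic].
have u0 n : (0 <= u n)%R by have /andP[h1 _] := u1 n; rewrite ltW// (lt_trans a0).
have c1 := wlaplace_cvg mw1 mX1 w10 X10 fin1 u0 ua.
have c2 := wlaplace_cvg mw2 mX2 w20 X20 fin2 u0 ua.
apply: (cvg_unique _ c1) => //.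
by rewrite (_ : (fun n => _) = (fun n => wlaplace mu2 w2 X2 (u n)))//; exact/funext.
Qed.

Theorem stieltjes_unique B : measurable B -> wlaw mu1 w1 X1 B = wlaw mu2 w2 X2 B.
Proof.
apply: laplace_unique => // l l0.
by rewrite !wlaplaceE ?ltW// eq_wlaplace.
Qed.

Theorem stieltjes_unique_laplace a : (0 < a)%R ->
  \int[mu1]_x (w1 x * expR (- (a * X1 x)))%:E = \int[mu2]_x (w2 x * expR (- (a * X2 x)))%:E.
Proof. by move=> a0; rewrite !wlaplaceE ?ltW// eq_wlaplace. Qed.

End two_weights.

End stieltjes.

(** * Frullani's integral *)

Section frullani.
Local Open Scope ereal_scope.
Context {R : realType}.

Lemma integral_expR_head (l x : R) : (0 <= l)%R -> (0 < x)%R ->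
  \int[lebesgue_measure]_(u in `]0%R, l[) (expR (- (x * u)))%:E =
  ((1 - expR (- (l * x))) / x)%:E.
Proof.
rewrite le_eqVlt => /predU1P[<- x0|l0 x0].
  by rewrite set_itv_ge ?integral_set0 ?bnd_simp ?ltxx// mul0r oppr0 expR0 subrr mul0r.
have dF (y : R) : (0 < y < l)%R ->
    is_derive y 1%R (fun y => - x^-1 * expR ((- x) * y))%R (expR (- (x * y))).
  move=> _; have := is_deriveZ (- x^-1)%R (is_derive_expRM (- x)%R y).
  rewrite /GRing.scale/= mulrA mulrNN mulVf ?gt_eqF// mul1r mulNr; exact.
have cF (y : R) : {for y, continuous (fun y => - x^-1 * expR ((- x) * y))%R}.
  apply: continuousM; first exact: cst_continuous.
  apply: differentiable_continuous; apply/derivable1_diffP.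
  by have [] := is_derive_expRM (- x)%R y.
rewrite (ftc_oo (A := (- x^-1 * expR ((- x) * 0))%R) (B := (- x^-1 * expR ((- x) * l))%R) l0 dF).
- by congr EFin; rewrite mulr0 expR0 (_ : - x * l = - (l * x))%R; ring.
- move=> y _; apply: differentiable_continuous; apply/derivable1_diffP.
  by have [h _] := is_derive_expRM (- x)%R y; move: h; under eq_fun do rewrite mulNr.
- by move=> y _; exact: expR_ge0.
- exact/cvg_at_right_filter/cF.
- exact/cvg_at_left_filter/cF.
Qed.

Lemma is_derive_ln_shift (g u : R) : (0 < u + g)%R ->
  is_derive u 1%R (fun u => ln (u + g))%R (u + g)^-1%R.
Proof.
move=> ug; have h : is_derive u 1%R (fun u : R => u + g)%R 1%R.
  by apply: is_derive_eq; rewrite addr0.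
by have := @is_derive1_comp _ (@ln R) (fun u => u + g)%R _ _ _ (is_derive1_ln ug) h; rewrite mulr1.
Qed.

Lemma integral_inv_shift (g l : R) : (0 < g)%R -> (0 <= l)%R ->
  \int[lebesgue_measure]_(u in `]0%R, l[) ((u + g)^-1)%:E = (ln (1 + l / g))%:E.
Proof.
move=> g0; rewrite le_eqVlt => /predU1P[<-|l0].
  by rewrite set_itv_ge ?integral_set0 ?bnd_simp ?ltxx// mul0r addr0 ln1.
have ug (u : R) : (0 <= u)%R -> (0 < u + g)%R by move=> u0; rewrite ltr_wpDl.
have dF (u : R) : (0 < u < l)%R -> is_derive u 1%R (fun u => ln (u + g))%R (u + g)^-1%R.
  by move=> /andP[u0 _]; exact/is_derive_ln_shift/ug/ltW.
have cF (u : R) : (0 <= u)%R -> {for u, continuous (fun u => ln (u + g))%R}.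
  move=> u0; apply: differentiable_continuous; apply/derivable1_diffP.
  by have [] := is_derive_ln_shift (ug _ u0).
rewrite (ftc_oo (A := ln (0 + g)%R) (B := ln (l + g)%R) l0 dF).
- rewrite add0r -ln_div ?posrE ?ug ?ltW//; congr (ln _)%:E.
  by rewrite mulrDl divff ?gt_eqF// addrC.
- move=> u /andP[u0 _]; apply: continuousV; first by rewrite gt_eqF// ug ?ltW.
  by apply: continuousD => //; exact: cst_continuous.
- by move=> u /andP[u0 _]; rewrite invr_ge0 ltW// ug ?ltW.
- exact/cvg_at_right_filter/cF.
- by apply/cvg_at_left_filter/cF; exact: ltW.
Qed.

(** With [(1 - e^(-lx)) / x] written as the integral of [e^(-xu)] over [0 < u < l], the integral in
    [x] becomes [1 / (u + g)], whose primitive is a logarithm. *)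
Lemma frullani (g l : R) : (0 < g)%R -> (0 <= l)%R ->
  \int[lebesgue_measure]_(x in `]0%R, +oo[)
    ((1 - expR (- (l * x))) / x * expR (- (x * g)))%:E = (ln (1 + l / g))%:E.
Proof.
move=> g0 l0.
transitivity (\int[lebesgue_measure]_(x in `]0%R, +oo[)
    \int[lebesgue_measure]_(u in `]0%R, l[) (expR (- ((u + g) * x)))%:E).
  apply: eq_integral => x; rewrite inE/= in_itv/= andbT => x0.
  rewrite EFinM -integral_expR_head// -ge0_integralZr//.
  - by apply: eq_integral => u _; rewrite -EFinM -expRD; congr (expR _)%:E; ring.
  - by apply/measurable_EFinP/measurableT_comp => //; apply: measurableT_comp.
rewrite (tonelli_in lebesgue_measure lebesgue_measure
  (fun x u : R => (expR (- ((u + g) * x)))%:E))//.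
- rewrite -integral_inv_shift//; apply: eq_integral => u.
  rewrite inE/= in_itv/= => /andP[u0 _].
  by rewrite integral_expR_tail ?addr_gt0// mulr0 oppr0 expR0 mul1r.
- apply/measurable_EFinP/measurableT_comp => //; apply: measurableT_comp => //.
  by apply: measurable_funM => //; apply: measurable_funD.
Qed.

End frullani.

(** * The exponent [psi] as the expectation of a logarithm *)

Section psi.
Local Open Scope ereal_scope.
Context {R : realType} d (T : measurableType d) (P : probability T R).

Lemma eq_ae_psi (G H : T -> R) (l : R) : measurable_fun setT G ->
  measurable_fun setT H -> {ae P, forall w, G w = H w} -> psi P G l = psi P H l.
Proof.
move=> mG mH GH; apply: eq_integral => x _; congr (_ * _).
rewrite unlock; apply: ae_eq_integral => //.
- apply/measurable_EFinP/measurableT_comp => //; apply: measurableT_comp => //.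
  exact: measurable_funM.
- apply/measurable_EFinP/measurableT_comp => //; apply: measurableT_comp => //.
  exact: measurable_funM.
- by apply: filterS GH => w /= -> _.
Qed.

Lemma psi_ln (G : T -> R) (l : R) : measurable_fun setT G -> (forall w, 0 < G w)%R ->
  (0 <= l)%R -> psi P G l = \int[P]_w (ln (1 + l / G w))%:E.
Proof.
move=> mG G0 l0.
have h0 (x : R) : (0 < x)%R -> (0 <= (1 - expR (- (l * x))) / x)%R.
  move=> x0; rewrite divr_ge0 ?(ltW x0)// subr_ge0 -expR0 ler_expR oppr_le0.
  by rewrite mulr_ge0// ltW.
transitivity (\int[lebesgue_measure]_(x in `]0%R, +oo[) \int[P]_w
   ((1 - expR (- (l * x))) / x * expR (- (x * G w)))%:E).
  apply: eq_integral => x; rewrite inE/= in_itv/= andbT => x0.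
  rewrite unlock -ge0_integralZl//.
  - apply/measurable_EFinP/measurableT_comp => //; apply: measurableT_comp => //.
    exact: measurable_funM.
  - by rewrite lee_fin h0.
rewrite (tonelli_in lebesgue_measure P
  (fun (x : R) w => ((1 - expR (- (l * x))) / x * expR (- (x * G w)))%:E))//.
- by apply: eq_integral => w _; rewrite frullani.
- apply/measurable_EFinP; apply: measurable_funM.
    apply: (@measurableT_comp _ _ _ _ _ _ (fun x : R => (1 - expR (- (l * x))) / x)%R) => //.
    apply: measurable_funM; last exact: measurable_invr.
    by apply: measurable_funB => //; apply: measurableT_comp => //; apply: measurableT_comp.
  apply: measurableT_comp => //; apply: measurableT_comp => //.
  by apply: measurable_funM => //; exact: measurableT_comp.
- move=> x w; rewrite /= in_itv/= andbT => x0 _.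
  by rewrite lee_fin mulr_ge0 ?expR_ge0 ?h0.
Qed.

End psi.

(** * The function [E log (l + W)], its derivative, and the equation fixed by [S] *)

Section mean_log.
Context {R : realType} d (T : measurableType d) (P : probability T R).
Variable W : T -> R.
Hypotheses (mW : measurable_fun setT W) (W0 : forall w, 0 < W w)
  (lnW : (\int[P]_w `|ln (W w)|%:E < +oo)%E).

Definition logm (l : R) : R := \int[P]_w ln (l + W w).
Definition inv_mean (l : R) : R := \int[P]_w (l + W w)^-1.

Let lW l w : 0 <= l -> 0 < l + W w. Proof. by move=> l0; rewrite ltr_wpDl. Qed.

Let mln l : measurable_fun setT (fun w => ln (l + W w)).
Proof. by apply: measurableT_comp => //; exact: measurable_funD. Qed.

Let minv l : measurable_fun setT (fun w => (l + W w)^-1).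
Proof.
apply: (measurableT_comp (@measurable_invr R)); exact: measurable_funD.
Qed.

(** Domination by [|ln W| + ln (1 + l)]: below, [l + W >= W]; above, [l + W] is at most [1 + l] when
    [W <= 1] and at most [W (1 + l)] otherwise. *)
Lemma integrable_logm l : 0 <= l ->
  P.-integrable setT (EFin \o (fun w => ln (l + W w))).
Proof.
move=> l0; apply: (@le_integrable _ _ _ P setT measurableT _
   (fun w => (`|ln (W w)| + ln (1 + l))%:E)).
- exact/measurable_EFinP.
- move=> w _ /=; rewrite lee_fin.
  have ln1l : 0 <= ln (1 + l) by rewrite ln_ge0// lerDl.
  rewrite [leRHS]ger0_norm ?addr_ge0// ler_norml; apply/andP; split.
    rewrite lerNl; apply: (@le_trans _ _ (- ln (W w))).
      by rewrite lerN2 ler_ln ?posrE ?lW// lerDr.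
    by apply: (le_trans (ler_norm _)); rewrite normrN lerDl.
  have [W1|W1] := leP (W w) 1.
    apply: (@le_trans _ _ (ln (1 + l))); last by rewrite lerDr.
    by rewrite ler_ln ?posrE ?lW// ?ltr_pwDl// addrC lerD2r.
  apply: (@le_trans _ _ (ln (W w * (1 + l)))).
    rewrite ler_ln ?posrE ?lW// ?mulr_gt0// ?ltr_pwDl//.
    by rewrite mulrDr mulr1 addrC lerD2l ler_peMl// ltW.
  by rewrite lnM ?posrE ?ltr_pwDl// lerD2r ler_norm.
- have iW : P.-integrable setT (EFin \o (fun w => `|ln (W w)|)).
    apply: integrable_weight => //.
    by apply: measurableT_comp => //; apply: measurableT_comp.
  under eq_fun do rewrite EFinD.
  by apply: integrableD => //; exact: finite_measure_integrable_cst.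
Qed.

Lemma logmE l : 0 <= l -> (\int[P]_w (ln (l + W w))%:E = (logm l)%:E)%E.
Proof.
move=> l0; rewrite /logm /Rintegral fineK//.
exact: (integrable_fin_num measurableT (integrable_logm l0)).
Qed.

Lemma integrable_inv_mean l : 0 < l ->
  P.-integrable setT (EFin \o (fun w => (l + W w)^-1)).
Proof.
move=> l0; apply: (@le_integrable _ _ _ P setT measurableT _ (EFin \o cst l^-1)).
- exact/measurable_EFinP.
- have l0' := ltW l0.
  move=> w _ /=; have lw := lW w l0'; have lw' := ltW lw.
  rewrite lee_fin !ger0_norm ?invr_ge0//.
  by rewrite lef_pV2 ?posrE// lerDl ltW.
- exact: finite_measure_integrable_cst.
Qed.

Lemma inv_meanE l : 0 < l -> (\int[P]_w ((l + W w)^-1)%:E = (inv_mean l)%:E)%E.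
Proof.
move=> l0; rewrite /inv_mean /Rintegral fineK//.
exact: (integrable_fin_num measurableT (integrable_inv_mean l0)).
Qed.

Lemma inv_mean_ge0 l : 0 < l -> 0 <= inv_mean l.
Proof.
by move=> l0; apply: Rintegral_ge0 => w _; rewrite invr_ge0 ltW// lW// ltW.
Qed.

(** Differentiation and continuity under the integral take place on []l / 2, 2 l[], where
    [(x + W)^-1] stays below the constant [2 / l]. *)
Let near_itv (l : R) : 0 < l -> l \in `](l / 2), (2 * l)[%classic.
Proof. by move=> l0; rewrite inE/= in_itv/=; lra. Qed.

Let itv_gt0 (l x : R) : 0 < l -> `](l / 2), (2 * l)[%classic x -> 0 < x.
Proof. by move=> l0; rewrite /= in_itv/=; lra. Qed.

Let inv_bound (l x : R) w : 0 < l -> `](l / 2), (2 * l)[%classic x ->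
  `|(x + W w)^-1| <= 2 / l.
Proof.
move=> l0 xl; have x0 := itv_gt0 l0 xl.
have lw := lW w (ltW x0); have lw' := ltW lw.
rewrite ger0_norm ?invr_ge0//.
rewrite (_ : 2 / l = (l / 2)^-1); last by rewrite invf_div.
rewrite lef_pV2 ?posrE// ?divr_gt0//.
by move: xl (W0 w); rewrite /= in_itv/=; lra.
Qed.

Lemma is_derive_logm (l : R) : 0 < l -> is_derive l 1 logm (inv_mean l).
Proof.
move=> l0.
have dln (x : R) w : 0 < x -> is_derive x 1 (fun x => ln (x + W w)) (x + W w)^-1.
  by move=> x0; apply: is_derive_ln_shift; rewrite lW// ltW.
have E (x : R) w : 0 < x -> partial1of2 (fun (x : R) (w : T) => ln (x + W w)) x w = (x + W w)^-1.
  by move=> x0; rewrite partial1of2E; have [_ ->] := dln x w x0.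
have Ia : `](l / 2), (2 * l)[%classic l by exact: set_mem (near_itv l0).
have iln x : `](l / 2), (2 * l)[%classic x -> P.-integrable setT (EFin \o (fun w => ln (x + W w))).
  by move=> /(itv_gt0 l0) /ltW; exact: integrable_logm.
have dvl x w : `](l / 2), (2 * l)[%classic x -> setT w ->
    derivable (fun x => ln (x + W w)) x 1.
  by move=> /(itv_gt0 l0) x0 _; have [] := dln x w x0.
have G0 (w : T) : 0 <= cst (2 / l) w by rewrite /= divr_ge0// ltW.
have iG : P.-integrable setT (EFin \o cst (2 / l)) by exact: finite_measure_integrable_cst.
have ub x w : `](l / 2), (2 * l)[%classic x -> setT w ->
    `|partial1of2 (fun (x : R) (w : T) => ln (x + W w)) x w| <= cst (2 / l) w.
  by move=> xI _; rewrite E ?(itv_gt0 l0)//= inv_bound.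
apply: DeriveDef.
  exact: (derivable_under_integral measurableT Ia iln dvl G0 iG ub).
rewrite -derive1E (differentiation_under_integral measurableT Ia iln dvl G0 iG ub).
by apply: eq_Rintegral => w _; rewrite E.
Qed.

Lemma continuous_inv_mean (l : R) : 0 < l -> {for l, continuous inv_mean}.
Proof.
move=> l0.
apply: (@continuity_under_integral R _ T P (fun x w => (x + W w)^-1) setT measurableT
   (l / 2) (2 * l) _ _ (cst (2 / l))).
- by move=> x /(itv_gt0 l0); exact: integrable_inv_mean.
- apply: aeW => w _ x /set_mem /(itv_gt0 l0) x0.
  have h : {for x, continuous (fun x : R => (x + W w)^-1)}.
    apply: continuousV; first by rewrite gt_eqF// lW// ltW.
    by apply: continuousD => //; exact: cst_continuous.
  exact: h.
- exact: finite_measure_integrable_cst.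
- by move=> x xI; apply: aeW => w _; exact: inv_bound.
- exact: near_itv.
Qed.

Lemma logm_ge_ln l : 0 < l -> ln l <= logm l.
Proof.
move=> l0; rewrite -lee_fin -(logmE (ltW l0)).
have -> : (ln l)%:E = (\int[P]_w (ln l)%:E)%E.
  by rewrite integral_cst//= [X in (_ * X)%E]probability_setT mule1.
apply: le_integral => //.
- exact: finite_measure_integrable_cst.
- exact: integrable_logm (ltW l0).
- by move=> w _; rewrite lee_fin ler_ln ?posrE// ?lerDl ?lW ?(ltW l0)// ltW.
Qed.

Section exp_logm.
Variable t : R.
Hypothesis t0 : 0 < t.

Definition explogm (l : R) : R := expR (- (t * logm l)).

Lemma explogm_le l : 0 < l -> explogm l <= l `^ (- t).
Proof.
move=> l0; rewrite /explogm /powR gt_eqF// ler_expR mulNr lerN2.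
by rewrite ler_pM2l// logm_ge_ln.
Qed.

Lemma cvg_powRN_pinfty : x `^ (- t) @[x --> +oo] --> (0 : R).
Proof.
have h : expR (- (t * x)) @[x --> +oo] --> (0 : R) by exact: cvg_expRN_pinfty.
apply/cvg_pinftyP => u uoo.
have lnu : ln (u n) @[n --> \oo] --> +oo.
  apply/cvgryPge => A; move/cvgryPge : uoo => /(_ (expR A)).
  apply: filterS => n uA; rewrite -(expRK A) ler_ln// posrE ?expR_gt0//.
  exact: lt_le_trans (expR_gt0 A) uA.
move/cvg_pinftyP : h => /(_ _ lnu); apply: cvg_trans; apply: near_eq_cvg.
move/cvgryPgt : uoo => /(_ 0); apply: filterS => n u0.
by rewrite /powR gt_eqF// mulNr.
Qed.

Lemma is_derive_explogm (l : R) : 0 < l ->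
  is_derive l 1 (fun l => - explogm l) (t * inv_mean l * explogm l).
Proof.
move=> l0.
have h1 : is_derive l 1 (fun l => - t * logm l) (- t * inv_mean l).
  exact: is_deriveZ (is_derive_logm l0).
have h2 := @is_derive1_comp _ (@expR R) _ _ _ _ (is_derive_expR _) h1.
have := is_deriveN h2.
rewrite (_ : - (expR \o (fun l => - t * logm l)) = (fun l => - explogm l)); last first.
  by apply/funext => x; rewrite /explogm /= -mulNr.
move=> h; apply: (is_derive_eq h); rewrite /explogm mulNr; ring.
Qed.

Lemma continuous_explogm (x : R) : 0 < x -> {for x, continuous explogm}.
Proof.
move=> x0; rewrite (_ : explogm = (fun x => - (- explogm x))); last first.
  by apply/funext => y; rewrite opprK.
apply: continuousN; apply: differentiable_continuous; apply/derivable1_diffP.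
by have [] := is_derive_explogm x0.
Qed.

(** [S' = - t E[1/(s + W)] S], and [S] vanishes at infinity since [S(l) <= l^(-t)]; integrating from
    [l] to infinity yields the fixed-point equation. *)
Lemma integral_explogm (l : R) : 0 < l ->
  (\int[lebesgue_measure]_(s in `]l, +oo[) (t * inv_mean s * explogm s)%:E = (explogm l)%:E)%E.
Proof.
move=> l0.
have dF (x : R) : l < x -> is_derive x 1 (fun l => - explogm l) (t * inv_mean x * explogm x).
  by move=> lx; apply: is_derive_explogm; exact: lt_trans lx.
rewrite (ftc_oy (A := - explogm l) (B := 0) dF) ?sub0r ?opprK//.
- move=> x lx; have x0 := lt_trans l0 lx.
  apply: continuousM; last exact: continuous_explogm.
  apply: continuousM; [exact: cst_continuous|exact: continuous_inv_mean].
- move=> x lx; have x0 := lt_trans l0 lx.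
  by rewrite !mulr_ge0 ?expR_ge0 ?inv_mean_ge0 ?(ltW t0).
- by apply/cvg_at_right_filter/continuousN/continuous_explogm.
- rewrite -[X in _ --> X]oppr0; apply: cvgN.
  apply: (@squeeze_cvgr _ _ _ _ (cst 0) (fun x => x `^ (- t))).
  + near=> x; rewrite expR_ge0/= explogm_le//.
  + exact: cvg_cst.
  + exact: cvg_powRN_pinfty.
Unshelve. all: by end_near. Qed.

End exp_logm.

End mean_log.

(** * The product of two probabilities as a probability *)

Section product_probability.
Local Open Scope ereal_scope.
Context {R : realType} d1 d2 (T1 : measurableType d1) (T2 : measurableType d2).
Variables (P1 : probability T1 R) (P2 : probability T2 R).

Definition prod_prob : set (T1 * T2) -> \bar R := P1 \x P2.

HB.instance Definition _ := Measure.on prod_prob.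

Let prod_prob_setT : prod_prob setT = 1.
Proof.
rewrite /prod_prob -setXTT [LHS]product_measure1E//.
by rewrite [X in X * _]probability_setT [X in _ * X]probability_setT mule1.
Qed.

HB.instance Definition _ := Measure_isProbability.Build _ _ _ prod_prob prod_prob_setT.

End product_probability.

(** * Power integrals and the mixing variable [V] *)

Section power_integrals.
Local Open Scope ereal_scope.
Context {R : realType}.
Implicit Types (t p q l y : R).

Lemma is_derive_powR_shift (a y x : R) : (0 < x + y)%R ->
  is_derive x 1%R (fun x => (x + y) `^ a)%R (a * (x + y) `^ (a - 1))%R.
Proof.
move=> xy; have h : is_derive x 1%R (fun x : R => x + y)%R 1%R.
  by apply: is_derive_eq; rewrite addr0.
by have := @is_derive1_comp _ (fun x => x `^ a)%R (fun x => x + y)%R _ _ _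
  (is_derive_powR a xy) h; rewrite mulr1.
Qed.

Lemma continuous_powR_shift (a y x : R) : (0 < x + y)%R ->
  {for x, continuous (fun x => (x + y) `^ a)%R}.
Proof.
move=> xy; apply: differentiable_continuous; apply/derivable1_diffP.
by have [] := is_derive_powR_shift a xy.
Qed.

Lemma integral_powR_tail t l y : (0 < t)%R -> (0 < l + y)%R ->
  \int[lebesgue_measure]_(s in `]l, +oo[) (t * (s + y) `^ (- t - 1))%:E =
  ((l + y) `^ (- t))%:E.
Proof.
move=> t0 ly.
have sy (s : R) : (l < s)%R -> (0 < s + y)%R by lra.
have dF (s : R) : (l < s)%R -> is_derive s 1%R (fun s => - (s + y) `^ (- t))%R
    (t * (s + y) `^ (- t - 1))%R.
  move=> ls; have h := is_deriveN (is_derive_powR_shift (- t)%R (sy _ ls)).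
  by apply: (is_derive_eq h); rewrite mulNr opprK.
rewrite (ftc_oy (A := (- (l + y) `^ (- t))%R) (B := 0%R) dF) ?sub0r ?opprK//.
- move=> s /sy h; apply: continuousM; first exact: cst_continuous.
  exact: continuous_powR_shift.
- by move=> s _; rewrite mulr_ge0 ?powR_ge0// ltW.
- by apply: cvg_at_right_filter; apply: cvgN; exact: continuous_powR_shift.
- rewrite -[X in _ --> X]oppr0; apply: cvgN.
  apply/cvg_pinftyP => u uoo.
  have := @cvg_powRN_pinfty R t t0; move/cvg_pinftyP; apply.
  apply/cvgryPge => A; move/cvgryPge : uoo => /(_ (A - y)%R).
  by apply: filterS => n; rewrite lerBlDr.
Qed.

Lemma cvg_powR (I : Type) (F : set_system I) {FF : Filter F} (D : I -> R) q (a : R) :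
  (0 < q)%R -> D u @[u --> F] --> q -> (D u `^ a)%R @[u --> F] --> (q `^ a)%R.
Proof.
move=> q0 Dc; have h : (x `^ a)%R @[x --> q] --> (q `^ a)%R by exact: continuous_powR.
have := @cvg_comp _ _ _ D (fun x => x `^ a)%R _ _ _ Dc h; exact.
Qed.

(* [V = U ^ (1/t)], truncated so as to lie in [0, 1] for every [u]. *)
Definition mixing t (u : R) : R := Num.min 1%R (u `^ t^-1)%R.

Lemma mixing_ge0 t u : (0 <= mixing t u)%R.
Proof. by rewrite /mixing le_min ler01 powR_ge0. Qed.

Lemma mixing_le1 t u : (mixing t u <= 1)%R.
Proof. by rewrite /mixing ge_min lexx. Qed.

Lemma measurable_mixing t : measurable_fun setT (mixing t).
Proof.
by apply: measurable_minr => //; exact: measurable_powR.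
Qed.

Lemma mixing_id t u : (0 < t)%R -> (0 <= u <= 1)%R -> mixing t u = (u `^ t^-1)%R.
Proof.
move=> t0 /andP[u0 u1]; apply/min_idPr.
have : (u `^ t^-1 <= 1 `^ t^-1)%R.
  by apply: ge0_ler_powR; rewrite ?nnegrE ?invr_ge0// ltW.
by rewrite powR1.
Qed.

Lemma mixing_pos t (a b u : R) : (0 < a)%R -> (0 < b)%R ->
  (0 < mixing t u * a + (1 - mixing t u) * b)%R.
Proof.
move=> a0 b0; have v0 := mixing_ge0 t u; have v1 := mixing_le1 t u.
set v := mixing t u in v0 v1 *.
by move: v0; rewrite le_eqVlt => /predU1P[<-|v0]; [lra|nra].
Qed.

(* The antiderivative is [u / (q * (v p + (1 - v) q) ^ t)] with [v = u ^ (1/t)]. *)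
Lemma beta_integral t p q : (0 < t)%R -> (0 < p)%R -> (0 < q)%R ->
  \int[lebesgue_measure]_(u in `]0%R, 1%R[)
    ((mixing t u * p + (1 - mixing t u) * q) `^ (- t - 1))%:E =
  (p `^ (- t) * q^-1)%:E.
Proof.
move=> t0 p0 q0.
pose v (u : R) : R := (u `^ t^-1)%R.
pose D (u : R) : R := (q + (p - q) * v u)%R.
have tV0 : (0 < t^-1)%R by rewrite invr_gt0.
have v01 u : (0 <= u <= 1)%R -> (0 <= v u <= 1)%R.
  by move=> u01; rewrite /v powR_ge0/= -(mixing_id t0 u01) mixing_le1.
have DE u : (0 <= u <= 1)%R -> (mixing t u * p + (1 - mixing t u) * q = D u)%R.
  by move=> u01; rewrite mixing_id// /D /v; ring.
have D0 u : (0 <= u <= 1)%R -> (0 < D u)%R.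
  by move=> u01; rewrite -DE//; exact: mixing_pos.
have dv (u : R) : (0 < u)%R -> is_derive u 1%R v (t^-1 * u `^ (t^-1 - 1))%R.
  by move=> u0; exact: is_derive_powR.
have dD (u : R) : (0 < u)%R -> is_derive u 1%R D ((p - q) * (t^-1 * u `^ (t^-1 - 1)))%R.
  move=> u0.
  have h1 : is_derive u 1%R (fun u => (p - q) * v u)%R ((p - q) * (t^-1 * u `^ (t^-1 - 1)))%R.
    exact: is_deriveZ (dv _ u0).
  have h2 := @is_deriveD _ _ _ (cst q) _ u 1%R 0%R _ (is_derive_cst q u 1%R) h1.
  by apply: (is_derive_eq h2); rewrite add0r.
have cD u : (0 < u)%R -> {for u, continuous D}.
  by move=> u0; apply: differentiable_continuous; apply/derivable1_diffP; have [] := dD _ u0.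
have dDt (u : R) : (0 < u <= 1)%R ->
    is_derive u 1%R (fun u => D u `^ (- t))%R
      (- t * D u `^ (- t - 1) * ((p - q) * (t^-1 * u `^ (t^-1 - 1))))%R.
  move=> /andP[u0 u1].
  have Du0 : (0 < D u)%R by apply: D0; rewrite ltW.
  exact: (@is_derive1_comp _ (fun x => x `^ (- t))%R D _ _ _ (is_derive_powR (- t)%R Du0) (dD _ u0)).
pose F (u : R) : R := (q^-1 * (u * D u `^ (- t)))%R.
have dF1 (u : R) : (0 < u <= 1)%R -> is_derive u 1%R F (D u `^ (- t - 1))%R.
  move=> u01; have /andP[u0 u1] := u01.
  have h1 := is_deriveM (is_derive_id u 1%R) (dDt _ u01).
  have h2 := is_deriveZ q^-1%R h1.
  apply: (is_derive_eq h2).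
  rewrite /GRing.scale/= mulr1.
  have Du0 : (0 < D u)%R by apply: D0; rewrite ltW.
  have -> : (D u `^ (- t) = D u * D u `^ (- t - 1))%R.
    rewrite -[X in (X * _)%R]powRr1 ?ltW// -powRD; last by rewrite (gt_eqF Du0) implybT.
    by congr (_ `^ _)%R; ring.
  have -> : (u `^ (t^-1 - 1) = v u / u)%R.
    rewrite -[X in (_ / X)%R]powRr1 ?ltW// -powRN -powRD //.
    by rewrite (gt_eqF u0) implybT.
  (* What remains is [D u - (p - q) * v u = q], which cancels the factor [q^-1] of [F]. *)
  set E := (D u `^ _)%R; rewrite /D; field.
  by rewrite !gt_eqF.
have dF (u : R) : (0 < u < 1)%R -> is_derive u 1%R F (D u `^ (- t - 1))%R.
  by move=> /andP[u0 u1]; apply: dF1; rewrite u0 ltW.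
transitivity (\int[lebesgue_measure]_(u in `]0%R, 1%R[) (D u `^ (- t - 1))%:E).
  apply: eq_integral => u; rewrite inE/= in_itv/= => /andP[u0 u1].
  by rewrite DE// !ltW.
rewrite (ftc_oo (A := 0%R) (B := F 1%R) ltr01 dF).
- rewrite subr0 /F /D /v powR1 mulr1 mul1r mulrC; congr (_ `^ _ * _)%:E; ring.
- move=> u /andP[u0 u1].
  have Du0 : (0 < D u)%R by apply: D0; rewrite !ltW.
  apply: (@continuous_comp _ _ _ D (fun x => x `^ (- t - 1))%R); first exact: cD.
  exact: continuous_powR.
- by move=> u _; rewrite powR_ge0.
- have vc : v u @[u --> 0^'+] --> (0:R)%R by exact: powR_cvg0.
  have Dc : D u @[u --> 0^'+] --> q.
    rewrite -[X in _ --> X]addr0; apply: cvgD; first exact: cvg_cst.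
    by rewrite -[X in _ --> X](mulr0 (p - q)%R); apply: cvgMr.
  rewrite -[X in _ --> X](mulr0 q^-1%R); apply: cvgMr.
  rewrite -[X in _ --> X](mul0r (q `^ (- t))%R); apply: cvgM.
    by apply: cvg_at_right_filter; exact: cvg_id.
  exact: cvg_powR.
- apply/cvg_at_left_filter; apply: differentiable_continuous; apply/derivable1_diffP.
  by have /dF1[] : (0 < (1 : R) <= 1)%R by rewrite ltr01 lexx.
Qed.

End power_integrals.

(** * One step of the iteration on laws, and its effect on transforms and cdfs *)

Section mixture.
Local Open Scope ereal_scope.
Context {R : realType} d (T : measurableType d) (P : probability T R).
Variables (W : T -> R) (t : R).
Hypotheses (mW : measurable_fun setT W) (W0 : forall w, (0 < W w)%R) (t0 : (0 < t)%R).

Local Notation mR := (measurableTypeR R).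
Local Notation U := (uniform_prob (@ltr01 R)).

Definition mixture (z : mR * (T * mR)) : mR :=
  (mixing t z.2.2 * `|z.1| + (1 - mixing t z.2.2) * W z.2.1)%R.

Lemma mixture_ge0 z : (0 <= mixture z)%R.
Proof.
by rewrite addr_ge0// mulr_ge0 ?mixing_ge0 ?subr_ge0 ?mixing_le1// ltW.
Qed.

Lemma measurable_mixture : measurable_fun setT mixture.
Proof.
have mv : measurable_fun setT (fun z : mR * (T * mR) => mixing t z.2.2).
  exact: (measurableT_comp (measurable_mixing t)
    (measurableT_comp measurable_snd measurable_snd)).
apply: measurable_funD; apply: measurable_funM => //.
- by apply: measurableT_comp => //; exact: measurable_fst.
- by apply: measurable_funB.
- by apply: (measurableT_comp mW); apply: measurableT_comp.
Qed.

HB.instance Definition _ := isMeasurableFun.Build _ _ _ _ mixture measurable_mixture.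

Definition mix_step (mu : probability mR R) : probability mR R :=
  distribution (prod_prob mu (prod_prob P U)) mixture.

Lemma integral_mix_step (mu : probability mR R) (f : R -> \bar R) :
  measurable_fun setT f -> (forall x, 0 <= f x) ->
  \int[mix_step mu]_x f x = \int[mu]_x \int[P]_w
    \int[lebesgue_measure]_(u in `]0%R, 1%R[)
      f (mixing t u * `|x| + (1 - mixing t u) * W w)%R.
Proof.
move=> mf f0; rewrite /mix_step ge0_integral_distribution//.
have mfm : measurable_fun setT (f \o mixture).
  exact: (measurableT_comp mf measurable_mixture).
rewrite [LHS](fubini_tonelli1 (f \o mixture))//; last by move=> z; exact: f0.
apply: eq_integral => x _; rewrite /fubini_F.
have mfx : measurable_fun setT (fun y : T * mR => f (mixture (x, y))).
  by apply: (measurableT_comp mfm); exact: measurable_pair1.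
rewrite [LHS](fubini_tonelli1 (fun y : T * mR => f (mixture (x, y))))//.
apply: eq_integral => w _; rewrite /fubini_F.
have mfu : measurable_fun setT (fun u : mR => f (mixture (x, (w, u)))).
  by apply: (measurableT_comp mfx); exact: measurable_pair1.
rewrite integral_uniform// subr0 invr1 mul1e.
rewrite -integral_itv_bndo_bndc; last exact: measurable_funS mfu.
by rewrite -integral_itv_obnd_cbnd//; exact: measurable_funS mfu.
Qed.

(* Laws on the half-line are given by probabilities on [R], read through [`|x|]. *)
Definition stj (mu : probability mR R) (a l : R) : \bar R :=
  \int[mu]_x ((l + `|x|) `^ a)%:E.

Lemma measurable_powR_shift_norm (a l : R) :
  measurable_fun setT (fun x : R => (l + `|x|) `^ a)%R.
Proof.
apply: (measurableT_comp (measurable_powR a)).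
by apply: measurable_funD => //; exact: measurableT_comp.
Qed.

Lemma stj_ge0 mu a l : 0 <= stj mu a l.
Proof. by apply: integral_ge0 => x _; rewrite lee_fin powR_ge0. Qed.

(** Since [V + (1 - V) = 1], adding [l] to the mixture adds [l] to both [X] and [W], and
    [beta_integral] splits the power of order [t + 1] into order t in [l + X] and order 1 in
    [l + W]. *)
Lemma stj_mix_step_succ (mu : probability mR R) (l : R) : (0 < l)%R ->
  stj (mix_step mu) (- t - 1) l =
  stj mu (- t) l * \int[P]_w ((l + W w)^-1)%:E.
Proof.
move=> l0; rewrite /stj integral_mix_step; last 2 first.
- by apply/measurable_EFinP; exact: measurable_powR_shift_norm.
- by move=> x; rewrite lee_fin powR_ge0.
have minv : measurable_fun setT (fun w => (l + W w)^-1%R).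
  by apply: (measurableT_comp (@measurable_invr R)); exact: measurable_funD.
rewrite -ge0_integralZr//; last 3 first.
- by apply/measurable_EFinP; exact: measurable_powR_shift_norm.
- by move=> x _; rewrite lee_fin powR_ge0.
- by apply: integral_ge0 => w _; rewrite lee_fin invr_ge0 addr_ge0// ltW.
apply: eq_integral => x _.
rewrite -ge0_integralZl//; last 3 first.
- exact/measurable_EFinP.
- by move=> w _; rewrite lee_fin invr_ge0 addr_ge0// ltW.
- by rewrite lee_fin powR_ge0.
apply: eq_integral => w _; rewrite -EFinM.
rewrite -(beta_integral t0); last 2 first.
- by rewrite ltr_pwDl.
- by rewrite addr_gt0.
apply: eq_integral => u _; congr (_ `^ _)%:E.
rewrite ger0_norm; first by ring.
exact: (mixture_ge0 (x, (w, u))).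
Qed.

(** The factorization is available at order [t + 1] only; integrating [t (s + y)^(-t-1)] over
    [s > l] leads back to order t. *)
Lemma stj_tail (mu : probability mR R) (l : R) : (0 < l)%R ->
  stj mu (- t) l =
  \int[lebesgue_measure]_(s in `]l, +oo[) (t%:E * stj mu (- t - 1) s).
Proof.
move=> l0.
transitivity (\int[mu]_x \int[lebesgue_measure]_(s in `]l, +oo[)
    (t * (s + `|x|) `^ (- t - 1))%:E).
  by apply: eq_integral => x _; rewrite integral_powR_tail// ltr_pwDl.
rewrite (tonelli_in mu lebesgue_measure
  (fun (x s : R) => (t * (s + `|x|) `^ (- t - 1))%:E))//.
- apply: eq_integral => s _; rewrite /stj -ge0_integralZl//.
  + by apply/measurable_EFinP; exact: measurable_powR_shift_norm.
  + by move=> x _; rewrite lee_fin powR_ge0.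
  + by rewrite lee_fin ltW.
- apply/measurable_EFinP; apply: measurable_funM => //.
  apply: (measurableT_comp (measurable_powR _)).
  by apply: measurable_funD => //; apply: measurableT_comp => //; exact: measurable_fst.
- by move=> x s _ _; rewrite lee_fin mulr_ge0 ?powR_ge0// ltW.
Qed.

Lemma stj_mix_step (mu : probability mR R) (l : R) : (0 < l)%R ->
  stj (mix_step mu) (- t) l =
  \int[lebesgue_measure]_(s in `]l, +oo[)
    (t%:E * (stj mu (- t) s * \int[P]_w ((s + W w)^-1)%:E)).
Proof.
move=> l0; rewrite stj_tail//; apply: eq_integral => s.
rewrite inE/= in_itv/= andbT => ls.
by rewrite stj_mix_step_succ// (lt_trans l0).
Qed.

Definition acdf (mu : probability mR R) (z : R) : R := fine (mu [set x | (`|x| <= z)%R]).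

Lemma measurable_norm_le (z : R) : measurable [set x : mR | (`|x| <= z)%R].
Proof.
rewrite (_ : [set x | _] = (fun x : R => `|x|%R) @^-1` `]-oo, z]).
  by apply: preimage_measurable => //; exact: measurableT_comp.
by apply/seteqP; split => x /=; rewrite in_itv.
Qed.

Lemma acdfE (mu : probability mR R) z : mu [set x | (`|x| <= z)%R] = (acdf mu z)%:E.
Proof. by rewrite /acdf fineK// fin_num_measure//; exact: measurable_norm_le. Qed.

Lemma acdf_ge0 (mu : probability mR R) z : (0 <= acdf mu z)%R.
Proof. exact: fine_ge0. Qed.

Lemma acdf_le1 mu z : (acdf mu z <= 1)%R.
Proof. by rewrite -lee_fin -acdfE probability_le1//; exact: measurable_norm_le. Qed.

Lemma acdf_lt0 mu z : (z < 0)%R -> acdf mu z = 0%R.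
Proof.
move=> z0; rewrite /acdf (_ : [set x | _] = set0) ?measure0//.
apply/seteqP; split => x //= /(le_lt_trans)/(_ z0).
by rewrite ltNge normr_ge0.
Qed.

Lemma acdf_homo mu : {homo acdf mu : x y / (x <= y)%R}.
Proof.
move=> x y xy; rewrite -lee_fin -!acdfE le_measure ?inE//.
- exact: measurable_norm_le.
- exact: measurable_norm_le.
- by move=> z /= /le_trans; exact.
Qed.

(** An integration by parts carried out with Tonelli. The transform becomes an integral of the cdf
    against a positive kernel, so comparisons and limits of cdfs pass to transforms. *)
Lemma stj_acdf (mu : probability mR R) (l : R) : (0 < l)%R ->
  stj mu (- t) l = \int[lebesgue_measure]_(x in `[0%R, +oo[)
    (t * (x + l) `^ (- t - 1) * acdf mu x)%:E.
Proof.
move=> l0.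
have mp : measurable_fun setT (fun x : R => t * (x + l) `^ (- t - 1))%R.
  apply: measurable_funM => //; apply: (measurableT_comp (measurable_powR _)).
  exact: measurable_funD.
transitivity (\int[mu]_y \int[lebesgue_measure]_(x in `[0%R, +oo[)
    (t * (x + l) `^ (- t - 1) * \1_[set z : mR * mR | `|z.1| <= z.2] (y, x))%R%:E).
  apply: eq_integral => y _.
  rewrite addrC -(integral_powR_tail t0); last by rewrite ltr_wpDl.
  rewrite integral_itv_obnd_cbnd; last first.
    by apply/measurable_EFinP; exact: measurable_funS mp.
  rewrite [LHS]integral_mkcond [RHS]integral_mkcond; apply: eq_integral => x _.
  rewrite !patchE !mem_setE !in_itv/= !andbT indicE.
  rewrite (_ : ((y, x) \in _) = (`|y| <= x)%R); last by apply/idP/idP; rewrite inE.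
  have [yx|yx] := leP `|y|%R x; first by rewrite (le_trans _ yx)// mulr1.
  by rewrite mulr0; case: ifP.
rewrite (tonelli_in mu lebesgue_measure (fun y x : R =>
  (t * (x + l) `^ (- t - 1) * \1_[set z : mR * mR | `|z.1| <= z.2] (y, x))%R%:E))//.
- apply: eq_integral => x; rewrite inE/= in_itv/= andbT => x0.
  rewrite EFinM -acdfE -[X in _ = _ * mu X]setIT -integral_indic//; last exact: measurable_norm_le.
  rewrite -ge0_integralZl//.
  + by apply/measurable_EFinP; apply: measurable_indic; exact: measurable_norm_le.
  + by rewrite lee_fin mulr_ge0 ?powR_ge0// ltW.
- apply/measurable_EFinP; apply: measurable_funM.
    exact: (measurableT_comp mp measurable_snd).
  rewrite (_ : (fun x => _) = \1_[set z : mR * mR | `|z.1| <= z.2]%R); last first.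
    by apply/funext => -[].
  apply: measurable_indic; rewrite -[X in measurable X]setTI.
  have := @measurable_fun_ler _ _ _ setT (fun z : mR * mR => `|z.1|%R) (fun z : mR * mR => z.2)
    (measurableT_comp (@normr_measurable R setT) measurable_fst) measurable_snd.
  by move/(_ measurableT [set true] _); exact.
- by move=> y x _ _; rewrite lee_fin !mulr_ge0 ?powR_ge0// ltW.
Qed.

(** The step preserves the stochastic order: for fixed [w] and [u] the mixture is nondecreasing in
    [|x|], hence its sublevel sets have the form [|x| <= y]. *)
Lemma acdf_mix_step_le (mu nu : probability mR R) :
  (forall z, acdf mu z <= acdf nu z)%R ->
  forall z, (acdf (mix_step mu) z <= acdf (mix_step nu) z)%R.
Proof.
move=> munu z; rewrite -lee_fin -!acdfE.
pose A := [set x : mR * (T * mR) | (mixture x <= z)%R].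
have mA : measurable A.
  rewrite (_ : A = mixture @^-1` `]-oo, z]).
    by apply: preimage_measurable => //; exact: measurable_mixture.
  by apply/seteqP; split => x /=; rewrite in_itv.
have mi : measurable_fun setT (fun x => (\1_A x)%:E : \bar R).
  by apply/measurable_EFinP; exact: measurable_indic.
have E (m : probability mR R) : mix_step m [set x | (`|x| <= z)%R] =
    \int[prod_prob P U]_y m [set x | A (x, y)].
  transitivity (prod_prob m (prod_prob P U) A).
    rewrite /mix_step /distribution /pushforward; congr (prod_prob _ _ _).
    by apply/seteqP; split => x /=; rewrite ger0_norm// mixture_ge0.
  rewrite -[in LHS](setIT A) -integral_indic//.
  rewrite [LHS](fubini_tonelli2 (fun x => (\1_A x)%:E))//.
  apply: eq_integral => y _; rewrite /fubini_G.
  rewrite -[in RHS](setIT [set x | A (x, y)]) -integral_indic//.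
  by have := measurable_ysection y mA; rewrite ysectionE.
have mE (m : probability mR R) : measurable_fun setT (fun y => m [set x | A (x, y)]).
  have := @measurable_fun_ysection _ _ _ _ _ m A mA.
  by apply: eq_measurable_fun => y _; rewrite /= ysectionE.
rewrite !E; apply: ge0_le_integral => //.
move=> [w u] _.
have v0 := mixing_ge0 t u; have v1 := mixing_le1 t u.
rewrite /A /mixture /=.
(* For [V = 0] the mixture is [W w] whatever [x] is, and the event is everything or nothing;
   otherwise one divides by [V]. *)
move: v0; rewrite le_eqVlt => /predU1P[v0|v0].
  rewrite -v0; under eq_set do rewrite mul0r subr0 mul1r add0r.
  have [Wz|Wz] := leP (W w) z.
    rewrite (_ : [set x | _] = setT) ?probability_setT//.
    by apply/seteqP; split.
  by rewrite (_ : [set x | _] = set0) ?measure0//; apply/seteqP; split.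
pose y := ((z - (1 - mixing t u) * W w) / mixing t u)%R.
rewrite (_ : [set x | _] = [set x : mR | (`|x| <= y)%R]); last first.
  by apply/seteqP; split => x /=; rewrite /y ler_pdivlMr// lerBrDr mulrC.
by rewrite !acdfE lee_fin.
Qed.

End mixture.

(** * Probabilities with a prescribed cdf *)

Section cdf_existence.
Context {R : realType}.

Lemma exists_probability_cdf (F : R -> R) : {homo F : x y / x <= y} ->
  right_continuous F -> F @ -oo --> (0 : R) -> F @ +oo --> (1 : R) ->
  exists mu : probability (measurableTypeR R) R,
    forall r, (mu `]-oo, r]%classic = (F r)%:E)%E.
Proof.
move=> ndF rcF F0 F1.
pose F' := HB.pack_for (cumulativeBounded (0 : R) (1 : R)) F
  (isCumulative.Build R _ R F ndF rcF) (isCumulativeBounded.Build R 0 1 F F0 F1).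
exists (lebesgue_stieltjes_measure F') => r.
exact: (cdf_lebesgue_stieltjes_id F' r).
Qed.

Let normR : measurableTypeR R -> R := fun x => `|x|.

Let mnormR : measurable_fun setT normR. Proof. exact: measurableT_comp. Qed.

#[local] HB.instance Definition _ := isMeasurableFun.Build _ _ _ _ normR mnormR.

Lemma acdf_right_continuous (mu : probability (measurableTypeR R) R) :
  right_continuous (acdf mu).
Proof.
move=> z; have := @cdf_right_continuous _ _ _ mu (normR : {RV mu >-> R}) z.
have E x : cdf (normR : {RV mu >-> R}) x = (acdf mu x)%:E.
  rewrite -acdfE /cdf /distribution /pushforward; congr (mu _).
rewrite E => h; rewrite (_ : acdf mu = fine \o (cdf (normR : {RV mu >-> R}))).
  by apply: fine_cvg; rewrite /= E.
by apply/funext => x /=; rewrite E.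
Qed.

End cdf_existence.

(** * A comparison principle for the integral equation *)

Section gronwall.
Local Open Scope ereal_scope.
Context {R : realType}.
Variables (k f g : R -> R).
Hypotheses (k0 : forall s, (0 < s)%R -> (0 <= k s)%R)
  (f0 : forall s, (0 < s)%R -> (0 <= f s)%R) (g0 : forall s, (0 < s)%R -> (0 < g s)%R)
  (mk : measurable_fun (`]0%R, +oo[%classic : set R) k) (mf : measurable_fun (`]0%R, +oo[%classic : set R) f)
  (mg : measurable_fun (`]0%R, +oo[%classic : set R) g).
Hypotheses (fE : forall l, (0 < l)%R ->
    \int[lebesgue_measure]_(s in `]l, +oo[) (k s * f s)%:E = (f l)%:E)
  (gE : forall l, (0 < l)%R ->
    \int[lebesgue_measure]_(s in `]l, +oo[) (k s * g s)%:E = (g l)%:E).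
Hypothesis fg_bound : forall l, (0 < l)%R ->
  exists C, forall s, (l <= s)%R -> (f s <= C * g s)%R.
Hypothesis fg_limit : forall e, (0 < e)%R ->
  exists2 L, (0 < L)%R & forall s, (L <= s)%R -> (f s <= (1 + e) * g s)%R.

Let mkh (h : R -> R) l (J : interval R) : measurable_fun (`]0%R, +oo[%classic : set R) h -> (0 < l)%R ->
  (forall x, x \in J -> (l < x)%R) ->
  measurable_fun [set` J] (fun s => (k s * h s)%:E).
Proof.
move=> mh l0 J0; apply/measurable_EFinP.
apply: (@measurable_funS _ _ _ _ (`]0%R, +oo[%classic : set R)) => //.
  by move=> x /= /J0 lx; rewrite in_itv/= andbT (lt_trans l0).
exact: measurable_funM.
Qed.

Let splitE (h : R -> R) l L : measurable_fun (`]0%R, +oo[%classic : set R) h -> (forall s, (0 < s)%R -> (0 <= h s)%R) ->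
  (0 < l)%R -> (l <= L)%R ->
  \int[lebesgue_measure]_(s in `]l, +oo[) (k s * h s)%:E =
  \int[lebesgue_measure]_(s in `]l, L]) (k s * h s)%:E +
  \int[lebesgue_measure]_(s in `]L, +oo[) (k s * h s)%:E.
Proof.
move=> mh h0 l0 lL; rewrite -ge0_integral_setU//=.
- congr (integral _ _ _); apply/seteqP; split => x /=; rewrite !in_itv/= ?andbT.
    by move=> lx; case: (leP x L) => xL; [left; rewrite lx|right].
  by case=> [/andP[]//|]; apply: le_lt_trans.
- rewrite (_ : _ `|` _ = `]l, +oo[%classic); first by apply: (mkh mh l0) => x; rewrite in_itv/= andbT.
  apply/seteqP; split => x /=; rewrite !in_itv/= ?andbT.
    by case=> [/andP[]//|]; apply: le_lt_trans.
  by move=> lx; case: (leP x L) => xL; [left; rewrite lx|right].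
- move=> x; rewrite !in_itv/= andbT => hx; have x0 : (0 < x)%R.
    by case: hx => [/andP[lx _]|Lx]; [exact: lt_trans lx|apply: lt_trans Lx; exact: lt_le_trans lL].
  by rewrite lee_fin mulr_ge0 ?k0 ?h0.
- apply/disj_setPLR => x /=; rewrite !in_itv/= andbT => /andP[_ xL].
  by apply/negP; rewrite -leNgt.
Qed.

(** Let [M] be the supremum of [f / g] on [[l, +oo[] and suppose [M > B = 1 + e']. Beyond [L] the
    ratio is at most [B]. For [s < L], bounding [f] by [M g] in the integral over []s, L]] gives
    [f s <= M (g s - g L) + B g L]: after division by [g s] this is a convex combination of [M] and
    [B] in which [B] has weight at least [th > 0]. The supremum would then lie below [M]. *)
Lemma gronwall_le l : (0 < l)%R -> (f l <= g l)%R.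
Proof.
move=> l0; apply/ler_addgt0Pr => e e0.
have [C fC] := fg_bound l0.
(* Chosen so that [(1 + e') * g l = g l + e]. *)
pose e' := (e / g l)%R; have e'0 : (0 < e')%R by rewrite divr_gt0// g0.
have [L' L'0 fL'] := fg_limit e'0.
pose L := Num.max L' l.
have lL : (l <= L)%R by rewrite le_max lexx orbT.
have L0 : (0 < L)%R by exact: lt_le_trans lL.
have fL s : (L <= s)%R -> (f s <= (1 + e') * g s)%R.
  by move=> Ls; apply: fL'; apply: le_trans Ls; rewrite le_max lexx.
pose B := (1 + e')%R.
pose E := [set (f s / g s)%R | s in [set s | (l <= s)%R]].
have E0 : E !=set0 by exists (f l / g l)%R; exists l => /=.
have Eub : has_ubound E.
  exists C => _ [s /= ls <-]; have s0 := lt_le_trans l0 ls.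
  by rewrite ler_pdivrMr ?g0// fC.
pose M := sup E.
have fM s : (l <= s)%R -> (f s <= M * g s)%R.
  move=> ls; have s0 := lt_le_trans l0 ls.
  by rewrite -ler_pdivrMr ?g0//; apply: ub_le_sup => //; exists s.
have gle s s' : (0 < s)%R -> (s <= s')%R -> (g s' <= g s)%R.
  move=> s0 ss'; rewrite -lee_fin -(gE s0) -(gE (lt_le_trans s0 ss')).
  rewrite (splitE mg _ s0 ss'); last by move=> ? /g0 /ltW.
  rewrite leeDr// integral_ge0// => x /=; rewrite in_itv/= => /andP[sx _].
  have x0 := lt_trans s0 sx.
  by rewrite lee_fin mulr_ge0 ?k0 ?ltW// g0.
suff MB : (M <= B)%R.
  have := fM l (lexx l); have gl := g0 l0.
  have : (M * g l <= B * g l)%R by rewrite ler_pM2r.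
  rewrite /B /e' mulrDl mul1r mulfVK ?gt_eqF//; lra.
rewrite leNgt; apply/negP => BM.
(* As [g] is nonincreasing, [g L / g s >= th] for every [s >= l]: a lower bound on the weight of [B]
   that does not depend on [s]. *)
pose th := (g L / g l)%R.
have th0 : (0 < th)%R by rewrite divr_gt0 ?g0.
suff : (M <= M * (1 - th) + B * th)%R by nra.
apply: ge_sup => // _ [s /= ls <-].
have s0 := lt_le_trans l0 ls; have gs := g0 s0.
have thE : (th <= 1)%R by rewrite /th ler_pdivrMr ?g0// mul1r gle.
have [Ls|sL] := leP L s.
  have : (f s / g s <= B)%R by rewrite ler_pdivrMr// fL.
  by nra.
rewrite ler_pdivrMr//.
have : (f s <= M * (g s - g L) + f L)%R.
  rewrite -lee_fin -fE// (splitE mf f0 s0 (ltW sL)) (fE L0) EFinD leeD2r//.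
  have := gE s0; rewrite (splitE mg _ s0 (ltW sL)); last by move=> ? /g0 /ltW.
  rewrite (gE L0) => h.
  have -> : (M * (g s - g L))%:E = M%:E * \int[lebesgue_measure]_(s in `]s, L]) (k s * g s)%:E.
    by rewrite EFinM EFinB -h addeK.
  rewrite -ge0_integralZl//.
  - apply: ge0_le_integral => //.
    + move=> x /=; rewrite in_itv/= => /andP[sx _]; have x0 := lt_trans s0 sx.
      by rewrite lee_fin mulr_ge0 ?k0 ?f0.
    + by apply: (mkh mf s0) => x; rewrite in_itv/= => /andP[].
    + apply: measurable_funeM.
      by apply: (mkh mg s0) => x; rewrite in_itv/= => /andP[].
    + move=> x /=; rewrite in_itv/= => /andP[sx _]; have x0 := lt_trans s0 sx.
      rewrite -EFinM lee_fin mulrCA ler_wpM2l ?k0// fM//.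
      exact: le_trans ls (ltW sx).
  - by apply: (mkh mg s0) => x; rewrite in_itv/= => /andP[].
  - move=> x /=; rewrite in_itv/= => /andP[sx _]; have x0 := lt_trans s0 sx.
    by rewrite lee_fin mulr_ge0 ?k0 ?ltW// g0.
  - rewrite lee_fin; apply: le_trans (ltW BM); rewrite /B; lra.
have := fL L (lexx L); rewrite -/B => fLL.
have ths : (th * g s <= g L)%R.
  by rewrite /th mulrAC ler_pdivrMr ?g0// ler_wpM2l ?gle// ltW// g0.
by nra.
Qed.

End gronwall.

(** * Behaviour of [E log (l + W)] at infinity *)

Section logm_asymptotics.
Context {R : realType} d (T : measurableType d) (P : probability T R).
Variable W : T -> R.
Hypotheses (mW : measurable_fun setT W) (W0 : forall w, 0 < W w)
  (lnW : (\int[P]_w `|ln (W w)|%:E < +oo)%E).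

Lemma logm_sub_ln l : 0 < l -> (\int[P]_w (ln (1 + W w / l))%:E = (logm P W l - ln l)%:E)%E.
Proof.
move=> l0.
rewrite EFinB -(logmE mW W0 lnW (ltW l0)).
have -> : (ln l)%:E = (\int[P]_w (ln l)%:E)%E.
  by rewrite integral_cst//= [X in (_ * X)%E]probability_setT mule1.
rewrite -integralB_EFin//; last 2 first.
- exact: integrable_logm (ltW l0).
- exact: finite_measure_integrable_cst.
apply: eq_integral => w _; rewrite -EFinB -ln_div ?posrE ?addr_gt0//.
by rewrite mulrDl divff// gt_eqF.
Qed.

(** The difference is [E ln (1 + W / l)]. Dominated convergence along the integers makes it small at
    one of them, and monotonicity in [l] extends the bound to all larger [l]. Equivalently
    [S(l) ~ l^(-t)]. *)
Lemma logm_sub_ln_lt e : 0 < e ->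
  exists2 L, 0 < L & forall l, L <= l -> logm P W l - ln l < e.
Proof.
move=> e0.
have Wl w (l : R) : 0 < l -> 0 < 1 + W w / l.
  by move=> l0; rewrite addr_gt0// divr_gt0.
have mln (l : R) : measurable_fun setT (fun w => ln (1 + W w / l)).
  by apply: measurableT_comp => //; apply: measurable_funD => //; exact: measurable_funM.
have homo (l l' : R) w : 0 < l -> l <= l' -> ln (1 + W w / l') <= ln (1 + W w / l).
  move=> l0 ll'; have l'0 := lt_le_trans l0 ll'.
  by rewrite ler_ln ?posrE ?Wl// lerD2l ler_wpM2l ?(ltW (W0 w))// lef_pV2.
have pos (l : R) w : 0 < l -> 0 <= ln (1 + W w / l).
  by move=> l0; rewrite ln_ge0// lerDl divr_ge0// ltW.
have c : (\int[P]_w (ln (1 + W w / n.+1%:R))%:E @[n --> \oo] --> \int[P]_w (0 : R)%:E)%E.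
  apply: (dominated_cvg_fin (g := fun w => ln (1 + W w))).
  - by move=> n; exact: mln.
  - move=> w.
    have h : 1 + W w * harmonic n @[n --> \oo] --> (1 + W w * 0 : R).
      by apply: cvgD; [exact: cvg_cst|apply: cvgMr; exact: cvg_harmonic].
    rewrite mulr0 addr0 in h.
    have h2 : ln x @[x --> (1 : R)] --> ln (1 : R) by exact: continuous_ln.
    by have := cvg_comp _ _ h h2; rewrite ln1.
  - exact: integrable_logm.
  - move=> n w; rewrite ger0_norm ?pos// -[W w in leRHS]divr1.
    by apply: homo => //; rewrite ler1n.
move: c; under eq_fun do rewrite logm_sub_ln//.
rewrite integral0 => /fine_cvgP[_ /cvgrPdist_lt /(_ _ e0)] [n _ /(_ n (leqnn n))].
rewrite /= sub0r normrN => h.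
exists n.+1%:R => // l nl; apply: le_lt_trans (le_lt_trans (ler_norm _) h).
rewrite -lee_fin -!logm_sub_ln//; last by exact: lt_le_trans nl.
apply: ge0_le_integral => //.
- by move=> w _; rewrite lee_fin pos// (lt_le_trans _ nl).
- exact/measurable_EFinP.
- exact/measurable_EFinP.
- by move=> w _; rewrite lee_fin homo.
Qed.

End logm_asymptotics.

(** * Construction of the law of [D] by monotone iteration *)

Section mixing_law.
Local Open Scope ereal_scope.
Context {R : realType} d (T : measurableType d) (P : probability T R).
Variables (W : T -> R) (t : R).
Hypotheses (mW : measurable_fun setT W) (W0 : forall w, (0 < W w)%R)
  (lnW : \int[P]_w `|ln (W w)|%:E < +oo) (t0 : (0 < t)%R).

Local Notation mR := (measurableTypeR R).

Let mu_ (n : nat) : probability mR R := iter n (mix_step P t mW) (\d_ (0%R : mR)).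

Let A_ n z : R := acdf (mu_ n) z.

Let A0 (z : R) : (0 <= z)%R -> A_ 0 z = 1%R.
Proof.
move=> z0; rewrite /A_ /acdf [X in fine X](_ : _ = 1)//.
by rewrite /= /dirac indicE mem_set//= normr0.
Qed.

(** The point mass at 0 has the largest cdf possible on the half-line, so the first step can only
    lower it; monotonicity of [mix_step] propagates this to all steps. *)
Let A_decr z : nonincreasing_seq (A_ ^~ z).
Proof.
suff h n y : (A_ n.+1 y <= A_ n y)%R by apply/nonincreasing_seqP => n; exact: h.
elim: n y => [y|n IH y]; last exact: (acdf_mix_step_le P t mW W0 IH).
have [y0|y0] := ltP y 0%R; first by rewrite /A_ !acdf_lt0.
by rewrite A0// acdf_le1.
Qed.

Let F (z : R) : R := limn (A_ ^~ z).

Let Acvg z : A_ n z @[n --> \oo] --> F z.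
Proof.
apply: nonincreasing_is_cvgn; first exact: A_decr.
by exists 0%R => _ [n _ <-]; exact: acdf_ge0.
Qed.

Let F_le n z : (F z <= A_ n z)%R.
Proof. by apply: nonincreasing_cvgn_ge; [exact: A_decr|exact: cvgP _ (@Acvg z)]. Qed.

Let F_ge0 z : (0 <= F z)%R.
Proof.
by apply: limr_ge; [exact: cvgP _ (@Acvg z)|apply: nearW => n; exact: acdf_ge0].
Qed.

Let F_le1 z : (F z <= 1)%R.
Proof. exact: le_trans (F_le 0 z) (acdf_le1 _ _). Qed.

Let F_lt0 z : (z < 0)%R -> F z = 0%R.
Proof.
by move=> z0; apply/eqP; rewrite eq_le F_ge0 andbT (le_trans (F_le 0 z))// /A_ acdf_lt0.
Qed.

Let F_homo : {homo F : x y / (x <= y)%R}.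
Proof.
move=> x y xy; apply: ler_lim; [exact: cvgP _ (@Acvg x)|exact: cvgP _ (@Acvg y)|].
by apply: nearW => n; exact: acdf_homo.
Qed.

(** [F] lies below every [A_ n], each right-continuous, so near [a] on the right it cannot exceed
    [F a] by much; it is not smaller there because it is nondecreasing. *)
Let F_rc : right_continuous F.
Proof.
move=> a; apply/cvgrPdist_lt => e e0.
have /cvgrPdist_lt /(_ _ (divr_gt0 e0 (ltr0n _ 2))) [n _ /(_ n (leqnn n)) /= hn] := @Acvg a.
have /cvgrPdist_lt /(_ _ (divr_gt0 e0 (ltr0n _ 2))) := @acdf_right_continuous R (mu_ n) a.
move=> h; near=> x.
have h1 : (`|A_ n a - A_ n x| < e / 2)%R by near: x; exact: h.
have ax : (a <= x)%R by near: x; apply: nbhs_right_ge.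
have h2 := F_le n x; have h3 := F_homo ax.
by rewrite ler0_norm ?subr_le0// opprB; move: h1 hn; rewrite !ltr_norml => /andP[? ?] /andP[? ?]; lra.
Unshelve. all: by end_near. Qed.

Let dens (l x : R) : R := (t * (x + l) `^ (- t - 1))%R.

Let mdens l : measurable_fun setT (dens l).
Proof.
apply: measurable_funM => //; apply: (measurableT_comp (measurable_powR _)).
exact: measurable_funD.
Qed.

Let dens_ge0 l x : (0 <= dens l x)%R.
Proof. by rewrite mulr_ge0 ?powR_ge0// ltW. Qed.

Let int_dens l : (0 < l)%R ->
  \int[lebesgue_measure]_(x in `[0%R, +oo[) (dens l x)%:E = (l `^ (- t))%:E.
Proof.
move=> l0; rewrite -integral_itv_obnd_cbnd; last first.
  by apply/measurable_EFinP; exact: measurable_funS (mdens l).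
by rewrite integral_powR_tail ?add0r.
Qed.

Let S_ n l : R := fine (stj (mu_ n) (- t) l).

Let stj_le n l : (0 < l)%R -> stj (mu_ n) (- t) l <= (l `^ (- t))%:E.
Proof.
move=> l0; rewrite stj_acdf// -int_dens//; apply: ge0_le_integral => //.
- by move=> x _; rewrite lee_fin mulr_ge0 ?acdf_ge0 ?dens_ge0.
- apply/measurable_EFinP; apply: measurable_funS (_ : measurable_fun setT _) => //.
  apply: measurable_funM; first exact: mdens.
  by apply: nondecreasing_measurable => //; exact: acdf_homo.
- by apply/measurable_EFinP; exact: measurable_funS (mdens l).
- by move=> x _; rewrite lee_fin ler_piMr ?dens_ge0// acdf_le1.
Qed.

Let S_E n l : (0 < l)%R -> stj (mu_ n) (- t) l = (S_ n l)%:E.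
Proof.
move=> l0; rewrite /S_ fineK// ge0_fin_numE ?stj_ge0//.
exact: le_lt_trans (stj_le n l0) (ltry _).
Qed.

Let S_le n l : (0 < l)%R -> (S_ n l <= l `^ (- t))%R.
Proof. by move=> l0; rewrite -lee_fin -S_E//; exact: stj_le. Qed.

Let S_ge0 n l : (0 <= S_ n l)%R.
Proof. by apply: fine_ge0; exact: stj_ge0. Qed.

Let k (s : R) : R := (t * inv_mean P W s)%R.

Let k_ge0 s : (0 < s)%R -> (0 <= k s)%R.
Proof. by move=> s0; rewrite mulr_ge0 ?inv_mean_ge0// ltW. Qed.

Let mk : measurable_fun (`]0%R, +oo[%classic : set R) k.
Proof.
apply: measurable_funM => //; apply: open_continuous_measurable_fun => // x.
by rewrite inE/= in_itv/= andbT => x0; exact: continuous_inv_mean.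
Qed.

Let mS n : measurable_fun setT (S_ n).
Proof.
suff h : measurable_fun setT (fun l : R => stj (mu_ n) (- t) l).
  exact: (measurableT_comp (fine_measurable measurableT) h).
apply: (measurable_integral_param (mu_ n) (fun (l x : R) => ((l + `|x|) `^ (- t))%:E)) => //.
  apply/measurable_EFinP; apply: (measurableT_comp (measurable_powR _)).
  by apply: measurable_funD => //; apply: measurableT_comp => //; exact: measurable_snd.
by move=> l x; rewrite lee_fin powR_ge0.
Qed.

Let S_step n l : (0 < l)%R ->
  (S_ n.+1 l)%:E = \int[lebesgue_measure]_(s in `]l, +oo[) (k s * S_ n s)%:E.
Proof.
move=> l0; rewrite -S_E// [LHS]stj_mix_step//; apply: eq_integral => s.
rewrite inE/= in_itv/= andbT => ls; have s0 := lt_trans l0 ls.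
by rewrite (inv_meanE P mW W0 s0) -/mu_ S_E// -!EFinM; congr EFin; rewrite /k; ring.
Qed.

Let mkS (h : R -> R) (l : R) : measurable_fun (`]0%R, +oo[%classic : set R) h -> (0 < l)%R ->
  measurable_fun (`]l, +oo[%classic : set R) (fun s => (k s * h s)%:E).
Proof.
move=> mh l0; apply/measurable_EFinP.
apply: (@measurable_funS _ _ _ _ (`]0%R, +oo[%classic : set R)) => //.
  by move=> x /=; rewrite !in_itv/= !andbT; exact: lt_trans.
exact: measurable_funM.
Qed.

Let mexplogm : measurable_fun (`]0%R, +oo[%classic : set R) (explogm P W t).
Proof.
apply: open_continuous_measurable_fun => // x.
rewrite inE/= in_itv/= andbT => x0.
exact: continuous_explogm.
Qed.

(** True for the starting transform [l^(-t)], since [E log (l + W) >= log l], and preserved because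
    one step is a monotone operation that fixes [explogm]. *)
Let S_ge n l : (0 < l)%R -> (explogm P W t l <= S_ n l)%R.
Proof.
elim: n l => [l l0|n IH l l0].
  apply: le_trans (explogm_le mW W0 lnW t0 l0) _.
  rewrite -lee_fin -S_E// /stj integral_dirac//; last first.
    by apply/measurable_EFinP; exact: measurable_powR_shift_norm.
  by rewrite diracT mul1e normr0 addr0.
rewrite -lee_fin S_step// -(integral_explogm mW W0 lnW t0 l0).
apply: ge0_le_integral => //.
- move=> s /=; rewrite in_itv/= andbT => ls; have s0 := lt_trans l0 ls.
  by rewrite lee_fin mulr_ge0 ?k_ge0// expR_ge0.
- exact: mkS.
- by apply: mkS => //; exact: measurable_funS (mS n).
- move=> s /=; rewrite in_itv/= andbT => ls; have s0 := lt_trans l0 ls.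
  by rewrite lee_fin ler_wpM2l ?k_ge0// IH.
Qed.

Let Sig l : R := fine (\int[lebesgue_measure]_(x in `[0%R, +oo[) (dens l x * F x)%:E).

Let mF : measurable_fun setT F.
Proof. by apply: nondecreasing_measurable => //; exact: F_homo. Qed.

Let mdF l : measurable_fun setT (fun x => dens l x * F x)%R.
Proof. by apply: measurable_funM. Qed.

Let Sig_lim l : (0 < l)%R ->
  (S_ n l)%:E @[n --> \oo] --> \int[lebesgue_measure]_(x in `[0%R, +oo[) (dens l x * F x)%:E.
Proof.
move=> l0.
rewrite (_ : (fun n => _) =
    (fun n => \int[lebesgue_measure]_(x in `[0%R, +oo[) (dens l x * A_ n x)%:E)); last first.
  by apply/funext => n; rewrite -S_E// stj_acdf.
apply: (@dominated_cvg_in R _ _ lebesgue_measure _ (fun n x => dens l x * A_ n x)%R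
  (fun x => dens l x * F x)%R (dens l)) => //.
- move=> n; apply: measurable_funTS; apply: measurable_funM; first exact: mdens.
  by apply: nondecreasing_measurable => //; exact: acdf_homo.
- by move=> x _; apply: cvgMr; exact: Acvg.
- apply: ge0_integrable_in => //; first by apply: measurable_funTS; exact: mdens.
  by rewrite int_dens// ltry.
- move=> n x _; rewrite ger0_norm; last by apply: mulr_ge0; [exact: dens_ge0|exact: acdf_ge0].
  by rewrite ler_piMr ?acdf_le1//; exact: dens_ge0.
Qed.

Let Sig_E l : (0 < l)%R ->
  \int[lebesgue_measure]_(x in `[0%R, +oo[) (dens l x * F x)%:E = (Sig l)%:E.
Proof.
move=> l0; rewrite /Sig fineK// ge0_fin_numE; last first.
  by apply: integral_ge0 => x _; rewrite lee_fin mulr_ge0.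
apply: le_lt_trans (ltry (l `^ (- t))); rewrite -int_dens//.
apply: ge0_le_integral => //.
- by move=> x _; rewrite lee_fin mulr_ge0.
- by apply/measurable_EFinP; apply: measurable_funTS; exact: mdF.
- by apply/measurable_EFinP; apply: measurable_funTS; exact: mdens.
- by move=> x _; rewrite lee_fin ler_piMr.
Qed.

Let Sig_cvg l : (0 < l)%R -> S_ n l @[n --> \oo] --> Sig l.
Proof.
by move=> l0; have := Sig_lim l0; rewrite Sig_E// => /fine_cvgP[].
Qed.

Let Sig_le l : (0 < l)%R -> (Sig l <= l `^ (- t))%R.
Proof.
move=> l0; have h := Sig_cvg l0; rewrite -(cvg_lim (@Rhausdorff R) h).
by apply: limr_le; [exact: cvgP h|apply: nearW => n; exact: S_le].
Qed.

Let Sig_ge l : (0 < l)%R -> (explogm P W t l <= Sig l)%R.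
Proof.
move=> l0; have h := Sig_cvg l0; rewrite -(cvg_lim (@Rhausdorff R) h).
by apply: limr_ge; [exact: cvgP h|apply: nearW => n; exact: S_ge].
Qed.

Let mSig : measurable_fun (`]0%R, +oo[%classic : set R) Sig.
Proof.
apply: (measurable_fun_cvg (fun n => measurable_funTS (mS n))) => x /=.
by rewrite in_itv/= andbT; exact: Sig_cvg.
Qed.

(** The recursion [S_step] passes to the limit under the domination [S_ n s <= s^(-t)]. *)
Let Sig_fix l : (0 < l)%R ->
  \int[lebesgue_measure]_(s in `]l, +oo[) (k s * Sig s)%:E = (Sig l)%:E.
Proof.
move=> l0.
have c1 : \int[lebesgue_measure]_(s in `]l, +oo[) (k s * S_ n s)%:E @[n --> \oo] -->
    \int[lebesgue_measure]_(s in `]l, +oo[) (k s * Sig s)%:E.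
  apply: (@dominated_cvg_in R _ _ lebesgue_measure _ (fun n s => k s * S_ n s)%R
    (fun s => k s * Sig s)%R (fun s => k s * s `^ (- t))%R) => //.
  - by move=> n; apply/measurable_EFinP; exact: (mkS (measurable_funTS (@mS n)) l0).
  - move=> s /=; rewrite in_itv/= andbT => ls.
    by apply: cvgMr; apply: Sig_cvg; exact: lt_trans ls.
  (* The dominating function is [k * S_ 0], and its integral is the finite number [S_ 1 l]; this is
     how its integrability is known. *)
  - have S0E s : (0 < s)%R -> S_ 0 s = (s `^ (- t))%R.
      move=> s0; apply: EFin_inj; rewrite -S_E// /stj integral_dirac//; last first.
        by apply/measurable_EFinP; exact: measurable_powR_shift_norm.
      by rewrite diracT mul1e normr0 addr0.
    apply: ge0_integrable_in => //.
    + apply/measurable_EFinP; exact: (mkS (measurable_funTS (@measurable_powR R (- t)%R)) l0).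
    + move=> s /=; rewrite in_itv/= andbT => ls.
      by rewrite mulr_ge0 ?powR_ge0// k_ge0// (lt_trans l0).
    + rewrite [X in X < _](_ : _ = (S_ 1 l)%:E) ?ltry// S_step//.
      apply: eq_integral => s; rewrite inE/= in_itv/= andbT => ls.
      by rewrite S0E// (lt_trans l0).
  - move=> n s /=; rewrite in_itv/= andbT => ls; have s0 := lt_trans l0 ls.
    rewrite ger0_norm; last by apply: mulr_ge0; [exact: k_ge0|exact: S_ge0].
    by rewrite ler_wpM2l ?k_ge0// S_le.
have c2 : (S_ n.+1 l)%:E @[n --> \oo] --> (Sig l)%:E.
  apply: cvg_EFin; first exact: nearW.
  by have := Sig_cvg l0; rewrite -cvg_shiftS.
apply: (cvg_unique _ c1) => //.
by move: c2; under eq_fun do rewrite S_step//.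
Qed.

Let powR_explogm (e : R) : (0 < e)%R -> exists2 L, (0 < L)%R &
  forall s, (L <= s)%R -> (s `^ (- t) <= (1 + e) * explogm P W t s)%R.
Proof.
move=> e0.
have le0 : (0 < ln (1 + e) / t)%R by rewrite divr_gt0// ln_gt0// ltrDl.
have [L L0 hL] := logm_sub_ln_lt mW W0 lnW le0.
exists L => // s Ls; have s0 := lt_le_trans L0 Ls.
have := hL _ Ls; rewrite ltr_pdivlMr// => h.
have e1 : (0 < 1 + e)%R by rewrite addr_gt0.
rewrite -[X in (_ <= X * _)%R]lnK ?posrE// /explogm -expRD /powR gt_eqF// ler_expR.
by rewrite mulNr; move: h; rewrite mulrBl; lra.
Qed.

(** One inequality is the limit of [S_ge]. The other is the comparison principle: both functions
    solve the same equation, and [Sig s <= s^(-t) <= (1 + e) * explogm s] near infinity. *)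
Let Sig_explogm l : (0 < l)%R -> Sig l = explogm P W t l.
Proof.
move=> l0; apply/eqP; rewrite eq_le Sig_ge// andbT.
apply: (@gronwall_le R k Sig (explogm P W t)) => //.
- by move=> s s0; apply: le_trans (Sig_ge s0); exact: expR_ge0.
- by move=> s s0; exact: expR_gt0.
- by move=> s s0; exact: (integral_explogm mW W0 lnW t0 s0).
- move=> b b0.
  have [L L0 hL] := powR_explogm ltr01.
  (* The constant [1 + 1] works beyond [L], where [e = 1] was chosen; on [[b, L]] one has
     [s^(-t) <= b^(-t)], while [explogm] is at least its value at [L]. *)
  exists (Num.max (1 + 1) (b `^ (- t) / explogm P W t L))%R => s bs.
  have s0 := lt_le_trans b0 bs.
  apply: le_trans (Sig_le s0) _.
  have [Ls|sL] := leP L s.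
    apply: le_trans (hL _ Ls) _; apply: ler_wpM2r; first exact: expR_ge0.
    by rewrite le_max lexx.
  apply: (@le_trans _ _ (b `^ (- t) / explogm P W t L * explogm P W t s)%R).
    have E1 : (explogm P W t L <= explogm P W t s)%R.
      rewrite /explogm ler_expR lerN2 ler_pM2l//.
      rewrite -lee_fin -(logmE mW W0 lnW (ltW s0)) -(logmE mW W0 lnW (ltW L0)).
      apply: le_integral => //.
      + exact: integrable_logm (ltW s0).
      + exact: integrable_logm (ltW L0).
      + move=> w _; rewrite lee_fin ler_ln ?posrE ?addr_gt0//.
        by rewrite lerD2r ltW.
    have E2 : (s `^ (- t) <= b `^ (- t))%R.
      by rewrite !powRN lef_pV2 ?posrE ?powR_gt0// ge0_ler_powR ?nnegrE// ltW.
    have L1 : (0 < explogm P W t L)%R by exact: expR_gt0.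
    apply: le_trans E2 _; rewrite mulrAC ler_pdivlMr//.
    by rewrite ler_wpM2l// powR_ge0.
  apply: ler_wpM2r; first exact: expR_ge0.
  by rewrite le_max lexx orbT.
- move=> e e0; have [L L0 hL] := powR_explogm e0; exists L => // s Ls.
  have s0 := lt_le_trans L0 Ls; exact: le_trans (Sig_le s0) (hL _ Ls).
Qed.

(** No mass escapes: if [F <= 1 - e] everywhere, then for large [L] the transform satisfies [Sig L
    <= (1 - e) L^(-t) <= (1 - e)(1 + e) explogm L], which is less than [explogm L = Sig L]. *)
Let F_cvg1 : F x @[x --> +oo%R] --> (1 : R)%R.
Proof.
apply/cvgrPdist_lt => e e0.
suff [x hx] : exists x, (1 - e < F x)%R.
  exists x; split=> [|y xy]; first exact: num_real.
  have h1 := F_homo (ltW xy); have h2 := F_le1 y.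
  by rewrite /= ger0_norm ?subr_ge0//; lra.
apply: contrapT => /forallNP h.
have h' x : (F x <= 1 - e)%R by rewrite leNgt; apply/negP; exact: h.
have e1 : (0 <= 1 - e)%R by exact: le_trans (F_ge0 0%R) (h' 0%R).
have [L L0 hL] := powR_explogm e0.
have : (Sig L <= (1 - e) * L `^ (- t))%R.
  rewrite -lee_fin -Sig_E// EFinM -int_dens// -ge0_integralZl//.
  - apply: ge0_le_integral => //.
    + by move=> x _; rewrite lee_fin mulr_ge0.
    + by apply/measurable_EFinP; apply: measurable_funTS; exact: mdF.
    + by apply: measurable_funeM; apply/measurable_EFinP; apply: measurable_funTS; exact: mdens.
    + by move=> x _; rewrite -EFinM lee_fin mulrC ler_wpM2r.
  - by apply/measurable_EFinP; apply: measurable_funTS; exact: mdens.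
  - by move=> x _; rewrite lee_fin.
have := hL L (lexx L); rewrite Sig_explogm//.
have : (0 < explogm P W t L)%R by exact: expR_gt0.
set a := explogm P W t L; set b := (L `^ (- t))%R => a0 ba ab.
have : (a <= (1 - e) * ((1 + e) * a))%R by apply: (le_trans ab); exact: ler_wpM2l.
have : (0 < e * e * a)%R by rewrite !mulr_gt0.
have -> : ((1 - e) * ((1 + e) * a) = a - e * e * a)%R by ring.
by lra.
Qed.

Let F_cvg0 : F x @[x --> -oo%R] --> (0 : R)%R.
Proof.
apply: cvg_near_cst; exists 0%R; split; first exact: num_real.
by move=> x x0; exact: F_lt0.
Qed.

(* The limit of the laws of [X_n], where [X_(n+1) = V X_n + (1 - V) W] in law with
   [V = U ^ (1/t)] and [X_0 = 0]: their cdfs decrease, and their Stieltjes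
   transforms satisfy the integral equation of [gronwall_le]. *)
Theorem exists_mixing_law : exists mu : probability mR R,
  forall l, (0 < l)%R -> stj mu (- t) l = (explogm P W t l)%:E.
Proof.
have [mu muE] := exists_probability_cdf F_homo F_rc F_cvg0 F_cvg1.
exists mu => l l0.
rewrite -Sig_explogm// -Sig_E// stj_acdf//.
apply: eq_integral => x; rewrite inE/= in_itv/= andbT => x0.
congr ((_ * _)%:E); apply: EFin_inj; rewrite -acdfE -muE.
(* [mu] does not charge the negative numbers, exhausted here by closed half-lines; hence [|y| <= x]
   and [y <= x] have the same probability. *)
have N0 : mu.-negligible (\bigcup_n `]-oo, (- harmonic n)%R]%classic).
  apply: negligible_bigcup => n; apply/negligibleP => //.
  by rewrite [LHS]muE F_lt0// oppr_lt0 harmonic_gt0.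
have mN : measurable (\bigcup_n (`]-oo, (- harmonic n)%R]%classic : set mR)).
  exact: bigcup_measurable.
apply/eqP; rewrite eq_le; apply/andP; split.
  apply: le_measure; rewrite ?inE//; first exact: measurable_norm_le.
  by move=> y /=; rewrite in_itv/=; apply: le_trans; exact: ler_norm.
rewrite -[leRHS]adde0 -(negligibleP mu mN).1//.
apply: (@le_trans _ _ (mu ([set y : mR | (`|y| <= x)%R] `|`
    \bigcup_n (`]-oo, (- harmonic n)%R]%classic : set mR)))); last first.
  by apply: measureU2 => //; exact: measurable_norm_le.
apply: le_measure; rewrite ?inE//.
  by apply: measurableU => //; exact: measurable_norm_le.
move=> y /=; rewrite in_itv/= => yx.
have [y0|y0] := leP 0%R y; first by left; rewrite ger0_norm.
right; have ny : (0 < - y)%R by rewrite oppr_gt0.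
have /cvgrPdist_lt /(_ _ ny) [n _ /(_ n (leqnn n))] := @cvg_harmonic R.
rewrite /= sub0r normrN gtr0_norm// => h.
by exists n => //=; rewrite in_itv/= lerNr ltW.
Qed.

End mixing_law.

(** * The Bessel function as a power series [phi] *)

Section bessel_series.
Context {R : realType}.
Implicit Types (s u : R).

Definition phic s (k : nat) : R := (-1) ^+ k / (k`!%:R * Gamma_fun (k%:R + s)).

(* [J_nu z = (z / 2) ^ nu * phi (nu + 1) (z ^ 2 / 4)] *)
Definition phi s u : R := limn (pseries (phic s) u).

(** In the functional equation the first factor is [s] and every later one is at least 1. This crude
    bound makes the exponential series dominate that of [phi]. *)
Lemma Gamma_fun_shift_ge s k : 0 < s ->
  Num.min 1 s * Gamma_fun s <= Gamma_fun (k%:R + s).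
Proof.
move=> s0; have G0 := Gamma_fun_gt0 s0.
have m1 : Num.min 1 s <= 1 by rewrite ge_min lexx.
have ms : Num.min 1 s <= s by rewrite ge_min lexx orbT.
elim: k => [|k IH]; first by rewrite add0r ler_piMl// ltW.
have ks : 0 < k%:R + s by rewrite ltr_wpDl.
rewrite -natr1 (_ : k%:R + 1 + s = k%:R + s + 1); last by ring.
rewrite (Gamma_funS ks).
case: k IH ks => [|k] IH ks; first by clear IH ks; rewrite (add0r s); apply: (ler_wpM2r (ltW G0) ms).
apply: (le_trans IH); apply: ler_peMl; first exact: (ltW (Gamma_fun_gt0 ks)).
by rewrite -natr1 -addrA addrCA lerDl addr_ge0// (ltW s0).
Qed.

Definition phi_cst s : R := (Num.min 1 s * Gamma_fun s)^-1.

Lemma phi_cst_ge0 s : 0 < s -> 0 <= phi_cst s.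
Proof.
by move=> s0; rewrite invr_ge0 mulr_ge0 ?ltW ?Gamma_fun_gt0// lt_min ltr01.
Qed.

Lemma phic_norm s k : 0 < s -> `|phic s k| = (k`!%:R * Gamma_fun (k%:R + s))^-1.
Proof.
move=> s0; rewrite /phic normrM normrX normrN1 expr1n mul1r ger0_norm//.
by rewrite invr_ge0 mulr_ge0// ltW// Gamma_fun_gt0// ltr_wpDl.
Qed.

Lemma phic_le s k : 0 < s -> `|phic s k| <= phi_cst s * (k`!%:R)^-1.
Proof.
move=> s0; rewrite phic_norm// invfM mulrC ler_wpM2r ?invr_ge0//.
rewrite lef_pV2 ?posrE ?Gamma_fun_shift_ge ?Gamma_fun_gt0 ?ltr_wpDl//.
by rewrite mulr_gt0 ?Gamma_fun_gt0// lt_min ltr01.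
Qed.

Lemma is_cvg_phi_norm s u : 0 < s ->
  cvgn (series (fun k => `|phic s k * u ^+ k|)).
Proof.
move=> s0; apply: (@series_le_cvg _ _ (phi_cst s *: (exp_coeff `|u|))).
- by [].
- move=> k; apply: mulr_ge0; [exact: phi_cst_ge0|exact: exp_coeff_ge0].
- move=> k; rewrite normrM normrX.
  rewrite -[leRHS]/(phi_cst s * (`|u| ^+ k / k`!%:R)) [_ / _]mulrC mulrA.
  by rewrite ler_wpM2r// phic_le.
- by apply: is_cvg_seriesZ; exact: is_cvg_series_exp_coeff.
Qed.

Lemma is_cvg_phi s u : 0 < s -> cvgn (pseries (phic s) u).
Proof. by move=> s0; apply: normed_cvg; exact: is_cvg_phi_norm. Qed.

Lemma phi_norm_le s u : 0 < s -> `|phi s u| <= phi_cst s * expR `|u|.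
Proof.
move=> s0; apply: (le_trans (lim_series_norm (is_cvg_phi_norm (u := u) s0))).
rewrite -[phi_cst s * _]/(phi_cst s *: limn (series (exp_coeff `|u|))).
have ce := @is_cvg_series_exp_coeff R `|u|.
rewrite -lim_seriesZ//.
apply: lim_series_le; [exact: is_cvg_phi_norm|exact: is_cvg_seriesZ|].
move=> k; rewrite -[leLHS]/(`|phic s k * u ^+ k|) normrM normrX.
rewrite -[leRHS]/(phi_cst s * (`|u| ^+ k / k`!%:R)) [_ / _]mulrC mulrA.
by rewrite ler_wpM2r// phic_le.
Qed.

Lemma pseries_diffs_phic s : 0 < s -> pseries_diffs (phic s) = - phic (s + 1).
Proof.
move=> s0; apply/funext => k; rewrite /pseries_diffs /phic /=.
rewrite (_ : - (fun _ : nat => _) = fun k => - ((-1) ^+ k / (k`!%:R * Gamma_fun (k%:R + (s + 1)))))//.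
rewrite exprS factS natrM -natr1 (_ : k%:R + 1 + s = k%:R + (s + 1)); last by ring.
have s1 : 0 < s + 1 by rewrite addr_gt0.
by field; rewrite !gt_eqF ?Gamma_fun_gt0 ?ltr0n ?fact_gt0// ltr_wpDl.
Qed.

Lemma is_derive_phi s u : 0 < s -> is_derive u 1 (phi s) (- phi (s + 1) u).
Proof.
move=> s0; have s10 : 0 < s + 1 by rewrite addr_gt0.
have s20 : 0 < s + 1 + 1 by rewrite !addr_gt0.
have limN c (v : R) : cvgn (pseries c v) ->
    pseries (- c) v @ \oo --> - limn (pseries c v).
  move=> cc; rewrite (_ : pseries _ _ = - pseries c v); first exact: cvgN.
  apply/funext => n; rewrite /pseries /series/=.
  rewrite -[RHS]/(- \sum_(0 <= i < n) c i * v ^+ i).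
  by rewrite -sumrN; apply: eq_bigr => i _; rewrite -[(- c) i]/(- c i) mulNr.
have D2 : pseries_diffs (- phic (s + 1)) = phic (s + 1 + 1).
  rewrite (_ : pseries_diffs _ = - pseries_diffs (phic (s + 1))); last first.
    by apply/funext => k; rewrite /pseries_diffs mulrN.
  by rewrite pseries_diffs_phic// opprK.
have := @pseries_snd_diffs R (phic s) (`|u| + 1) u.
rewrite pseries_diffs_phic// D2.
rewrite (cvg_lim _ (limN _ u (is_cvg_phi (u := u) s10)))//; apply.
- exact: is_cvg_phi.
- exact: cvgP (limN _ _ (is_cvg_phi s10)).
- exact: is_cvg_phi.
- by rewrite [ltRHS]ger0_norm ?addr_ge0// ltrDl.
Qed.

Lemma continuous_phi s : 0 < s -> continuous (phi s).
Proof.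
move=> s0 u; apply: differentiable_continuous; apply/derivable1_diffP.
by have [] := is_derive_phi u s0.
Qed.

Lemma phi0 s : 0 < s -> phi s 0 = (Gamma_fun s)^-1.
Proof.
move=> s0; apply/cvg_lim => //; rewrite -cvg_shiftS.
apply: cvg_near_cst; apply: nearW => n.
rewrite /pseries /series/= big_nat_recl//= big1 ?addr0.
  by rewrite /phic expr0 mulr1 fact0 mul1r add0r mul1r.
by move=> i _; rewrite expr0n mulr0.
Qed.

Lemma phic_rec s k : 0 < s ->
  phic s k.+1 = s * phic (s + 1) k.+1 - phic (s + 1 + 1) k.
Proof.
move=> s0; have k0 : 0 <= k%:R :> R by [].
have ks : 0 < k%:R + 1 + s :> R by lra.
have E1 : Gamma_fun (k.+1%:R + (s + 1)) = (k%:R + 1 + s) * Gamma_fun (k%:R + 1 + s).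
  by rewrite -natr1 -(Gamma_funS ks) addrA addrAC.
have E2 : Gamma_fun (k%:R + (s + 1 + 1)) = Gamma_fun (k.+1%:R + (s + 1)).
  by rewrite -natr1; congr Gamma_fun; ring.
have G0 : Gamma_fun (k%:R + 1 + s) != 0 by rewrite (gt_eqF (Gamma_fun_gt0 ks)).
have F0 : k`!%:R != 0 :> R by rewrite pnatr_eq0 -lt0n fact_gt0.
rewrite /phic E2 E1 exprS factS natrM -natr1.
move: (Gamma_fun _) G0 (k`!%:R : R) F0 (((-1) : R) ^+ k) => g g0 f f0 e.
have k1 : k%:R + 1 != 0 :> R by rewrite gt_eqF// ltr_wpDl.
by field; rewrite g0 f0 k1 gt_eqF.
Qed.

Lemma phic0 s : 0 < s -> phic s 0 = s * phic (s + 1) 0.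
Proof.
move=> s0; have G0 : Gamma_fun s != 0 by rewrite (gt_eqF (Gamma_fun_gt0 s0)).
rewrite /phic fact0 (add0r s) (add0r (s + 1)) (Gamma_funS s0).
by move: (Gamma_fun s) G0 => g g0; field; rewrite g0 gt_eqF.
Qed.

(** The recurrence [J_(s-1) + J_(s+1) = (2 s / z) J_s] at [u = z ^ 2 / 4]. With
    [phi_s' = - phi_(s+1)] it is the differential equation [u y'' + s y' + y = 0]. *)
Lemma phi_rec s u : 0 < s -> phi s u = s * phi (s + 1) u - u * phi (s + 1 + 1) u.
Proof.
move=> s0; have s10 : 0 < s + 1 by rewrite addr_gt0.
have s20 : 0 < s + 1 + 1 by rewrite !addr_gt0.
have c0 := @is_cvg_phi s u s0; have c1 := @is_cvg_phi _ u s10; have c2 := @is_cvg_phi _ u s20.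
have : pseries (phic s) u n.+1 @[n --> \oo] --> s * phi (s + 1) u - u * phi (s + 1 + 1) u.
  rewrite (_ : (fun n => _) = (fun n => s * pseries (phic (s + 1)) u n.+1 -
      u * pseries (phic (s + 1 + 1)) u n)).
    apply: cvgB; apply: cvgMr; last exact: c2.
    by rewrite (cvg_shiftS (pseries (phic (s + 1)) u)); exact: c1.
  apply/funext => n; rewrite /pseries /series/=.
  rewrite (big_nat_recl n 0%N (fun i => phic s i * u ^+ i) (leq0n n)).
  rewrite (big_nat_recl n 0%N (fun i => phic (s + 1) i * u ^+ i) (leq0n n)).
  rewrite (phic0 s0) mulrDr mulrA -addrA !mulr_sumr -sumrB; congr (_ + _).
  apply: eq_bigr => k _; rewrite (phic_rec k s0) exprS.
  by move: (phic _ _) (phic _ _) => p q; ring.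
by rewrite (cvg_shiftS (pseries (phic s) u)) => h; apply/cvg_lim.
Qed.

(* The energy [phi_s^2 + u phi_s'^2] has derivative [(1 - 2 s) phi_(s+1)^2]. *)
Lemma phi_bound s u : 2^-1 <= s -> 0 <= u -> `|phi s u| <= (Gamma_fun s)^-1.
Proof.
move=> s12 u0; have s0 : 0 < s by lra.
have s10 : 0 < s + 1 by rewrite addr_gt0.
pose E (v : R) : R := phi s v ^+ 2 + v * phi (s + 1) v ^+ 2.
have dE (v : R) : is_derive v 1 E ((1 - 2 * s) * phi (s + 1) v ^+ 2).
  have d0 := is_derive_phi v s0; have d1 := is_derive_phi v s10.
  have h1 := is_deriveM d0 d0; have h2 := is_deriveM d1 d1.
  have h3 := is_deriveM (is_derive_id v (1 : R)) h2.
  have h4 := is_deriveD h1 h3.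
  apply: (is_derive_eq h4); rewrite /GRing.scale/=.
  rewrite (phi_rec v s0) -[(phi (s + 1) * phi (s + 1)) v]/(phi (s + 1) v * phi (s + 1) v).
  by move: (phi (s + 1) v) (phi (s + 1 + 1) v) => p q; ring.
have dvb v : derivable E v 1 by have [] := dE v.
have : E u <= E 0.
  apply: (@ler0_derive1_nincr _ E 0 u) => //.
  - by move=> v _; rewrite derive1E; have [_ ->] := dE v; rewrite mulr_le0_ge0 ?sqr_ge0//; lra.
  - by apply: derivable_within_continuous => v _.
rewrite /E mul0r addr0 phi0// => h.
rewrite -ler_sqr ?nnegrE ?invr_ge0 ?normr_ge0 ?(ltW (Gamma_fun_gt0 s0))// real_normK ?num_real//.
by apply: le_trans h; rewrite lerDl mulr_ge0// sqr_ge0.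
Qed.

(** The powers of [y] in the prefactor and in [(z / 2) ^ (t - 1)] cancel, leaving [x ^ (t - 1)] and
    a power series in [x * y]. *)
Lemma bessel_J_phi t x y : 0 < t -> 0 < x -> 0 < y ->
  (y / x) `^ ((1 - t) / 2) * bessel_J (t - 1) (2 * Num.sqrt (x * y)) =
  x `^ (t - 1) * phi t (x * y).
Proof.
move=> t0 x0 y0; have xy0 : 0 < x * y by rewrite mulr_gt0.
have sxy : 0 < Num.sqrt (x * y) by rewrite sqrtr_gt0.
pose c := Num.sqrt (x * y) `^ (t - 1).
have -> : bessel_J (t - 1) (2 * Num.sqrt (x * y)) = c * phi t (x * y).
  rewrite -[RHS]/(c *: limn (series (fun i => phic t i * (x * y) ^+ i))).
  rewrite -lim_seriesZ; last exact: is_cvg_phi.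
  rewrite /bessel_J; congr (limn (series _)); apply/funext => k.
  rewrite -[RHS]/(c * (phic t k * (x * y) ^+ k)).
  rewrite [2 * _]mulrC mulfK ?pnatr_eq0// powRD; last by rewrite (gt_eqF sxy) implybT.
  rewrite -/c Gamma_fun_nat -addrA subrK /phic.
  rewrite (_ : 2 * k%:R = (2 * k)%:R); last by rewrite natrM.
  by rewrite powR_mulrn ?ltW// exprM sqr_sqrtr ?ltW//; ring.
rewrite mulrA; congr (_ * _); rewrite /c /powR !gt_eqF ?divr_gt0// -expRD.
rewrite (_ : ln (Num.sqrt (x * y)) = (ln x + ln y) / 2); last first.
  rewrite -lnM ?posrE// -[in RHS](sqr_sqrtr (ltW xy0)) expr2 lnM ?posrE//.
  by field.
by rewrite ln_div ?posrE//; congr expR; field.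
Qed.

End bessel_series.

(** * Integrals of [phi] against the gamma weight, complete and truncated *)

Section bessel_integrals.
Context {R : realType}.
Implicit Types (s t u c a : R).

Lemma measurable_phi s : 0 < s -> measurable_fun [set: R] (phi s).
Proof. by move=> s0; apply: continuous_measurable_fun; exact: continuous_phi. Qed.

Definition bessel_int t u a := phi t (u * a) * (a `^ (t - 1) * expR (- a)).

Lemma measurable_bessel_int t u : 0 < t -> measurable_fun [set: R] (bessel_int t u).
Proof.
move=> t0; apply: measurable_funM; last exact: measurable_gamma_integrand1.
by apply: measurableT_comp; [exact: measurable_phi|exact: measurable_funM].
Qed.

Definition gamma_weight t a := a `^ (t - 1) * expR (- a).

Lemma gamma_weight_ge0 t a : 0 <= gamma_weight t a.
Proof. by rewrite mulr_ge0 ?powR_ge0 ?expR_ge0. Qed.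

Lemma integrable_gamma_weight t : 0 < t ->
  lebesgue_measure.-integrable `]0, +oo[ (EFin \o gamma_weight t).
Proof.
move=> t0; apply: ge0_integrable_in => //.
- exact: measurable_funTS (measurable_gamma_integrand1 _).
- by move=> a _; exact: gamma_weight_ge0.
- exact: gammaE_lty.
Qed.

Lemma integral_gamma_weight t k : 0 < t ->
  (\int[lebesgue_measure]_(a in `]0%R, +oo[) (a ^+ k * gamma_weight t a)%:E =
  (Gamma_fun (k%:R + t))%:E)%E.
Proof.
move=> t0; rewrite -Gamma_funE ?ltr_wpDl//; apply: eq_integral => a.
rewrite inE/= in_itv/= andbT => a0; rewrite /gamma_weight mulrA -powR_mulrn ?(ltW a0)//.
by rewrite -powRD ?(gt_eqF a0) ?implybT// addrA.
Qed.

Lemma pseries_phic_norm t v n : 0 < t -> 0 <= v ->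
  pseries (phic t) (- v) n = \sum_(0 <= k < n) `|phic t k| * v ^+ k.
Proof.
move=> t0 v0; apply: eq_bigr => k _.
rewrite phic_norm// -[LHS]/(phic t k * (- v) ^+ k) /phic (exprNn v).
have : (-1) ^+ k * (-1) ^+ k = 1 :> R by rewrite -exprMn mulrNN mulr1 expr1n.
by move: ((-1) ^+ k) (_^-1) (v ^+ k) => e f w; move=> ee; rewrite -[RHS]mul1r -ee; ring.
Qed.

(** At [- u] every term of the series is nonnegative, and integration cancels [Gamma(k + t)],
    leaving [u ^ k / k!]. Monotone convergence bounds the total by [e ^ u]. This function dominates
    the alternating case. *)
Lemma bessel_int_integrableN t u : 0 < t -> 0 <= u ->
  lebesgue_measure.-integrable `]0, +oo[ (EFin \o (fun a => bessel_int t (- u) a)).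
Proof.
move=> t0 u0.
pose g n a := pseries (phic t) (- (u * a)) n * gamma_weight t a.
have gE n a : 0 <= u * a -> g n a = \sum_(0 <= k < n) (`|phic t k| * u ^+ k) * (a ^+ k * gamma_weight t a).
  move=> ua; rewrite /g pseries_phic_norm// mulr_suml; apply: eq_bigr => k _.
  by rewrite exprMn; ring.
have ua (a : R) : `]0, +oo[%classic a -> 0 <= u * a.
  by rewrite /= in_itv/= andbT => a0; rewrite mulr_ge0// ltW.
have t1 k a : 0 < a -> 0 <= (`|phic t k| * u ^+ k) * (a ^+ k * gamma_weight t a).
  move=> /ltW a0; apply: mulr_ge0; first by rewrite mulr_ge0 ?exprn_ge0.
  by rewrite mulr_ge0 ?exprn_ge0// gamma_weight_ge0.
have mg n : measurable_fun [set: R] (g n).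
  apply: measurable_funM; last exact: measurable_gamma_integrand1.
  apply: measurable_sum => k; apply: measurable_funM => //.
  by apply: measurable_funX; apply: measurableT_comp => //; exact: measurable_funM.
have int_g n : (\int[lebesgue_measure]_(a in `]0%R, +oo[) (g n a)%:E <= (expR u)%:E)%E.
  under eq_integral => a /set_mem/ua ua0 do rewrite gE// -sumEFin.
  rewrite ge0_integral_sum//; last 2 first.
  - move=> k; apply/measurable_EFinP; apply: measurable_funTS.
    apply: measurable_funM => //; apply: measurable_funM.
      exact: measurable_funX.
    exact: measurable_gamma_integrand1.
  - by move=> k a; rewrite /= in_itv/= andbT lee_fin => /t1.
  apply: (@le_trans _ _ (\sum_(0 <= k < n) exp_coeff u k)%:E).
    rewrite -sumEFin; apply: lee_sum => k _.
    under eq_integral do rewrite EFinM.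
    rewrite ge0_integralZl//; last 3 first.
    - apply/measurable_EFinP; apply: measurable_funTS; apply: measurable_funM.
        exact: measurable_funX.
      exact: measurable_gamma_integrand1.
    - move=> a; rewrite /= in_itv/= andbT lee_fin => a0.
      by rewrite mulr_ge0 ?exprn_ge0 ?(ltW a0)// gamma_weight_ge0.
    - by rewrite lee_fin mulr_ge0// exprn_ge0.
    rewrite integral_gamma_weight// -EFinM lee_fin phic_norm// /exp_coeff/=.
    have : Gamma_fun (k%:R + t) != 0 by rewrite (gt_eqF (Gamma_fun_gt0 _))// ltr_wpDl.
    have : (k`!%:R : R) != 0 by rewrite pnatr_eq0 -lt0n fact_gt0.
    move: (Gamma_fun _) (k`!%:R : R) => G f f0 G0.
    by rewrite le_eqVlt; apply/orP; left; apply/eqP; field; rewrite f0.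
  rewrite lee_fin; apply: nondecreasing_cvgn_le => [|]; last exact: is_cvg_series_exp_coeff.
  by apply: nondecreasing_series => k _ _; exact: exp_coeff_ge0.
have cg a : `]0, +oo[%classic a -> g n a @[n --> \oo] --> bessel_int t (- u) a.
  move=> a0; apply: cvgMl; rewrite mulNr; exact: is_cvg_phi.
have mono a : `]0, +oo[%classic a -> {homo g^~ a : n m / (n <= m)%N >-> n <= m}.
  move=> a0; have := a0; rewrite /= in_itv/= andbT => a0'.
  apply: homo_leq => //; [exact: le_trans|move=> n].
  by rewrite !gE ?ua// big_nat_recr//= lerDl t1.
apply: ge0_integrable_in => //.
- exact: measurable_funTS (measurable_bessel_int _ t0).
- move=> a a0; rewrite -(cvg_lim _ (cg a a0))//; apply: limr_ge; first exact: cvgP (cg a a0).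
  apply: nearW => n; rewrite gE ?ua//; apply: sumr_ge0 => k _; apply: t1.
  by move: a0; rewrite /= in_itv/= andbT.
- apply: (@le_lt_trans _ _ (expR u)%:E); last exact: ltry.
  have mE n : measurable_fun (`]0%R, +oo[%classic : set R) (fun a => (g n a)%:E).
    by apply/measurable_EFinP; exact: measurable_funTS.
  have mono' a : `]0, +oo[%classic a -> {homo (fun n => (g n a)%:E) : n m / (n <= m)%N >-> (n <= m)%E}.
    by move=> a0 n m nm; rewrite lee_fin mono.
  have g0 n a : `]0, +oo[%classic a -> (0 <= (g n a)%:E)%E.
    move=> a0; rewrite lee_fin gE ?ua//; apply: sumr_ge0 => k _; apply: t1.
    by move: a0; rewrite /= in_itv/= andbT.
  have := @monotone_convergence _ _ _ lebesgue_measure _ (measurable_itv _) (fun n a => (g n a)%:E) mE g0 mono'.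
  have E : (\int[lebesgue_measure]_(a in `]0%R, +oo[) (bessel_int t (- u) a)%:E =
      \int[lebesgue_measure]_(a in `]0%R, +oo[) limn (fun n => (g n a)%:E))%E.
    apply: eq_integral => a /set_mem a0.
    by apply/esym/cvg_lim => //; apply: cvg_EFin; [exact: nearW|exact: cg].
  move=> mc; apply: (@le_trans _ _ (limn (fun n => (\int[lebesgue_measure]_(a in `]0%R, +oo[) (g n a)%:E)%E))).
    by rewrite -mc E.
  apply: lime_le; last exact: nearW.
  apply: ereal_nondecreasing_is_cvgn => n m nm.
  apply: ge0_le_integral => //;
    by [move=> a a0; exact: g0|exact: mE|move=> a a0; exact: mono'].
Qed.

Lemma bessel_int_le t u a : 0 < t -> 0 <= u -> 0 <= a ->
  `|bessel_int t u a| <= bessel_int t (- u) a.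
Proof.
move=> t0 u0 a0; rewrite normrM [X in _ * X]ger0_norm; last first.
  by rewrite mulr_ge0 ?powR_ge0 ?expR_ge0.
rewrite ler_wpM2r ?mulr_ge0 ?powR_ge0 ?expR_ge0//.
rewrite mulNr; have ua0 : 0 <= u * a by rewrite mulr_ge0.
apply: (le_trans (lim_series_norm (is_cvg_phi_norm (u := u * a) t0))).
apply: ler_lim; [exact: is_cvg_phi_norm|exact: is_cvg_phi|].
apply: nearW => n; rewrite pseries_phic_norm//; apply: ler_sum => k _.
by rewrite -[leLHS]/(`|phic t k * (u * a) ^+ k|) normrM normrX [`|u * a|]ger0_norm.
Qed.

Lemma bessel_int_integrable t u : 0 < t -> 0 <= u ->
  lebesgue_measure.-integrable `]0, +oo[ (EFin \o bessel_int t u).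
Proof.
move=> t0 u0; apply: le_integrable (bessel_int_integrableN t0 u0) => //.
  by apply/measurable_EFinP; exact: measurable_funTS (measurable_bessel_int _ t0).
move=> a; rewrite /= in_itv/= andbT => a0; rewrite lee_fin.
by apply: (le_trans (bessel_int_le t0 u0 (ltW a0))); exact: ler_norm.
Qed.

(** Term by term the integrals are [(- u) ^ k / k!]; the partial sums are dominated by the integrand
    at [- u]. *)
Lemma bessel_int_integral t u : 0 < t -> 0 <= u ->
  (\int[lebesgue_measure]_(a in `]0%R, +oo[) (bessel_int t u a)%:E = (expR (- u))%:E)%E.
Proof.
move=> t0 u0.
pose g n a := pseries (phic t) (u * a) n * gamma_weight t a.
have mg n : measurable_fun (`]0%R, +oo[%classic : set R) (g n).
  apply: measurable_funTS; apply: measurable_funM; last exact: measurable_gamma_integrand1.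
  apply: measurable_sum => k; apply: measurable_funM => //.
  by apply: measurable_funX; exact: measurable_funM.
have cg a : `]0, +oo[%classic a -> g n a @[n --> \oo] --> bessel_int t u a.
  by move=> a0; apply: cvgMl; exact: is_cvg_phi.
have gle n a : `]0, +oo[%classic a -> `|g n a| <= bessel_int t (- u) a.
  rewrite /= in_itv/= andbT => a0; have ua0 : 0 <= u * a by rewrite mulr_ge0// ltW.
  rewrite normrM [X in _ * X]ger0_norm ?gamma_weight_ge0//.
  apply: ler_wpM2r; first exact: gamma_weight_ge0.
  apply: (le_trans (ler_norm_sum _ _ _)).
  rewrite mulNr; apply: (@le_trans _ _ (pseries (phic t) (- (u * a)) n)).
    rewrite pseries_phic_norm//; apply: ler_sum => k _.
    by rewrite normrM normrX [`|u * a|]ger0_norm.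
  apply: nondecreasing_cvgn_le; last exact: is_cvg_phi.
  move=> m k mk; rewrite !pseries_phic_norm//.
  have := @nondecreasing_series R (fun k => `|phic t k| * (u * a) ^+ k) predT 0%N.
  by apply => // j _ _; rewrite mulr_ge0 ?exprn_ge0.
have int_g n : (\int[lebesgue_measure]_(a in `]0%R, +oo[) (g n a)%:E =
    (\sum_(0 <= k < n) exp_coeff (- u) k)%:E)%E.
  rewrite -sumEFin.
  transitivity (\int[lebesgue_measure]_(a in `]0%R, +oo[)
      \sum_(0 <= k < n) ((phic t k * u ^+ k)%:E * (a ^+ k * gamma_weight t a)%:E))%E.
    apply: eq_integral => a _; rewrite sumEFin; congr EFin; rewrite /g mulr_suml.
    apply: eq_bigr => k _; rewrite -[LHS]/(phic t k * (u * a) ^+ k * gamma_weight t a).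
    by rewrite exprMn; ring.
  have ig k : lebesgue_measure.-integrable `]0%R, +oo[ (fun a : R => (a ^+ k * gamma_weight t a)%:E).
    apply: ge0_integrable_in => //.
    - apply: measurable_funTS; apply: measurable_funM; first exact: measurable_funX.
      exact: measurable_gamma_integrand1.
    - move=> a; rewrite /= in_itv/= andbT => a0.
      by rewrite mulr_ge0 ?exprn_ge0 ?(ltW a0)// gamma_weight_ge0.
    - by rewrite integral_gamma_weight// ltry.
  rewrite integral_sum//; last by move=> k; exact: integrableZl.
  apply: eq_bigr => k _; rewrite integralZl// integral_gamma_weight// -EFinM; congr EFin.
  rewrite /phic /exp_coeff/= (exprNn u).
  have : Gamma_fun (k%:R + t) != 0 by rewrite (gt_eqF (Gamma_fun_gt0 _))// ltr_wpDl.
  have : (k`!%:R : R) != 0 by rewrite pnatr_eq0 -lt0n fact_gt0.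
  move: (Gamma_fun _) (k`!%:R : R) ((-1) ^+ k : R) => G f e f0 G0.
  by field; rewrite f0.
have dc := @dominated_cvg_in R _ _ lebesgue_measure _ g (bessel_int t u) (bessel_int t (- u))
  (measurable_itv _) mg cg (bessel_int_integrableN t0 u0) gle.
rewrite (_ : (fun n => _) = (fun n => (\sum_(0 <= k < n) exp_coeff (- u) k)%:E)) in dc.
  apply: (cvg_unique _ dc) => //.
  by apply: cvg_EFin; [exact: nearW|exact: is_cvg_series_exp_coeff].
by apply/funext => n; exact: int_g.
Qed.


(** The version for nonnegative integrands is applied to [k] and to [f + k], which is nonnegative
    because [|f| <= k], and the results are subtracted. *)
Lemma ftc_oo_signed (F f K k : R -> R) (a b FA FB KA KB : R) : a < b ->
  (forall x, a < x < b -> is_derive x 1 F (f x)) ->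
  (forall x, a < x < b -> is_derive x 1 K (k x)) ->
  (forall x, a < x < b -> {for x, continuous f}) ->
  (forall x, a < x < b -> {for x, continuous k}) ->
  measurable_fun `]a, b[ f -> measurable_fun `]a, b[ k ->
  (forall x, a < x < b -> `|f x| <= k x) ->
  F x @[x --> a^'+] --> FA -> F x @[x --> b^'-] --> FB ->
  K x @[x --> a^'+] --> KA -> K x @[x --> b^'-] --> KB ->
  lebesgue_measure.-integrable `]a, b[ (EFin \o f) /\
  \int[lebesgue_measure]_(x in `]a, b[) f x = FB - FA.
Proof.
move=> ab dF dK cf ck mf mk fk FaA FbB KaA KbB.
have Ek : (\int[lebesgue_measure]_(x in `]a, b[) (k x)%:E = (KB - KA)%:E)%E.
  apply: (ftc_oo ab dK) => // x xab; exact: le_trans (fk x xab).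
have ik : lebesgue_measure.-integrable `]a, b[ (EFin \o k).
  apply: ge0_integrable_in => //; last by rewrite Ek ltry.
  by move=> x; rewrite /= in_itv/= => xab; exact: le_trans (fk x xab).
have if_ : lebesgue_measure.-integrable `]a, b[ (EFin \o f).
  apply: le_integrable ik => //; first exact/measurable_EFinP.
  move=> x; rewrite /= in_itv/= => xab; rewrite lee_fin.
  exact: le_trans (fk x xab) (ler_norm _).
split=> //.
have Efk : (\int[lebesgue_measure]_(x in `]a, b[) ((f \+ k) x)%:E = (FB + KB - (FA + KA))%:E)%E.
  apply: (@ftc_oo R (f \+ k) (F \+ K) _ _ _ _ ab).
  - by move=> x xab; apply: is_deriveD; [exact: dF|exact: dK].
  - by move=> x xab; apply: continuousD; [exact: cf|exact: ck].
  - by move=> x /fk /ler_normlP[] h _ /=; lra.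
  - exact: cvgD.
  - exact: cvgD.
have := @RintegralD _ _ _ lebesgue_measure _ f k (measurable_itv _) if_ ik.
rewrite {1}/Rintegral Efk /= [X in _ = _ + X]/Rintegral Ek /=; lra.
Qed.

(** [e^(-c)] is the integral of [e^(-a)] over [a > c], and [c ^ s <= a ^ s] there. *)
Lemma powR_expRN_le_Gamma s c : 0 < s -> 0 < c -> c `^ s * expR (- c) <= Gamma_fun (s + 1).
Proof.
move=> s0 c0; rewrite -lee_fin -Gamma_funE ?addr_gt0//.
have ce : (\int[lebesgue_measure]_(a in `]c, +oo[) (expR (- (1 * a)))%:E = (expR (- c))%:E)%E.
  by rewrite integral_expR_tail// mul1r divr1.
have me : measurable_fun (`]c, +oo[%classic : set R) (fun a : R => (expR (- (1 * a)))%:E).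
  apply/measurable_EFinP; apply: measurable_funTS; apply: measurableT_comp => //.
  by apply: measurableT_comp => //; exact: measurable_funM.
rewrite EFinM -ce -ge0_integralZl//; last by rewrite lee_fin powR_ge0.
apply: (@le_trans _ _ (\int[lebesgue_measure]_(a in `]c, +oo[) (a `^ (s + 1 - 1) * expR (- a))%:E)%E).
  apply: ge0_le_integral => //.
  - by move=> a _; rewrite -EFinM lee_fin mulr_ge0 ?powR_ge0 ?expR_ge0.
  - exact: emeasurable_funM.
  - by apply/measurable_EFinP; exact: measurable_funTS (measurable_gamma_integrand1 _).
  move=> a; rewrite /= in_itv/= andbT => ca; rewrite -EFinM lee_fin addrK mul1r.
  rewrite ler_wpM2r ?expR_ge0//; apply: ge0_ler_powR; rewrite ?nnegrE ?(ltW s0) ?(ltW c0) ?(ltW ca)//.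
  by rewrite (ltW (lt_trans c0 ca)).
apply: ge0_subset_integral => //.
- by apply/measurable_EFinP; exact: measurable_funTS (measurable_gamma_integrand1 _).
- by move=> a _; rewrite lee_fin mulr_ge0 ?powR_ge0 ?expR_ge0.
- by move=> a /=; rewrite !in_itv/= !andbT; exact: lt_trans.
Qed.


Definition bessel_trunc t u c : R := \int[lebesgue_measure]_(a in `]0, c[) bessel_int t u a.

(* [a ^ t phi_(t+1)(u a)] is an antiderivative of [a ^ (t - 1) phi_t(u a)], so
   integrating by parts against [exp (- a)] trades [t] for [t + 1]. *)
Lemma bessel_trunc_parts t u c : 0 < t -> 0 <= u -> 0 < c ->
  bessel_trunc t u c = bessel_int (t + 1) u c + bessel_trunc (t + 1) u c.
Proof.
move=> t0 u0 c0; have t10 : 0 < t + 1 by rewrite addr_gt0.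
have t20 : 0 < t + 1 + 1 by rewrite !addr_gt0.
pose F a := bessel_int (t + 1) u a.
pose f a := bessel_int t u a - bessel_int (t + 1) u a.
(* Bounds [f] by [C * a ^ (t - 1)] on []0, c[]: the two summands come from the orders t and [t + 1],
   and the factor [c] from [a ^ t <= c * a ^ (t - 1)]. *)
pose C := phi_cst t * expR (u * c) + c * (phi_cst (t + 1) * expR (u * c)).
pose K a := t^-1 * C * a `^ t.
pose k a := C * a `^ (t - 1).
have dphi (a : R) : is_derive a 1 (fun a => phi (t + 1) (u * a)) (- u * phi (t + 1 + 1) (u * a)).
  have h : is_derive a 1 (fun y : R => u * y) u.
    by apply: is_derive_eq; rewrite /GRing.scale/= mulr1.
  have := is_derive1_comp (is_derive_phi (u * a) t10) h.
  by move/is_derive_eq; apply; rewrite /GRing.scale/=; ring.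
have dexp (a : R) : is_derive a 1 (fun a => expR (- a)) (- expR (- a)).
  have := is_derive_expRM (-1) a; rewrite (_ : (fun x => _) = (fun a => expR (- a))).
    by rewrite !mulN1r.
  by apply/funext => x; rewrite mulN1r.
have FE : F = (fun a => phi (t + 1) (u * a)) * ((fun a => a `^ t) * (fun a => expR (- a))).
  by apply/funext => a; rewrite /F /bessel_int addrK.
have dF (a : R) : 0 < a < c -> is_derive a 1 F (f a).
  move=> /andP[a0 _]; rewrite FE.
  have h := is_deriveM (dphi a) (is_deriveM (is_derive_powR t a0) (dexp a)).
  apply: (is_derive_eq h); rewrite /GRing.scale/= /f /bessel_int addrK (phi_rec _ t0).
  rewrite -[((fun a : R => a `^ t) * (fun a : R => expR (- a))) a]/(a `^ t * expR (- a)).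
  have -> : a `^ t = a * a `^ (t - 1).
    by rewrite -[X in X * _](powRr1 (ltW a0)) -powRD ?(gt_eqF a0) ?implybT// addrC subrK.
  move: (phi _ _) (phi _ _) (a `^ _) (expR _) => p q r e.
  by ring.
have dK (a : R) : 0 < a < c -> is_derive a 1 K (k a).
  move=> /andP[a0 _]; have h := is_deriveZ (t^-1 * C) (is_derive_powR t a0).
  apply: (is_derive_eq h); rewrite /GRing.scale/= /k.
  by field; rewrite gt_eqF.
have cphi s (a : R) : 0 < s -> {for a, continuous (fun a => phi s (u * a))}.
  move=> s0; apply: (@continuous_comp _ _ _ ( *%R u) (phi s)); last exact: continuous_phi.
  exact: mulrl_continuous.
have cexp (a : R) : {for a, continuous (fun a => expR (- a))}.
  apply: differentiable_continuous; apply/derivable1_diffP; by have [] := dexp a.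
have cb s (a : R) : 0 < s -> 0 < a -> {for a, continuous (bessel_int s u)}.
  move=> s0 a0; apply: continuousM; first exact: cphi.
  by apply: continuousM; [exact: continuous_powR|exact: cexp].
have fk (a : R) : 0 < a < c -> `|f a| <= k a.
  move=> /andP[a0 ac]; have ua : u * a <= u * c by rewrite ler_wpM2l// ltW.
  have ua0 : 0 <= u * a by rewrite mulr_ge0// ltW.
  have h s : 0 < s -> `|phi s (u * a)| <= phi_cst s * expR (u * c).
    move=> s0; apply: (le_trans (phi_norm_le _ s0)).
    by rewrite ler_wpM2l ?phi_cst_ge0// ler_expR ger0_norm.
  have e1 : expR (- a) <= 1 by rewrite -expR0 ler_expR oppr_le0 ltW.
  apply: (le_trans (ler_normB _ _)); rewrite /k /C mulrDl /bessel_int.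
  rewrite !normrM !(ger0_norm (powR_ge0 _ _)) !(ger0_norm (expR_ge0 _)) addrK.
  have at_ : a `^ t = a * a `^ (t - 1).
    by rewrite -[X in X * _](powRr1 (ltW a0)) -powRD ?(gt_eqF a0) ?implybT// addrC subrK.
  rewrite at_; have p0 := powR_ge0 a (t - 1); have e0 := expR_ge0 (- a).
  apply: lerD.
    apply: ler_pM; rewrite ?mulr_ge0//; first exact: h.
    by rewrite ler_piMr.
  have := h _ t10; have := phi_cst_ge0 t10; have := expR_ge0 (u * c).
  move: (phi_cst _) (expR (u * c)) `|phi _ _| (normr_ge0 (phi (t + 1) (u * a))) (a `^ _) p0 => p q r r0 y y0 q0 p0' rpq.
  rewrite [X in X <= _](_ : _ = (a * r) * (y * expR (- a))); last by ring.
  apply: ler_pM; rewrite ?mulr_ge0 ?(ltW a0)//; last by rewrite ler_piMr.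
  by apply: ler_pM; rewrite ?(ltW a0)// ltW.
have [] := @ftc_oo_signed F f K k 0 c 0 (F c) 0 (K c) c0 dF dK.
- by move=> a /andP[a0 _]; apply: continuousB; exact: cb.
- move=> a /andP[a0 _]; apply: continuousM; [exact: cst_continuous|exact: continuous_powR].
- by apply: measurable_funTS; apply: measurable_funB; exact: measurable_bessel_int.
- by apply: measurable_funTS; apply: measurable_funM => //; exact: measurable_powR.
- exact: fk.
- rewrite FE; have h1 : phi (t + 1) (u * x) @[x --> 0^'+] --> phi (t + 1) (u * 0).
    by apply: cvg_at_right_filter; exact: cphi.
  have h2 : expR (- x) @[x --> (0 : R)^'+] --> expR (- 0).
    by apply: cvg_at_right_filter; exact: cexp.
  by have := cvgM h1 (cvgM (powR_cvg0 t0) h2); rewrite mul0r mulr0 => h; exact: h.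
- by apply/cvg_at_left_filter; exact: cb.
- have : (t^-1 * C) * a `^ t @[a --> (0 : R)^'+] --> (t^-1 * C) * 0.
    by apply: cvgMr; exact: powR_cvg0.
  by rewrite mulr0.
- by apply/cvg_at_left_filter; apply: cvgMr; exact: continuous_powR.
move=> _; rewrite subr0 => E.
have bi s : 0 < s -> lebesgue_measure.-integrable `]0, c[ (EFin \o bessel_int s u).
  move=> s0; apply: (integrableS _ _ _ (bessel_int_integrable s0 u0)) => //.
  by move=> a /=; rewrite !in_itv/= andbT => /andP[].
by rewrite /bessel_trunc -[bessel_int _ _ c]/(F c) -E RintegralB ?subrK//; exact: bi.
Qed.

(** After the integration by parts only the order [t + 1] occurs, where [|phi| <= 1 / Gamma(t + 1)].
    The boundary term and the remaining integral are then at most 1 each, for all [u] and [c]. *)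
Lemma bessel_trunc_le t u c : 0 < t -> 0 <= u -> 0 < c -> `|bessel_trunc t u c| <= 2.
Proof.
move=> t0 u0 c0; rewrite bessel_trunc_parts//; have t10 : 0 < t + 1 by rewrite addr_gt0.
have G0 := Gamma_fun_gt0 t10.
have bl (a : R) : 0 < a -> `|bessel_int (t + 1) u a| <= (Gamma_fun (t + 1))^-1 * gamma_weight (t + 1) a.
  move=> a0; rewrite normrM [X in _ * X]ger0_norm ?gamma_weight_ge0//.
  apply: ler_wpM2r; first exact: gamma_weight_ge0.
  apply: phi_bound; [lra|by rewrite mulr_ge0// ltW].
rewrite (_ : 2 = 1 + 1); last by [].
apply: (le_trans (ler_normD _ _)); apply: lerD.
  apply: (le_trans (bl _ c0)); rewrite mulrC ler_pdivrMr// mul1r /gamma_weight addrK.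
  exact: powR_expRN_le_Gamma.
have bi : lebesgue_measure.-integrable `]0, c[ (EFin \o bessel_int (t + 1) u).
  apply: (integrableS _ _ _ (bessel_int_integrable t10 u0)) => //.
  by move=> a /=; rewrite !in_itv/= andbT => /andP[].
have mw : measurable_fun [set: R] (fun a => ((Gamma_fun (t + 1))^-1 * gamma_weight (t + 1) a)%:E).
  by apply/measurable_EFinP; apply: measurable_funM => //; exact: measurable_gamma_integrand1.
rewrite -lee_fin EFin_normr_Rintegral//.
apply: (le_trans (le_abse_integral _ _ _)) => //; first by case/integrableP : bi.
apply: (@le_trans _ _ (\int[lebesgue_measure]_(a in `]0%R, c[) ((Gamma_fun (t + 1))^-1 * gamma_weight (t + 1) a)%:E)%E).
  apply: ge0_le_integral => //.
  - apply: measurableT_comp => //; by case/integrableP : bi.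
  - exact: measurable_funTS.
  - by move=> a; rewrite /= in_itv/= lee_fin => /andP[a0 _]; exact: bl.
apply: (@le_trans _ _ (\int[lebesgue_measure]_(a in `]0%R, +oo[) ((Gamma_fun (t + 1))^-1 * gamma_weight (t + 1) a)%:E)%E).
  apply: ge0_subset_integral => //; first exact: measurable_funTS.
    by move=> a _; rewrite lee_fin mulr_ge0 ?gamma_weight_ge0// invr_ge0 ltW.
  by move=> a /=; rewrite !in_itv/= andbT => /andP[].
under eq_integral do rewrite EFinM.
rewrite ge0_integralZl//; last 3 first.
- by apply/measurable_EFinP; exact: measurable_funTS (measurable_gamma_integrand1 _).
- by move=> a _; rewrite lee_fin gamma_weight_ge0.
- by rewrite lee_fin invr_ge0 ltW.
by rewrite -[X in (_ * X)%E]/(gammaE (t + 1)) Gamma_funE// -EFinM mulVf ?gt_eqF.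
Qed.

Lemma bessel_trunc_cvg t u (c : nat -> R) : 0 < t -> 0 <= u ->
  c n @[n --> \oo] --> +oo -> bessel_trunc t u (c n) @[n --> \oo] --> expR (- u).
Proof.
move=> t0 u0 coo.
have i0 := bessel_int_integrable t0 u0.
pose g n a := bessel_int t u a * \1_(`]0, c n[%classic : set R) a.
have gE n : (\int[lebesgue_measure]_(a in `]0%R, +oo[) (g n a)%:E = (bessel_trunc t u (c n))%:E)%E.
  rewrite /bessel_trunc /Rintegral fineK; last first.
    apply: integrable_fin_num => //; apply: (integrableS _ _ _ i0) => //.
    by move=> a /=; rewrite !in_itv/= andbT => /andP[].
  rewrite [LHS]integral_mkcond [RHS]integral_mkcond; apply: eq_integral => a _.
  rewrite !patchE !mem_setE !in_itv/= andbT /g indicE mem_setE in_itv/=.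
  by case: (0 < a) => //=; case: (a < c n); rewrite ?mulr1 ?mulr0.
have := @dominated_cvg_in R _ _ lebesgue_measure (`]0%R, +oo[%classic : set R) g (bessel_int t u) (fun a => `|bessel_int t u a|).
rewrite bessel_int_integral//.
under [X in _ -> _ -> _ -> _ -> _ -> X @ _ --> _]eq_fun do rewrite gE.
move=> h; have {}h : (bessel_trunc t u (c n))%:E @[n --> \oo] --> (expR (- u))%:E.
  apply: h => //.
  - move=> n; apply: measurable_funM; first exact: measurable_funTS (measurable_bessel_int _ t0).
    exact: measurable_funTS.
  - move=> a; rewrite /= in_itv/= andbT => a0.
    apply: cvg_near_cst; near=> n.
    have ac : a < c n by near: n; move/cvgryPgt : coo; apply.
    by rewrite /g indicE mem_setE in_itv/= a0 ac mulr1.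
  - exact: integrable_norm i0.
  - move=> n a _; rewrite /g normrM indicE; case: (_ \in _); rewrite ?normr1 ?mulr1// normr0 mulr0.
    exact: normr_ge0.
by move/fine_cvgP : h => [].
Unshelve. all: by end_near. Qed.

End bessel_integrals.

(** * Inverse distribution functions of [G] and [1/G] *)

Section inverse_cdf.
Context {R : realType} d (T : measurableType d) (P : probability T R).
Variable G : {RV P >-> R}.
Hypothesis G0 : positive_rv P G.

Lemma cdf_preimage (X : {RV P >-> R}) x : cdf X x = P (X @^-1` `]-oo, x]).
Proof. by []. Qed.

Lemma positive_rv_null : P (G @^-1` `]-oo, 0]) = 0%E.
Proof.
have E : G @^-1` `]-oo, 0] = ~` [set w | 0 < G w].
  apply/seteqP; split => w /=; rewrite in_itv/=.
    by move=> h; apply/negP; rewrite -leNgt.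
  by move=> /negP; rewrite -leNgt.
have := measurable_funPTI G (measurable_itv (Interval -oo%O (BRight (0 : R)))).
by rewrite E => /negligibleP <-.
Qed.

Lemma cdf_positive_rv x : x <= 0 -> cdf G x = 0%E.
Proof.
move=> x0; apply/eqP; rewrite eq_le cdf_ge0 andbT -positive_rv_null cdf_preimage.
apply: le_measure; rewrite ?inE; try exact: measurable_funPTI.
by move=> w /=; rewrite !in_itv/= => h; exact: le_trans h x0.
Qed.

Lemma cdf_inv_rv_neg x : x <= 0 -> cdf (inv_rv G) x = 0%E.
Proof.
move=> x0; apply/eqP; rewrite eq_le cdf_ge0 andbT -positive_rv_null cdf_preimage.
apply: le_measure; rewrite ?inE; try exact: measurable_funPTI.
move=> w /=; rewrite !in_itv/= => h; have := le_trans h x0.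
by rewrite -[inv_rv G w]/(G w)^-1 invr_le0.
Qed.

(** For [G > 0], [1/G <= x] excludes [G <= z]. The event [G <= 0], where the conventional inverse is
    also at most [x], is put into a null set. *)
Lemma cdf_inv_rv_le x z : 0 < x -> z < x^-1 -> (cdf (inv_rv G) x <= 1 - cdf G z)%E.
Proof.
move=> x0 zx; rewrite !cdf_preimage -probability_setC; last exact: measurable_funPTI.
have mB : measurable (~` (G @^-1` `]-oo, z])).
  by apply: measurableC; exact: measurable_funPTI.
have mN := measurable_funPTI G (measurable_itv (Interval -oo%O (BRight (0 : R)))).
rewrite -[leRHS]adde0 -positive_rv_null.
apply: le_trans (measureU2 _ mB mN).
apply: le_measure; rewrite ?inE.
- exact: measurable_funPTI.
- exact: measurableU.
move=> w /=; rewrite in_itv/= -[inv_rv G w]/(G w)^-1 => Gx.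
have [Gw|Gw] := leP (G w) 0; [by right; rewrite /= in_itv|left].
rewrite /= in_itv/= => Gz; have := le_lt_trans Gz zx.
rewrite -[ltLHS]invrK ltf_pV2 ?posrE ?invr_gt0//.
by move=> /(le_lt_trans Gx); rewrite ltxx.
Qed.

Lemma cdf_inv_rv_ge r : 0 < r -> (1 - cdf G r <= cdf (inv_rv G) r^-1)%E.
Proof.
move=> r0; rewrite !cdf_preimage -probability_setC; last exact: measurable_funPTI.
apply: le_measure; rewrite ?inE.
- by apply: measurableC; exact: measurable_funPTI.
- exact: measurable_funPTI.
move=> w /=; rewrite !in_itv/= -[inv_rv G w]/(G w)^-1 => /negP; rewrite -ltNge => rG.
by rewrite lef_pV2 ?posrE ?(ltW rG)// (lt_trans r0).
Qed.

(** That [1 / inf B] is a lower bound of [A] follows by comparing members of [A] and [B]. The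
    converse needs points [1/r] of [A] with [r] slightly below [inf B]. There [F_G(r) <= 1 - y], and
    strictness is required; the hypothesis supplies it at rational [r], which are dense enough. *)
Lemma cdf_inv_mul y : 0 < y < 1 ->
  (forall r : rat, cdf G (ratr r) != (1 - y)%:E) ->
  cdf_inv (inv_rv G) y * cdf_inv G (1 - y) = 1.
Proof.
move=> /andP[y0 y1] hr; set q := 1 - y in hr *; have q0 : 0 < q by rewrite /q; lra.
have q1 : q < 1 by rewrite /q; lra.
have Ffin x : cdf G x = (fine (cdf G x))%:E.
  by rewrite fineK// ge0_fin_numE ?cdf_ge0//; apply: le_lt_trans (cdf_le1 _ _) (ltry _).
have Fmono x z : x <= z -> fine (cdf G x) <= fine (cdf G z).
  by move=> xz; rewrite -lee_fin -!Ffin; exact: cdf_nondecreasing.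
set B := [set x : R | (q%:E < cdf G x)%E].
set A := [set x : R | (y%:E < cdf (inv_rv G) x)%E].
(* [F_G] vanishes at 0 and is right-continuous there, so [B] has a positive lower bound and its
   infimum can be inverted. *)
have [z0 z00 Fz0] : exists2 z, 0 < z & fine (cdf G z) < q.
  have h : fine (cdf G z) @[z --> 0^'+] --> fine (cdf G 0).
    apply: fine_cvg; rewrite -Ffin; exact: (@cdf_right_continuous _ _ _ P G 0).
  have h1 : \forall z \near 0^'+, fine (cdf G z) < q.
    by apply: (cvgr_lt _ h); rewrite cdf_positive_rv.
  have h2 : \forall z \near (0:R)^'+, 0 < z by exact: nbhs_right_gt.
  have [z [zq z0]] : exists z, fine (cdf G z) < q /\ 0 < z.
    apply: (@filter_ex _ ((0 : R)^'+) _ (fun z => fine (cdf G z) < q /\ 0 < z)).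
    exact: filterI h1 h2.
  by exists z.
have Bne : B !=set0.
  have h : fine (cdf G z) @[z --> +oo] --> (1:R).
    by apply: fine_cvg; exact: cvg_cdfy1.
  have h1 : \forall z \near +oo, q < fine (cdf G z) by exact: (cvgr_gt _ h).
  by have [z zq] : exists z, q < fine (cdf G z) by [exact: filter_ex h1]; exists z; rewrite /B/= Ffin lte_fin.
have Blb : lbound B z0.
  move=> z; rewrite /B/= Ffin lte_fin => qz; rewrite leNgt; apply/negP => zz0.
  by have := lt_le_trans qz (Fmono _ _ (ltW zz0)); lra.
set i := inf B; have i0 : 0 < i.
  by apply: lt_le_trans z00 _; exact: lb_le_inf.
have hB : has_lbound B by exists z0.
have Fi r : r < i -> fine (cdf G r) <= q.
  move=> ri; rewrite leNgt; apply/negP => h.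
  by have := ge_inf hB (_ : B r); rewrite /B/= Ffin lte_fin => /(_ h); rewrite leNgt ri.
have Alb : lbound A i^-1.
  move=> x; rewrite /A/= => yx; have x0 : 0 < x.
    rewrite ltNge; apply/negP => /cdf_inv_rv_neg E.
    by move: yx; rewrite E lte_fin ltNge (ltW y0).
  rewrite -[x]invrK lef_pV2 ?posrE ?invr_gt0//.
  apply: lb_le_inf => // z; rewrite /B/= Ffin lte_fin => qz.
  rewrite leNgt; apply/negP => zx.
  have := lt_le_trans yx (cdf_inv_rv_le x0 zx); rewrite Ffin -EFinB lte_fin.
  by move: qz; rewrite /q; lra.
have Aex e : i^-1 < e -> exists2 x, A x & x < e.
  move=> ie; have e0 : 0 < e by apply: lt_trans ie; rewrite invr_gt0.
  have : e^-1 < i by rewrite -[i]invrK ltf_pV2 ?posrE ?invr_gt0.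
  move=> /rat_in_itvoo[r]; rewrite in_itv/= => /andP[er ri].
  have r0 : 0 < ratr r :> R by apply: lt_trans er; rewrite invr_gt0.
  exists (ratr r)^-1; last by rewrite -[e]invrK ltf_pV2 ?posrE ?invr_gt0.
  rewrite /A/=; apply: lt_le_trans (cdf_inv_rv_ge r0).
  have := hr r; rewrite Ffin => h; rewrite -EFinB lte_fin.
  have : fine (cdf G (ratr r)) != q by apply: contra h => /eqP ->.
  by have := Fi _ ri; rewrite le_eqVlt => /orP[->//|]; rewrite /q; lra.
have -> : cdf_inv (inv_rv G) y = i^-1.
  apply/eqP; rewrite eq_le; apply/andP; split; last first.
    apply: lb_le_inf => //; have [|x Ax _] := Aex (i^-1 + 1); first by rewrite ltrDl.
    by exists x.
  rewrite leNgt; apply/negP => /Aex[x Ax]; rewrite ltNge => /negP; apply.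
  by apply: ge_inf => //; exists i^-1.
by rewrite -[cdf_inv G q]/i mulVf// gt_eqF.
Qed.

Lemma ae_cdf_inv_mul : {ae (@lebesgue_measure R), forall y : R, 0 <= y <= 1 ->
     cdf_inv (inv_rv G) y * cdf_inv G (1 - y) = 1}.
Proof.
(* The exceptional set as the range of a countable type: [None] and [Some None] give the end points
   0 and 1. *)
pose f (o : option (option rat)) : R := if o is Some r then
  if r is Some r then 1 - fine (cdf G (ratr r)) else 1 else 0.
have cE : countable (range f).
  by apply: card_le_trans (card_image_le _ _) _; exact: countableP.
exists (range f); split; first exact: countable_measurable.
  exact: countable_lebesgue_measure0.
move=> y /= /not_implyP[/andP[y0 y1] h]; apply: contra_notP h => nE.
have yn0 : y != 0 by apply: contra_notN nE => /eqP ->; exists None.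
have yn1 : y != 1 by apply: contra_notN nE => /eqP ->; exists (Some None).
apply: cdf_inv_mul; first by rewrite !lt_neqAle eq_sym yn0 yn1 y0 y1.
move=> r; apply: contra_notN nE => /eqP e; exists (Some (Some r)) => //.
by rewrite /f e/=; lra.
Qed.

End inverse_cdf.

(** * Null sets and the mixing variable *)

Section mixing_null.
Local Open Scope ereal_scope.
Context {R : realType}.
Implicit Types (t a x w : R) (N : set R).
Local Notation leb := (@lebesgue_measure R).

Lemma powR_interval_preimage t a (u : R) : (0 < t)%R -> (0 < u < 1)%R ->
  (a < mixing t u)%R = ((if (a < 0)%R then 0 else a `^ t) < u)%R.
Proof.
move=> t0 /andP[u0 u1]; rewrite mixing_id ?(ltW u0) ?(ltW u1)//.
have uE : u = ((u `^ t^-1) `^ t)%R.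
  by rewrite -powRrM mulVf ?gt_eqF// powRr1// ltW.
case: (ltP a 0%R) => [a0|a0].
  by rewrite [RHS]u0; apply: (lt_le_trans a0); exact: powR_ge0.
rewrite [in RHS]uE; apply/idP/idP => h.
  by apply: gt0_ltr_powR; rewrite ?nnegrE ?powR_ge0.
by rewrite ltNge; apply: contraTN h => h; rewrite -leNgt ge0_ler_powR ?nnegrE ?powR_ge0// ltW.
Qed.

Lemma integral_powR_tail01 t a : (0 < t)%R -> (0 <= a < 1)%R ->
  \int[leb]_(v in `]a, 1%R[) (t * v `^ (t - 1))%:E = (1 - a `^ t)%:E.
Proof.
move=> t0 /andP[a0 a1].
have dF (x : R) : (a < x < 1)%R -> is_derive x 1%R (fun x => x `^ t)%R (t * x `^ (t - 1))%R.
  by move=> /andP[ax _]; apply: is_derive_powR; exact: le_lt_trans ax.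
rewrite (ftc_oo (A := (a `^ t)%R) (B := 1%R) a1 dF)//.
- move=> x /andP[ax _]; have x0 := le_lt_trans a0 ax.
  by apply: continuousM; [exact: cst_continuous|exact: continuous_powR].
- by move=> x _; rewrite mulr_ge0 ?powR_ge0// ltW.
- move: a0; rewrite le_eqVlt => /predU1P[<-|a0]; last exact/cvg_at_right_filter/continuous_powR.
  by rewrite powR0 ?gt_eqF//; exact: powR_cvg0.
- have h : (x `^ t)%R @[x --> (1 : R)%R^'-] --> ((1 : R) `^ t)%R.
    by apply: cvg_at_left_filter; exact: continuous_powR.
  by rewrite powR1 in h.
Qed.

(** [V] has density [t v^(t-1)] on []0, 1[]: the uniform weight [w1] seen through [mixing] and the
    weight [w2] on the line agree on rays, both giving [1 - b^t] for [0 <= b < 1]. *)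
Lemma mixing_null t N : (0 < t)%R -> measurable N -> leb N = 0 ->
  \int[leb]_(u in `]0%R, 1%R[) (\1_N (mixing t u))%:E = 0.
Proof.
move=> t0 mN N0.
pose w1 (u : R) : R := \1_(`]0%R, 1%R[%classic : set R) u.
pose w2 (v : R) : R := (w1 v * (t * v `^ (t - 1)))%R.
have mw1 : measurable_fun setT w1 by exact: measurable_indic.
have mw2 : measurable_fun setT w2.
  by apply: measurable_funM => //; apply: measurable_funM => //; exact: measurable_powR.
have w10 u : (0 <= w1 u)%R by rewrite /w1 indicE.
have w20 u : (0 <= w2 u)%R by rewrite !mulr_ge0 ?powR_ge0// ltW.
have int1 (g : R -> R) (B : set R) : measurable B ->
    \int[leb]_u (w1 u * g u * \1_B u)%:E = \int[leb]_(u in `]0%R, 1%R[ `&` B) (g u)%:E.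
  move=> mB; rewrite [RHS]integral_mkcond; apply: eq_integral => u _.
  rewrite patchE /w1 !indicE in_setI.
  by case: (_ \in _); case: (_ \in _); rewrite ?mul1r ?mul0r ?mulr1 ?mulr0.
have tot2 : \int[leb]_u (w2 u)%:E = 1.
  transitivity (\int[leb]_u (w1 u * (t * u `^ (t - 1)) * \1_(setT : set R) u)%:E).
    by apply: eq_integral => u _; rewrite indicT mulr1.
  by rewrite int1// setIT integral_powR_head// powR1.
have tot1 : \int[leb]_u (w1 u)%:E = 1.
  by rewrite integral_indic//= setIT lebesgue_measure_itv/= lte_fin ltr01 oppr0 adde0.
have rays a : wlaw leb w1 (mixing t) `]a, +oo[ = wlaw leb w2 id `]a, +oo[.
  pose b : R := if (a < 0)%R then 0%R else a.
  have b0 : (0 <= b)%R by rewrite /b; case: ltP.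
  have E1 : \int[leb]_u (w1 u * \1_(`]a, +oo[%classic : set R) (mixing t u))%:E =
      \int[leb]_u (w1 u * 1 * \1_(`](b `^ t)%R, +oo[%classic : set R) u)%:E.
    apply: eq_integral => u _; rewrite mulr1 /w1 !indicE !mem_setE !in_itv/= !andbT.
    case u01 : (0 < u < 1)%R; rewrite ?mul0r// !mul1r; congr (_%:E); congr (_%:R).
    rewrite powR_interval_preimage// /b; case: (ltP a 0%R) => // _.
    by rewrite powR0 ?gt_eqF.
  have E2 : \int[leb]_u (w2 u * \1_(`]a, +oo[%classic : set R) (id u))%:E =
      \int[leb]_u (w1 u * (t * u `^ (t - 1)) * \1_(`]b, +oo[%classic : set R) u)%:E.
    apply: eq_integral => u _; rewrite /w2 /w1 !indicE !mem_setE !in_itv/= !andbT.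
    case u01 : (0 < u < 1)%R; rewrite ?mul0r// !mul1r; congr (_%:E); congr (_ * _%:R)%R.
    rewrite /b; case: (ltP a 0%R) => // a0.
    by move/andP : u01 => [u0 _]; rewrite u0 (lt_trans a0).
  rewrite !wlawE ?E1 ?E2//; last exact: measurable_mixing.
  rewrite !int1//.
  have ioo (c : R) : (0 <= c)%R -> `]0%R, 1%R[ `&` `]c, +oo[ = `]c, 1%R[%classic.
    move=> c0; apply/seteqP; split => u /=; rewrite !in_itv/= andbT.
      by move=> [/andP[_ ->] ->].
    by move=> /andP[cu u1]; rewrite u1 cu (le_lt_trans c0 cu).
  rewrite !ioo ?powR_ge0//.
  have [b1|b1] := ltP b 1%R.
    rewrite integral_powR_tail01 ?b0// integral_cst//= mul1e lebesgue_measure_itv/= lte_fin.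
    have : (b `^ t < 1 `^ t)%R by apply: gt0_ltr_powR; rewrite ?nnegrE.
    by rewrite powR1 => ->.
  have : (1 `^ t <= b `^ t)%R by apply: ge0_ler_powR; rewrite ?nnegrE// ltW.
  rewrite powR1 => bt1.
  by rewrite !set_itv_ge ?integral_set0// bnd_simp -leNgt.
have := @eq_wlaw_rays R _ _ _ _ leb leb w1 (mixing t) w2 id mw1 (measurable_mixing t) w10 mw2
  (@measurable_id _ _ _) w20.
rewrite tot1 tot2 => /(_ (ltry _) erefl rays N mN).
rewrite !wlawE//; last exact: measurable_mixing.
rewrite (_ : \int[leb]_x (w2 x * \1_N (id x))%:E = 0); last first.
  rewrite int1//; apply: null_set_integral => //.
  - exact: measurableI.
  - by apply/measurable_EFinP; apply: measurable_funTS; apply: measurable_funM => //; exact: measurable_powR.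
  - by apply: subset_measure0 N0 => //; exact: measurableI.
move=> <-; rewrite [LHS]integral_mkcond; apply: eq_integral => u _.
rewrite patchE /w1 [\1_(`]0%R, 1%R[%classic : set R) u]indicE.
by case: (u \in _); rewrite ?mul1r ?mul0r.
Qed.

(** The point is [(x - w) V + w], a nondegenerate affine image of [V]. A reflection reduces to
    positive slope. *)
Lemma mixing_segment_null t x w N : (0 < t)%R -> x != w -> measurable N -> leb N = 0 ->
  \int[leb]_(u in `]0%R, 1%R[) (\1_N (mixing t u * x + (1 - mixing t u) * w))%:E = 0.
Proof.
move=> t0 xw mN N0.
wlog wx : N mN N0 x w {xw} / (w < x)%R => [H|].
  move: xw; rewrite neq_lt => /orP[xw|]; last exact: H.
  pose N' := (-%R : R -> R) @^-1` N.
  have := H N' _ _ (- x)%R (- w)%R; rewrite ltrN2 => <- //.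
  - apply: eq_integral => u _.
    rewrite (_ : mixing t u * x + _ = - (mixing t u * - x + (1 - mixing t u) * - w))%R; last by ring.
    by rewrite !indicE.
  - exact: preimage_measurable.
  - by have := lebesgue_measureN mN; rewrite /pushforward /N' N0.
pose M := (fun v : R => ((x - w) * v + w)%R) @^-1` N.
have c0 : (0 < x - w)%R by rewrite subr_gt0.
have ma : measurable_fun setT (fun v : R => (x - w) * v + w)%R.
  by apply: measurable_funD => //; exact: measurable_funM.
rewrite -(@mixing_null t M t0).
- apply: eq_integral => u _.
  rewrite (_ : mixing t u * x + _ = (x - w) * mixing t u + w)%R; last by ring.
  by rewrite !indicE.
- exact: preimage_measurable.
- move: N0; rewrite (lebesgue_affine w c0 mN) => /eqP.
  by rewrite mule_eq0 eqe gt_eqF//= => /eqP.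
Qed.

End mixing_null.

(** * Absolute continuity of the constructed law *)

Section mixing_density.
Local Open Scope ereal_scope.
Context {R : realType} d (T : measurableType d) (P : probability T R).
Variables (W : T -> R) (t : R).
Hypotheses (mW : measurable_fun setT W) (W0 : forall w, (0 < W w)%R).
Hypothesis lnW : \int[P]_w `|ln (W w)|%:E < +oo.
Hypothesis t0 : (0 < t)%R.
Local Notation mR := (measurableTypeR R).
Variable mu : probability mR R.
Hypothesis muE : forall l, (0 < l)%R -> stj mu (- t) l = (explogm P W t l)%:E.

Lemma indic_preimage (U V : Type) (f : U -> V) (A : set V) x :
  \1_(f @^-1` A) x = \1_A (f x) :> R.
Proof. by rewrite !indicE. Qed.

Lemma mem_set1E (x c : R) : (x \in [set c]) = (x == c).
Proof. by apply/idP/eqP => [/set_mem|->]; rewrite ?inE. Qed.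

Lemma measurable_norm : measurable_fun [set: mR] (fun x : R => `|x|%R).
Proof. exact: measurableT_comp. Qed.

Lemma measurable_norm_preimage (B : set R) : measurable B ->
  measurable ((fun x : mR => `|x|%R) @^-1` B).
Proof. by move=> mB; exact: preimage_measurable measurable_norm mB. Qed.

Lemma stj_mix_step_fixed l : (0 < l)%R -> stj (mix_step P t mW mu) (- t) l = stj mu (- t) l.
Proof.
move=> l0; rewrite stj_mix_step// muE// -integral_explogm//.
apply: eq_integral => s; rewrite inE/= in_itv/= andbT => ls; have s0 := lt_trans l0 ls.
by rewrite muE// inv_meanE// -!EFinM; congr EFin; ring.
Qed.

(** The transform of [mu] solves the fixed-point equation, so [mu] and its image have the same
    Stieltjes transform and uniqueness identifies the laws of [|x|]. *)
Lemma mix_step_fixed (B : set R) : measurable B ->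
  mix_step P t mW mu ((fun x => `|x|%R) @^-1` B) = mu ((fun x => `|x|%R) @^-1` B).
Proof.
move=> mB; have mn := measurable_norm.
rewrite -!wlaw_prob//.
apply: (@stieltjes_unique R _ _ _ _ (mix_step P t mW mu) mu (fun=> 1%R) (fun x : R => `|x|%R)
  (fun=> 1%R) (fun x : R => `|x|%R) _ _ _ _ _ _ _ _ _ _ t) => //.
- by rewrite integral_cst// mul1e -ge0_fin_numE// fin_num_measure.
- by rewrite integral_cst// mul1e -ge0_fin_numE// fin_num_measure.
- move=> l l0; under eq_integral do rewrite mul1r.
  under [RHS]eq_integral do rewrite mul1r.
  exact: stj_mix_step_fixed.
Qed.

(** In the fixed-point equation a pair with [W w] different from [|x|] yields a diffuse mixture that
    ignores [N]; on the diagonal the mixture stays at [|x|]. *)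
Lemma mixing_law_null (N : set R) : measurable N -> lebesgue_measure N = 0 ->
  mu ((fun x => `|x|%R) @^-1` N) =
  \int[mu]_x \int[P]_w (\1_N `|x|%R * (W w == `|x|)%:R)%:E.
Proof.
move=> mN N0; rewrite -mix_step_fixed// -[in LHS](setIT (_ @^-1` N)) -integral_indic//; last first.
  exact: measurable_norm_preimage.
rewrite integral_mix_step; last 2 first.
- by apply/measurable_EFinP; apply: measurable_indic; exact: measurable_norm_preimage.
- by move=> x; rewrite lee_fin.
apply: eq_integral => x _; apply: eq_integral => w _.
have [wx|wx] := eqVneq (W w) `|x|%R.
- rewrite wx mulr1; transitivity (\int[@lebesgue_measure R]_(u in `]0%R, 1%R[) (\1_N `|x|)%:E).
    apply: eq_integral => u _; rewrite (_ : mixing t u * _ + _ = `|x|)%R; last by ring.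
    by rewrite indic_preimage normr_id.
  by rewrite integral_cst//= lebesgue_measure_itv/= lte_fin ltr01 oppr0 adde0 mule1.
rewrite mulr0; apply: etrans (@mixing_segment_null R t `|x| (W w) N t0 _ mN N0); last by rewrite eq_sym.
apply: eq_integral => u _; rewrite indic_preimage ger0_norm//.
by apply: addr_ge0; apply: mulr_ge0; rewrite ?mixing_ge0 ?subr_ge0 ?mixing_le1// ltW.
Qed.

Hypothesis Wnc : ~ exists c, {ae P, forall w, W w = c}.

(** Applied to the set of the single point [c], the diagonal formula reads [m = P(W = c) m]. A
    positive [m] would force [W = c] almost surely. *)
Lemma mixing_law_atomless (c : R) : mu ((fun x => `|x|%R) @^-1` [set c]) = 0.
Proof.
have mc : measurable ((fun x : mR => `|x|%R) @^-1` [set c]).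
  exact: measurable_norm_preimage.
have mWc : measurable (W @^-1` [set c]) by exact: preimage_measurable.
have := mixing_law_null (measurable_set1 c) (lebesgue_measure_set1 c).
rewrite (_ : \int[mu]_x _ = P (W @^-1` [set c]) * mu ((fun x => `|x|%R) @^-1` [set c])); last first.
  rewrite -[X in _ * mu X](setIT _) -integral_indic// -ge0_integralZl//; last first.
    by apply/measurable_EFinP; exact: measurable_indic.
  apply: eq_integral => x _.
  rewrite -[X in P X](setIT _) -integral_indic// -ge0_integralZr//; last first.
    by apply/measurable_EFinP; exact: measurable_indic.
  apply: eq_integral => w _; rewrite -EFinM; congr EFin; rewrite mulrC !indic_preimage !indicE.
  rewrite !mem_set1E; by have [->|_] := eqVneq `|x|%R c; rewrite ?mulr0.
have [p0|p0] := eqVneq (mu ((fun x => `|x|%R) @^-1` [set c])) 0; first by [].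
have [p Ep] : exists p : R, mu ((fun x => `|x|%R) @^-1` [set c]) = p%:E.
  by exists (fine (mu ((fun x => `|x|%R) @^-1` [set c]))); rewrite fineK// fin_num_measure.
have [q Eq] : exists q : R, P (W @^-1` [set c]) = q%:E.
  by exists (fine (P (W @^-1` [set c]))); rewrite fineK// fin_num_measure.
rewrite Ep Eq -EFinM => -[E]; exfalso; apply: Wnc; exists c.
have P1 : P (W @^-1` [set c]) = 1.
  rewrite Ep eqe in p0.
  by rewrite Eq; congr EFin; apply: (mulIf p0); rewrite mul1r.
exists (~` (W @^-1` [set c])); split => //; first exact: measurableC.
by rewrite probability_setC// P1 subee.
Qed.

(** After exchanging the integrals in the diagonal formula, the inner one is at most the mass of
    [mu] at [W w], which is zero. *)
Lemma mixing_law_dominated (N : set R) : measurable N -> lebesgue_measure N = 0 ->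
  mu ((fun x => `|x|%R) @^-1` N) = 0.
Proof.
move=> mN N0; rewrite mixing_law_null//.
have meq : measurable [set z : mR * T | W z.2 = `|z.1|%R].
  rewrite (_ : [set z | _] = (fun z : mR * T => (W z.2 - `|z.1|)%R) @^-1` [set 0%R]).
    apply: preimage_measurable => //; apply: measurable_funB.
      exact: measurableT_comp mW measurable_snd.
    by apply: (measurableT_comp measurable_norm); exact: measurable_fst.
  by apply/seteqP; split => z /= => [->|/eqP]; rewrite ?subrr// subr_eq0 => /eqP.
rewrite (tonelli_in mu P (fun (x : mR) w => (\1_N `|x|%R * (W w == `|x|)%:R)%:E))//.
- apply: integral0_eq => w _; apply/eqP; rewrite eq_le integral_ge0 ?andbT//.
  rewrite -(mixing_law_atomless (W w)).
  have mc : measurable ((fun x : mR => `|x|%R) @^-1` [set W w]).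
    exact: measurable_norm_preimage.
  rewrite -[X in mu X](setIT _) -integral_indic//.
  have mi : measurable_fun setT (fun x : mR => (\1_N `|x|%R * (W w == `|x|)%:R)%R : R).
    apply: measurable_funM.
      by apply: measurable_indic; exact: measurable_norm_preimage.
    rewrite (_ : (fun _ => _) = \1_((fun x : mR => `|x|%R) @^-1` [set W w])).
      exact: measurable_indic.
    apply/funext => x; rewrite indicE; congr ((nat_of_bool _)%:R).
    by apply/idP/idP => [/eqP e|/set_mem /= ->//]; exact/mem_set.
  apply: ge0_le_integral => //.
  + exact/measurable_EFinP.
  + by apply/measurable_EFinP; exact: measurable_indic.
  + move=> x _; rewrite lee_fin (indic_preimage (fun x : mR => `|x|%R) [set W w]) !indicE mem_set1E.
    rewrite eq_sym; have [_|_] := eqVneq `|x|%R (W w); rewrite ?mulr0 ?mulr1//.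
    by rewrite lern1; case: (_ \in _).
- apply/measurable_EFinP; apply: measurable_funM.
    apply: (measurableT_comp (measurable_indic (measurable_norm_preimage mN))).
    exact: measurable_fst.
  rewrite (_ : (fun _ => _) = \1_[set z : mR * T | W z.2 = `|z.1|%R]).
    exact: measurable_indic.
  apply/funext => z; rewrite indicE; congr ((nat_of_bool _)%:R).
  by apply/idP/idP => [/eqP e|/set_mem /= ->//]; exact/mem_set.
Qed.

Definition norm_fun (x : mR) : mR := `|x|%R.

HB.instance Definition _ := isMeasurableFun.Build _ _ _ _ norm_fun measurable_norm.

Lemma exists_mixing_density : exists f : R -> R,
  [/\ measurable_fun [set: R] f, forall x, (0 <= f x)%R
    & forall B : set R, measurable B ->
        mu ((fun x => `|x|%R) @^-1` B) = \int[lebesgue_measure]_(x in B) (f x)%:E].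
Proof.
have dom : distribution mu norm_fun `<< lebesgue_measure.
  by apply/null_content_dominatesP => N mN N0; exact: mixing_law_dominated.
have [f [f0 ff fi fE]] := radon_nikodym_sigma_finite dom.
exists (fine \o f); split.
- by apply: measurableT_comp => //; case/integrableP : fi.
- by move=> x; exact: fine_ge0.
- by move=> B mB; apply: etrans (fE B mB) _; apply: eq_integral => x _; rewrite /= fineK.
Qed.

End mixing_density.

(** * The exponents of [G] and [1/G] in terms of [W] *)

Section reciprocal.
Context {R : realType} d (T : measurableType d) (P : probability T R).
Variable G : {RV P >-> R}.
Hypothesis G0 : positive_rv P G.
Hypothesis lnG : ('E_P[fun w => `|ln (G w)|%R] < +oo)%E.

(* A version of [1/G] that is positive everywhere. *)
Definition recip (w : T) : R := if 0 < G w then (G w)^-1 else 1.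

Lemma recip_gt0 w : 0 < recip w.
Proof. by rewrite /recip; case: ifPn => // ?; rewrite invr_gt0. Qed.

Lemma measurable_recip : measurable_fun [set: T] recip.
Proof.
apply: measurable_fun_ifT => //; last exact: measurable_inv_fun.
exact: measurable_fun_ltr.
Qed.

Lemma ae_recip : {ae P, forall w, (G w)^-1 = recip w}.
Proof. by apply: filterS G0 => w Gw; rewrite /recip Gw. Qed.

Lemma ae_recipV : {ae P, forall w, G w = (recip w)^-1}.
Proof. by apply: filterS G0 => w Gw; rewrite /recip Gw invrK. Qed.

Lemma measurable_ln_rv : measurable_fun [set: T] (fun w => ln (G w)).
Proof. by apply: (measurableT_comp _ (measurable_funPT G)). Qed.

Lemma ae_ln_recip : {ae P, forall w, ln (G w) = - ln (recip w)}.
Proof. by apply: filterS G0 => w Gw; rewrite /recip Gw lnV ?opprK. Qed.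

Lemma measurable_ln_recip : measurable_fun [set: T] (fun w => ln (recip w)).
Proof. by apply: (measurableT_comp _ measurable_recip). Qed.

Lemma integral_norm_ln_recip : (\int[P]_w `|ln (recip w)|%:E < +oo)%E.
Proof.
move: lnG; rewrite unlock; congr (_ < _)%E; apply: ae_eq_integral => //.
- apply/measurable_EFinP; exact: (measurableT_comp _ measurable_ln_rv).
- apply/measurable_EFinP; exact: (measurableT_comp _ measurable_ln_recip).
- by apply: filterS ae_ln_recip => w e _; rewrite e normrN.
Qed.

Let mW := measurable_recip.
Let W0 := recip_gt0.
Let lnW := integral_norm_ln_recip.

Lemma mean_log_recip : mean_log P G = - logm P recip 0.
Proof.
rewrite /mean_log unlock; apply: EFin_inj.
rewrite (_ : (\int[P]_w (ln (G w))%:E = (- logm P recip 0)%:E)%E)//.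
rewrite EFinN -logmE// -integralN//; last first.
  exact: integrable_add_def (integrable_logm mW W0 lnW (lexx 0)).
apply: ae_eq_integral => //.
- exact/measurable_EFinP/measurable_ln_rv.
- apply: measurableT_comp => //; apply/measurable_EFinP.
  by under eq_fun do rewrite add0r; exact: measurable_ln_recip.
- by apply: filterS ae_ln_recip => w e _; rewrite e add0r EFinN.
Qed.

Lemma psi_rv l : 0 < l -> psi P G l = (ln l + logm P recip l^-1)%:E.
Proof.
move=> l0; have mV : measurable_fun [set: T] (fun w => (recip w)^-1).
  exact: measurableT_comp (@measurable_invr R) mW.
rewrite (eq_ae_psi _ (measurable_funPT G) mV ae_recipV).
rewrite psi_ln//; [|by move=> w; rewrite invr_gt0|exact: ltW].
rewrite EFinD -logmE ?invr_ge0 ?(ltW l0)//.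
have il := integrable_logm mW W0 lnW (l := l^-1).
rewrite -[(ln l)%:E](_ : \int[P]_w (ln l)%:E = _)%E; last first.
  by rewrite integral_cst//= probability_setT mule1.
rewrite -integralD//; last 2 first.
- exact: finite_measure_integrable_cst.
- by apply: il; rewrite invr_ge0 ltW.
apply: eq_integral => w _; rewrite -EFinD invrK -lnM ?posrE ?addr_gt0 ?invr_gt0//.
by rewrite mulrDr divff ?gt_eqF.
Qed.

Lemma psi_inv_rv l : 0 <= l -> psi P (inv_rv G) l = (logm P recip l + mean_log P G)%:E.
Proof.
move=> l0; rewrite (eq_ae_psi _ (measurable_funPT (inv_rv G)) mW ae_recip).
rewrite psi_ln// mean_log_recip EFinB -!logmE//.
have il := integrable_logm mW W0 lnW.
rewrite -integralB//; [|exact: il|exact: il].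
apply: eq_integral => w _; rewrite -EFinB add0r -ln_div ?posrE ?ltr_wpDl//.
by rewrite mulrDl divff ?gt_eqF// addrC.
Qed.

Lemma psi_duality l : 0 < l ->
  (psi P (inv_rv G) l - psi P G l^-1)%E = (mean_log P G + ln l)%:E.
Proof.
move=> l0; rewrite psi_rv ?invr_gt0// psi_inv_rv ?(ltW l0)// invrK lnV ?posrE//.
by rewrite -EFinB; congr EFin; ring.
Qed.

Lemma recip_not_cst : ~ (exists c, {ae P, forall w, G w = c}) ->
  ~ exists c, {ae P, forall w, recip w = c}.
Proof.
move=> nc [c ec]; apply: nc; exists c^-1.
by apply: filterS2 ec ae_recipV => w <- ->; rewrite ?invrK.
Qed.

End reciprocal.

(** * The product of a sigma-finite measure with a probability *)

Section sigma_finite_product.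
Local Open Scope ereal_scope.
Context {R : realType} d1 d2 (T1 : measurableType d1) (T2 : measurableType d2).
Variables (m1 : {sigma_finite_measure set T1 -> \bar R}) (P2 : probability T2 R).

Definition prod_measure : set (T1 * T2) -> \bar R := m1 \x P2.

HB.instance Definition _ := Measure.on prod_measure.

Let prod_measure_sigma_finite : sigma_finite setT prod_measure.
Proof.
have [F TF mF] := sigma_finiteT m1; exists (fun n => F n `*` setT).
  by rewrite -setXTT TF; apply/seteqP; split => z; [move=> [[i _ Fi] _]|move=> [i _ [Fi _]]];
    [exists i|split=> //; exists i].
move=> n; have [mFn Fnoo] := mF n; split; first exact: measurableX.
by rewrite /prod_measure [ltLHS]product_measure1E// [X in _ * X]probability_setT mule1.
Qed.

HB.instance Definition _ := Measure_isSigmaFinite.Build _ _ _ prod_measure prod_measure_sigma_finite.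

End sigma_finite_product.

(** * Integration against a pair of independent variables *)

Section independence.
Local Open Scope ereal_scope.
Context {R : realType} d (T : measurableType d) (P : probability T R).
Variables X Y : {RV P >-> R}.

Definition pair_rv (w : T) : R * R := (X w, Y w).

Lemma measurable_pair_rv : measurable_fun [set: T] pair_rv.
Proof. by apply/measurable_fun_pairP; split; exact: measurable_funPT. Qed.

HB.instance Definition _ := isMeasurableFun.Build _ _ _ _ pair_rv measurable_pair_rv.

(** Independence says that the joint law agrees with the product of the laws on rectangles, which
    determines it. The variable [w'] runs over a second copy of the same space. *)
Lemma independent_integral (F : R -> R -> \bar R) :
  independent_rv P X Y ->
  measurable_fun [set: R * R] (fun z => F z.1 z.2) -> (forall x y, 0 <= F x y) ->
  \int[P]_w F (X w) (Y w) = \int[P]_w' \int[P]_w F (X w) (Y w').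
Proof.
move=> XY mF F0; pose F' (z : R * R) := F z.1 z.2.
have F'0 z : 0 <= F' z by exact: F0.
transitivity (\int[distribution P pair_rv]_z F' z).
  by rewrite ge0_integral_distribution.
transitivity (\int[distribution P X \x distribution P Y]_z F' z).
  apply: eq_measure_integral => A mA _; apply/esym.
  by apply: product_measure_unique => // B C mB mC; exact: XY.
rewrite fubini_tonelli2//= /fubini_G.
rewrite ge0_integral_distribution//; last 2 first.
- by apply: measurable_fun_fubini_tonelli_G.
- by move=> y; apply: integral_ge0 => x _; exact: F'0.
apply: eq_integral => w' _ /=; rewrite ge0_integral_distribution//.
by apply: measurableT_comp mF _; exact: measurable_pair2.
Qed.

End independence.

(** * Transforms of gamma mixtures *)

Section laws.
Local Open Scope ereal_scope.
Context {R : realType}.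

Lemma has_density_integral d (T : measurableType d) (P : probability T R)
    (X : T -> R) (f k : R -> R) : measurable_fun [set: T] X ->
  has_density P X f -> measurable_fun [set: R] k -> (forall x, 0 <= k x)%R ->
  \int[P]_w (k (X w))%:E = \int[lebesgue_measure]_x (f x * k x)%:E.
Proof.
move=> mX [mf f0 fE] mk k0; under eq_integral do rewrite -[k _]mul1r.
apply: (@eq_wlaw_integral R _ _ _ _ P lebesgue_measure (fun=> 1%R) X f id k) => //.
by move=> B mB; rewrite wlaw_prob// fE.
Qed.

Lemma law_eq_integral d1 d2 (T1 : measurableType d1) (T2 : measurableType d2)
    (P1 : probability T1 R) (P2 : probability T2 R) (X1 : T1 -> R) (X2 : T2 -> R) (k : R -> R) :
  measurable_fun [set: T1] X1 -> measurable_fun [set: T2] X2 ->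
  law_eq P1 X1 P2 X2 -> measurable_fun [set: R] k -> (forall x, 0 <= k x)%R ->
  \int[P1]_w (k (X1 w))%:E = \int[P2]_w (k (X2 w))%:E.
Proof.
move=> m1 m2 e mk k0; under eq_integral do rewrite -[k _]mul1r.
under [RHS]eq_integral do rewrite -[k _]mul1r.
apply: (@eq_wlaw_integral R _ _ _ _ P1 P2 (fun=> 1%R) X1 (fun=> 1%R) X2 k) => //.
by move=> B mB; rewrite !wlaw_prob// e.
Qed.

(** The uniqueness theorems require values that are nonnegative everywhere; the absolute value is a
    version with this property. *)
Lemma law_norm d (T : measurableType d) (P : probability T R) (X : {RV P >-> R}) (B : set R) :
  {ae P, forall w, (0 <= X w)%R} -> measurable B ->
  P (X @^-1` B) = wlaw P (fun=> 1%R) (fun w => `|X w|%R) B.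
Proof.
move=> X0 mB; have mX : measurable_fun setT X := measurable_funPT X.
have mnX : measurable_fun setT (fun w => `|X w|%R) by exact: measurableT_comp.
rewrite -wlaw_prob// !wlawE//; apply: ae_eq_integral => //.
- by apply/measurable_EFinP; apply: measurable_funM => //; exact: (measurableT_comp (measurable_indic mB)).
- by apply/measurable_EFinP; apply: measurable_funM => //; exact: (measurableT_comp (measurable_indic mB)).
- by apply: filterS X0 => w h _; rewrite ger0_norm.
Qed.

Lemma subordinator_ge0 d (T : measurableType d) (P : probability T R)
    (X : R -> {RV P >-> R}) t : (0 <= t)%R -> subordinator X ->
  {ae P, forall w, (0 <= X t w)%R}.
Proof.
move=> t0 [X0 Xm _ _]; apply: filterS2 X0 Xm => w e [h _].
by rewrite -e; exact: h.
Qed.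

Lemma gamma_pdf_ge0 (t a : R) : (0 < t)%R -> (0 <= gamma_pdf t a)%R.
Proof.
move=> t0; rewrite /gamma_pdf; case: ifP => // _.
by rewrite divr_ge0 ?mulr_ge0 ?powR_ge0 ?expR_ge0// ltW// Gamma_fun_gt0.
Qed.

Lemma measurable_gamma_pdf (t : R) : measurable_fun [set: R] (gamma_pdf t).
Proof.
apply: measurable_fun_ifT => //; first exact: measurable_fun_ltr.
apply: measurable_funM => //; under eq_fun do rewrite mulrC.
exact: measurable_gamma_integrand1.
Qed.

Lemma integral_gamma_pdf (t : R) (k : R -> R) : (0 < t)%R ->
  \int[lebesgue_measure]_a (gamma_pdf t a * k a)%:E =
  \int[lebesgue_measure]_(a in `]0%R, +oo[) ((Gamma_fun t)^-1 * (gamma_weight t a * k a))%:E.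
Proof.
move=> t0; rewrite [RHS]integral_mkcond; apply: eq_integral => a _.
rewrite patchE mem_setE in_itv/= andbT /gamma_pdf; case: ifP; rewrite ?mul0r// => _.
by congr EFin; rewrite /gamma_weight; ring.
Qed.

Lemma laplace_gamma_pdf (t c : R) : (0 < t)%R -> (0 <= c)%R ->
  \int[lebesgue_measure]_a (gamma_pdf t a * expR (- (c * a)))%:E =
  ((1 + c) `^ (- t))%:E.
Proof.
move=> t0 c0; rewrite integral_gamma_pdf//.
have c1 : (0 < 1 + c)%R by rewrite ltr_pwDl.
have G0 := Gamma_fun_gt0 t0.
transitivity (((Gamma_fun t)^-1)%:E * (Gamma_fun t * (1 + c) `^ (- t))%:E).
  rewrite -(integral_gamma_scale t0 c1) -ge0_integralZl//; last 3 first.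
  - by apply/measurable_EFinP; exact: measurable_funTS (measurable_gamma_integrand _ _).
  - by move=> a _; rewrite lee_fin mulr_ge0 ?powR_ge0 ?expR_ge0.
  - by rewrite lee_fin invr_ge0 ltW.
  apply: eq_integral => a _; rewrite -EFinM; congr (_ * _)%:E.
  by rewrite /gamma_weight -mulrA -expRD; congr (_ * expR _)%R; ring.
by rewrite -EFinM mulKf// gt_eqF.
Qed.

(** Integrating out the gamma variable first turns [E e^(-l g D)] into [E (1 + l D)^(-t)]. *)
Lemma is_D_laplace (t l : R) d d' (T : measurableType d) (T' : measurableType d')
    (P : probability T R) (Y : {RV P >-> R}) (P' : probability T' R) (D : {RV P' >-> R}) :
  (0 < t)%R -> (0 < l)%R -> is_D t P Y D ->
  \int[P]_w (expR (- (l * Y w)))%:E = \int[P']_w ((1 + l * `|D w|) `^ (- t))%:E.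
Proof.
move=> t0 l0 [D0 [g [gd gD YgD]]].
have mg : measurable_fun [set: T'] g by exact: measurable_funPT.
have mD : measurable_fun [set: T'] D by exact: measurable_funPT.
have me : measurable_fun [set: R] (fun y => expR (- (l * y))).
  by apply: measurableT_comp => //; apply: measurableT_comp => //; exact: measurable_funM.
have mgD : measurable_fun [set: T'] (fun w => (g w * D w)%R) by exact: measurable_funM.
rewrite (law_eq_integral (measurable_funPT Y) mgD YgD me); last by move=> y; exact: expR_ge0.
transitivity (\int[P']_w (expR (- (l * (g w * `|D w|))))%:E).
  apply: ae_eq_integral => //.
  - by apply/measurable_EFinP; exact: measurableT_comp me mgD.
  - apply/measurable_EFinP; apply: measurableT_comp me _.
    by apply: measurable_funM => //; exact: measurableT_comp.
  - by apply: filterS D0 => w Dw _; rewrite gtr0_norm.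
rewrite (independent_integral (F := fun a b : R => (expR (- (l * (a * `|b|))))%:E) gD); last 2 first.
- apply/measurable_EFinP; apply: measurableT_comp me _.
  by apply: measurable_funM => //; apply: measurableT_comp => //; exact: measurable_snd.
- by move=> a b; rewrite lee_fin expR_ge0.
apply: eq_integral => w' _.
rewrite -laplace_gamma_pdf ?mulr_ge0// ?(ltW l0)//.
rewrite (has_density_integral (k := fun a => expR (- (l * (a * `|D w'|)))) mg gd); last 2 first.
- by apply: measurableT_comp me _; exact: measurable_funM.
- by move=> a; exact: expR_ge0.
by apply: eq_integral => a _; congr (_ * expR _)%:E; ring.
Qed.

Lemma powR_scale_shift (t l y : R) : (0 < l)%R -> (0 <= y)%R ->
  ((l + y) `^ (- t) = l `^ (- t) * (1 + l^-1 * y) `^ (- t))%R.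
Proof.
move=> l0 y0; rewrite -powRM ?(ltW l0)//; last by rewrite addr_ge0// mulr_ge0// invr_ge0 ltW.
by rewrite mulrDr mulr1 mulrA divff ?gt_eqF// mul1r.
Qed.

Lemma is_D_stieltjes (t l : R) d d' (T : measurableType d) (T' : measurableType d')
    (P : probability T R) (Y : {RV P >-> R}) (P' : probability T' R) (D : {RV P' >-> R}) :
  (0 < t)%R -> (0 < l)%R -> is_D t P Y D ->
  \int[P']_w ((l + `|D w|) `^ (- t))%:E =
  (l `^ (- t))%:E * \int[P]_w (expR (- (l^-1 * Y w)))%:E.
Proof.
move=> t0 l0 YD; rewrite (is_D_laplace t0 _ YD) ?invr_gt0// -ge0_integralZl//.
- by apply: eq_integral => w _; rewrite -EFinM -powR_scale_shift.
- apply/measurable_EFinP; apply: (measurableT_comp (measurable_powR _)).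
  apply: measurable_funD => //; apply: measurable_funM => //.
  by apply: measurableT_comp => //; exact: measurable_funPT.
- by move=> w _; rewrite lee_fin powR_ge0.
- by rewrite lee_fin powR_ge0.
Qed.

(** [X] has the Laplace transform of a gamma variable times [|y|] with [y] of law [mu]. That product
    is realized as a weighted law on Lebesgue measure times [mu], and Laplace uniqueness extends the
    identity from exponentials to every nonnegative [k]. *)
Lemma gamma_mixture_integral (t : R) d (T : measurableType d) (P : probability T R)
    (X : {RV P >-> R}) (mu : probability (measurableTypeR R) R) (k : R -> R) :
  (0 < t)%R -> {ae P, forall w, (0 <= X w)%R} ->
  (forall l, (0 < l)%R -> \int[P]_w (expR (- (l * X w)))%:E =
     \int[mu]_y ((1 + l * `|y|) `^ (- t))%:E) ->
  measurable_fun [set: R] k -> (forall x, 0 <= k x)%R ->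
  \int[P]_w (k (X w))%:E =
  \int[mu]_y \int[lebesgue_measure]_a (gamma_pdf t a * k (a * `|y|))%:E.
Proof.
move=> t0 X0 XE mk k0.
have mX : measurable_fun [set: T] X by exact: measurable_funPT.
have mnX : measurable_fun [set: T] (fun w => `|X w|%R) by exact: measurableT_comp.
pose lm := prod_measure (@lebesgue_measure R) mu.
pose w2 (z : measurableTypeR R * measurableTypeR R) := gamma_pdf t z.1.
(* The absolute value on the first factor makes [X2] nonnegative everywhere and changes nothing
   under the weight, which vanishes for [a <= 0]. *)
pose X2 (z : measurableTypeR R * measurableTypeR R) : R := (`|z.1| * `|z.2|)%R.
have mw2 : measurable_fun setT w2 by exact: measurableT_comp (measurable_gamma_pdf t) measurable_fst.
have mX2 : measurable_fun setT X2.
  by apply: measurable_funM; apply: measurableT_comp => //; exact: measurable_snd.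
have tot (h : R -> R) : measurable_fun setT h -> (forall x, 0 <= h x)%R ->
    \int[lm]_z (w2 z * h (X2 z))%:E =
    \int[mu]_y \int[lebesgue_measure]_a (gamma_pdf t a * h (a * `|y|))%:E.
  move=> mh h0; apply: etrans (fubini_tonelli2 (fun z => (w2 z * h (X2 z))%:E) _ _) _.
  - by apply/measurable_EFinP; apply: measurable_funM => //; exact: measurableT_comp.
  - by move=> z; rewrite lee_fin; apply: mulr_ge0; [exact: gamma_pdf_ge0|exact: h0].
  apply: eq_integral => y _; rewrite /fubini_G; apply: eq_integral => a _.
  rewrite /w2 /X2 /=; have [a0|a0] := leP a 0%R; last by rewrite gtr0_norm.
  by rewrite /gamma_pdf ltNge a0 !mul0r.
have fin2 : \int[lm]_z (w2 z)%:E = 1.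
  under eq_integral do rewrite -[w2 _]mulr1.
  rewrite (tot (fun=> 1%R))//.
  rewrite (eq_integral (fun=> 1%E)).
    by rewrite integral_cst// mul1e [LHS]probability_setT.
  move=> y _; have := laplace_gamma_pdf t0 (lexx 0%R); rewrite addr0 powR1 => <-.
  by apply: eq_integral => a _; rewrite mul0r oppr0 expR0.
have weq : forall B, measurable B -> wlaw P (fun=> 1%R) X B = wlaw lm w2 X2 B.
  move=> B mB; rewrite wlaw_prob// law_norm//.
  apply: (@laplace_unique R _ _ _ _ P lm (fun=> 1%R) (fun w => `|X w|%R) w2 X2) => //.
  - by move=> z; exact: gamma_pdf_ge0.
  - by move=> z; rewrite mulr_ge0.
  - by rewrite integral_cst// mul1e -ge0_fin_numE// fin_num_measure.
  - by rewrite fin2 ltry.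
  move=> l l0; rewrite (tot (fun x => expR (- (l * x)))); last 2 first.
  - by apply: measurableT_comp => //; apply: measurableT_comp => //; exact: measurable_funM.
  - by move=> x; exact: expR_ge0.
  transitivity (\int[P]_w (expR (- (l * X w)))%:E).
    apply: ae_eq_integral => //.
    - apply/measurable_EFinP; apply: measurable_funM => //; apply: measurableT_comp => //.
      by apply: measurableT_comp => //; exact: measurable_funM.
    - apply/measurable_EFinP; apply: measurableT_comp => //.
      by apply: measurableT_comp => //; exact: measurable_funM.
    - by apply: filterS X0 => w Xw _; rewrite ger0_norm// mul1r.
  rewrite XE//; apply: eq_integral => y _; rewrite -laplace_gamma_pdf ?mulr_ge0// ?(ltW l0)//.
  by apply: eq_integral => a _; congr (_ * expR _)%:E; ring.
rewrite -tot//; under eq_integral do rewrite -[k _]mul1r.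
apply: (@eq_wlaw_integral R _ _ _ _ P (prod_measure (@lebesgue_measure R) mu) (fun=> 1%R) X w2 X2 k) => //.
by move=> z; exact: gamma_pdf_ge0.
Qed.

End laws.

(** * Truncated expectations of [phi] and their limit *)

Section bessel_expectation.
Context {R : realType} d (T : measurableType d) (P : probability T R).
Variables (t x : R) (X : {RV P >-> R}).
Local Notation mR := (measurableTypeR R).
Variable mu : probability mR R.
Hypotheses (t0 : 0 < t) (x0 : 0 < x) (mu0 : mu [set 0] = 0%E).
Hypothesis XE : forall k : R -> R, measurable_fun [set: R] k -> (forall y, 0 <= k y) ->
  (\int[P]_w (k (X w))%:E =
   \int[mu]_y \int[lebesgue_measure]_a (gamma_pdf t a * k (a * `|y|))%:E)%E.

Definition cut_phi (A y : R) : R := if (0 < y) && (y <= A) then phi t (x * y) else 0.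

(** A constant added to [cut_phi] to make it nonnegative, since the mixture formula holds for
    nonnegative functions only; it is subtracted at the end. *)
Definition cut_bound (A : R) : R := phi_cst t * expR (x * A).

Definition cut_mean (A y : R) : R :=
  if y == 0 then 0 else (Gamma_fun t)^-1 * bessel_trunc t (x * `|y|) (A / `|y|).

Lemma measurable_cut_phi A : measurable_fun [set: R] (cut_phi A).
Proof.
apply: measurable_fun_ifT => //.
  by apply: measurable_and; [exact: measurable_fun_ltr|exact: measurable_fun_ler].
by apply: measurableT_comp; [exact: measurable_phi|exact: measurable_funM].
Qed.

Lemma cut_bound_ge0 A : 0 <= cut_bound A.
Proof. by rewrite mulr_ge0 ?phi_cst_ge0 ?expR_ge0. Qed.

Lemma cut_phi_le A y : `|cut_phi A y| <= cut_bound A.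
Proof.
rewrite /cut_phi; case: ifP => [/andP[y0 yA]|_]; last by rewrite normr0 cut_bound_ge0.
apply: (le_trans (phi_norm_le _ t0)); apply: ler_wpM2l; first exact: phi_cst_ge0.
by rewrite ler_expR ger0_norm ?mulr_ge0 ?(ltW x0) ?(ltW y0)// ler_wpM2l// ltW.
Qed.

Lemma cut_mean_le A y : 0 < A -> `|cut_mean A y| <= (Gamma_fun t)^-1 * 2.
Proof.
move=> A0; have G0 := Gamma_fun_gt0 t0.
have Gi : 0 <= (Gamma_fun t)^-1 by rewrite invr_ge0 ltW.
rewrite /cut_mean; case: ifPn => [_|y0]; first by rewrite normr0 mulr_ge0.
rewrite normrM (ger0_norm Gi); apply: ler_wpM2l => //.
by apply: bessel_trunc_le => //; rewrite ?mulr_ge0 ?(ltW x0)// divr_gt0// normr_gt0.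
Qed.

Lemma integral_cut A y : 0 < A ->
  (\int[lebesgue_measure]_a (gamma_pdf t a * (cut_phi A (a * `|y|) + cut_bound A))%:E =
   (cut_mean A y + cut_bound A)%:E)%E.
Proof.
move=> A0; have G0 := Gamma_fun_gt0 t0; have cA0 := cut_bound_ge0 A.
have Gi : 0 <= (Gamma_fun t)^-1 by rewrite invr_ge0 ltW.
have h0 a : 0 <= cut_phi A (a * `|y|) + cut_bound A.
  by have := cut_phi_le A (a * `|y|); rewrite ler_norml => /andP[]; lra.
have mc : measurable_fun [set: R] (fun a => cut_phi A (a * `|y|)).
  by apply: measurableT_comp (measurable_cut_phi A) _; exact: measurable_funM.
rewrite (integral_gamma_pdf (fun a => cut_phi A (a * `|y|) + cut_bound A) t0).
have iw := integrable_gamma_weight t0.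
have ic : lebesgue_measure.-integrable `]0%R, +oo[
    (EFin \o (fun a => gamma_weight t a * cut_phi A (a * `|y|))).
  apply: (@le_integrable _ _ _ lebesgue_measure (`]0%R, +oo[%classic : set R)
    (measurable_itv _) _ (fun a => ((cut_bound A)%:E * (gamma_weight t a)%:E)%E)).
  - apply/measurable_EFinP; apply: measurable_funTS; apply: measurable_funM => //.
    exact: measurable_gamma_integrand1.
  - move=> a _; rewrite -EFinM /= lee_fin normrM (ger0_norm (gamma_weight_ge0 _ _)).
    rewrite mulrC (ger0_norm (mulr_ge0 (cut_bound_ge0 A) (gamma_weight_ge0 t a))).
    by apply: ler_wpM2r; [exact: gamma_weight_ge0|exact: cut_phi_le].
  - exact: integrableZl.
have Ec : (\int[lebesgue_measure]_(a in `]0%R, +oo[) (gamma_weight t a * cut_phi A (a * `|y|))%:E =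
    (Gamma_fun t * cut_mean A y)%:E)%E.
  rewrite /cut_mean; have [y0|y0] := eqVneq y 0.
    rewrite mulr0 integral0_eq// => a _.
    by rewrite y0 normr0 mulr0 /cut_phi ltxx/= mulr0.
  have ny0 : 0 < `|y| by rewrite normr_gt0.
  have xy0 : 0 <= x * `|y| by rewrite mulr_ge0// ltW.
  have bi : lebesgue_measure.-integrable `]0%R, (A / `|y|)[ (EFin \o bessel_int t (x * `|y|)).
    apply: (integrableS _ _ _ (bessel_int_integrable t0 xy0)) => //.
    by move=> a /=; rewrite !in_itv/= andbT => /andP[].
  (* The closed right end matches the non-strict cut [y <= A] in [cut_phi]. *)
  rewrite mulrA divff ?gt_eqF// mul1r /bessel_trunc Rintegral_itv_bndo_bndc//.
  rewrite /Rintegral fineK; last first.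
    apply: integrable_fin_num => //.
    apply: (integrableS _ _ _ (bessel_int_integrable t0 xy0)) => //.
    by move=> a /=; rewrite !in_itv/= andbT => /andP[].
  rewrite [LHS]integral_mkcond [RHS]integral_mkcond; apply: eq_integral => a _.
  rewrite !patchE !mem_setE !in_itv/= andbT /cut_phi; have [a0|a0] //= := ltP 0 a.
  rewrite mulr_gt0//= ler_pdivlMr//; case: ifP => _; last by rewrite mulr0.
  by rewrite /bessel_int /gamma_weight mulrC -!mulrA [a * `|y|]mulrC.
transitivity (\int[lebesgue_measure]_(a in `]0%R, +oo[) (((Gamma_fun t)^-1)%:E *
    ((gamma_weight t a * cut_phi A (a * `|y|))%:E + (cut_bound A)%:E * (gamma_weight t a)%:E)))%E.
  apply: eq_integral => a _.
  rewrite -[RHS]/(((Gamma_fun t)^-1 * (gamma_weight t a * cut_phi A (a * `|y|) +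
    cut_bound A * gamma_weight t a))%:E).
  by congr EFin; ring.
rewrite integralZl//; last by apply: integrableD => //; exact: integrableZl.
rewrite integralD//; last exact: integrableZl.
rewrite Ec integralZl// -[X in (_ + _ * X)%E]/(gammaE t) Gamma_funE//.
rewrite -[LHS]/(((Gamma_fun t)^-1 * (Gamma_fun t * cut_mean A y + cut_bound A * Gamma_fun t))%:E).
by move: (Gamma_fun t) G0 => g g0; congr EFin; field; rewrite gt_eqF.
Qed.

Lemma measurable_cut_mean A : 0 < A -> measurable_fun [set: mR] (cut_mean A).
Proof.
move=> A0; have h0 a (y : mR) : 0 <= cut_phi A (a * `|y|) + cut_bound A.
  by have := cut_phi_le A (a * `|y|); rewrite ler_norml => /andP[]; lra.
rewrite (_ : cut_mean A = (fun y : mR => fine (\int[lebesgue_measure]_a (gamma_pdf t a * (cut_phi A (a * `|y|) + cut_bound A))%:E)%E - cut_bound A)); last first.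
  by apply/funext => y; rewrite integral_cut//= addrK.
apply: measurable_funB => //; apply: measurableT_comp => //.
apply: (@measurable_integral_param R _ _ mR mR lebesgue_measure setT
  (fun (y : mR) (a : mR) => (gamma_pdf t a * (cut_phi A (a * `|y|) + cut_bound A))%:E)) => //.
- apply/measurable_EFinP; apply: measurable_funM.
    exact: measurableT_comp (measurable_gamma_pdf t) measurable_snd.
  apply: measurable_funD => //; apply: measurableT_comp (measurable_cut_phi A) _.
  apply: measurable_funM; first exact: measurable_snd.
  by apply: measurableT_comp => //; exact: measurable_fst.
- by move=> y a; rewrite lee_fin mulr_ge0 ?gamma_pdf_ge0.
Qed.

Lemma bounded_integrable d' (T' : measurableType d') (Q : probability T' R) (f : T' -> R) (C : R) :
  measurable_fun [set: T'] f -> (forall w, `|f w| <= C) ->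
  Q.-integrable [set: T'] (EFin \o f).
Proof.
move=> mf fC; apply: (@le_integrable _ _ _ Q setT measurableT _ (fun=> C%:E)).
- exact/measurable_EFinP.
- by move=> w _ /=; rewrite lee_fin; apply: le_trans (fC w) (ler_norm _).
- exact: finite_measure_integrable_cst.
Qed.

Lemma expectation_cut A : 0 < A ->
  (\int[P]_w (cut_phi A (X w))%:E = (\int[mu]_y cut_mean A y)%:E)%E.
Proof.
move=> A0.
have mX : measurable_fun [set: T] (fun w => cut_phi A (X w)).
  exact: measurableT_comp (measurable_cut_phi A) (measurable_funPT X).
have iX : P.-integrable [set: T] (EFin \o (fun w => cut_phi A (X w))).
  by apply: (@bounded_integrable _ _ P _ (cut_bound A)) => // w; exact: cut_phi_le.
have im : mu.-integrable [set: mR] (EFin \o cut_mean A).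
  apply: (@bounded_integrable _ _ mu _ ((Gamma_fun t)^-1 * 2)); first exact: measurable_cut_mean.
  by move=> y; exact: cut_mean_le.
have := @XE (fun y => cut_phi A y + cut_bound A).
have mk : measurable_fun [set: R] (fun y => cut_phi A y + cut_bound A).
  by apply: measurable_funD => //; exact: measurable_cut_phi.
have k0 y : 0 <= cut_phi A y + cut_bound A.
  by have := cut_phi_le A y; rewrite ler_norml => /andP[]; lra.
move=> /(_ mk k0).
under [X in _ = X]eq_integral do rewrite integral_cut// EFinD.
under [X in X = _ -> _]eq_integral do rewrite EFinD.
have icP : P.-integrable [set: T] (cst (cut_bound A)%:E) by exact: finite_measure_integrable_cst.
have icm : mu.-integrable [set: mR] (cst (cut_bound A)%:E) by exact: finite_measure_integrable_cst.
rewrite integralD// integralD// !integral_cst// [X in (_ + _ * X)%E]probability_setT.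
rewrite [X in (_ = _ + _ * X)%E]probability_setT !mule1.
have Xf := integrable_fin_num measurableT iX.
have mf := integrable_fin_num measurableT im.
rewrite /Rintegral fineK//.
by move=> /(congr1 (fun z => z - (cut_bound A)%:E)%E); rewrite !addeK.
Qed.

(** Pointwise in [y] the truncation level [A / |y|] tends to infinity, and [cut_mean_le] provides a
    dominating constant independent of [A] and [y]. *)
Lemma cut_mean_cvg :
  \int[mu]_y cut_mean A y @[A --> +oo] -->
  (Gamma_fun t)^-1 * \int[mu]_y expR (- (x * `|y|)).
Proof.
have G0 := Gamma_fun_gt0 t0.
have Gi : 0 <= (Gamma_fun t)^-1 by rewrite invr_ge0 ltW.
pose g (y : mR) : R := if y == 0 then 0 else (Gamma_fun t)^-1 * expR (- (x * `|y|)).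
have me : measurable_fun [set: mR] (fun y : mR => expR (- (x * `|y|))).
  have mm : measurable_fun [set: mR] (fun y : mR => x * `|y|).
    by apply: measurable_funM => //; exact: (@measurable_norm R).
  by apply: (measurableT_comp (@measurable_expR R)); apply: (measurableT_comp _ mm).
have ie : mu.-integrable [set: mR] (EFin \o (fun y : mR => expR (- (x * `|y|)))).
  apply: (@bounded_integrable _ _ mu _ 1) => // y; rewrite ger0_norm ?expR_ge0//.
  by rewrite -expR0 ler_expR oppr_le0 mulr_ge0// ltW.
have gE : ((Gamma_fun t)^-1 * \int[mu]_y expR (- (x * `|y|)))%:E = (\int[mu]_y (g y)%:E)%E.
  have ef := integrable_fin_num measurableT ie; rewrite EFinM /Rintegral fineK//.
  rewrite -integralZl//; apply: ae_eq_integral => //.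
  - apply: emeasurable_funM => //; exact/measurable_EFinP.
  - apply/measurable_EFinP; apply: measurable_fun_ifT => //.
      exact: measurable_fun_eqr.
    exact: measurable_funM.
  - exists [set 0]; split => // y /= /not_implyP[_ h].
    by apply: contrapT => y0; apply: h; rewrite /g ifF//; exact/eqP.
apply/cvg_pinftyP => u uoo.
(* The maximum with 1 keeps the level positive for every [n]; it is eventually inactive. *)
have cv : (\int[mu]_y (cut_mean (Num.max 1 (u n)) y)%:E @[n --> \oo] --> \int[mu]_y (g y)%:E)%E.
  have u1 n : 0 < Num.max 1 (u n) by rewrite lt_max ltr01.
  apply: (@dominated_cvg_in R _ _ mu setT (fun n y => cut_mean (Num.max 1 (u n)) y) g
    (fun=> (Gamma_fun t)^-1 * 2)) => //.
  - by move=> n; exact: measurable_cut_mean.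
  - move=> y _; rewrite /cut_mean /g; have [y0|y0] := eqVneq y 0; first exact: cvg_cst.
    have ny0 : 0 < `|y| by rewrite normr_gt0.
    apply: cvgMr; apply: bessel_trunc_cvg => //; first by rewrite mulr_ge0// ltW.
    apply/cvgryPge => M; move/cvgryPge : uoo => /(_ (M * `|y|)); apply: filterS => n h.
    by rewrite ler_pdivlMr// le_max h orbT.
  - exact: finite_measure_integrable_cst.
  - by move=> n y _; exact: cut_mean_le.
have cv2 : (\int[mu]_y cut_mean (Num.max 1 (u n)) y @[n --> \oo] -->
    (Gamma_fun t)^-1 * \int[mu]_y expR (- (x * `|y|))).
  by move: cv; rewrite -gE => /fine_cvgP[].
apply: cvg_trans cv2; apply: near_eq_cvg.
move/cvgryPge : uoo => /(_ 1); apply: filterS => n h /=.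
by rewrite max_r.
Qed.

End bessel_expectation.

(** * The map [x |-> 1/x] on densities *)

Section inversion.
Local Open Scope ereal_scope.
Context {R : realType}.
Local Notation leb := (@lebesgue_measure R).

(* The finite measure with density [(x + 1) ^ (-2)] on the positive half-line is
   invariant under [x |-> 1 / x], which gives the change of variables for every
   nonnegative integrand. *)
Lemma integral_inversion (k : R -> R) :
  measurable_fun [set: R] k -> (forall y, 0 <= k y)%R ->
  \int[leb]_(y in `]0%R, +oo[) (k y)%:E =
  \int[leb]_(x in `]0%R, +oo[) (k x^-1 * x `^ (- 2))%:E.
Proof.
move=> mk k0.
(* Written in the shape of [integral_powR_tail] at [t = 1]. *)
pose s (y : R) : R := ((1 : R) * (y + 1) `^ (- 1 - 1))%R.
pose w (y : R) : R := (\1_(`]0%R, +oo[%classic : set R) y * s y)%R.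
have ms : measurable_fun setT s.
  apply: measurable_funM => //; apply: (measurableT_comp (measurable_powR _)).
  exact: measurable_funD.
have mw : measurable_fun setT w by exact: measurable_funM.
have s0 y : (0 <= s y)%R by rewrite mulr_ge0 ?powR_ge0.
have w0 y : (0 <= w y)%R by rewrite mulr_ge0.
have wE (g : R -> R) : \int[leb]_y (w y * g y)%:E = \int[leb]_(y in `]0%R, +oo[) (s y * g y)%:E.
  rewrite [RHS]integral_mkcond; apply: eq_integral => y _.
  by rewrite patchE /w indicE; case: (y \in _); rewrite ?mul1r ?mul0r.
have tailE (a : R) : (0 <= a)%R -> \int[leb]_(y in `]a, +oo[) (s y)%:E = ((a + 1) `^ (- 1))%:E.
  by move=> a0; rewrite integral_powR_tail// ltr_wpDl.
have headE (b : R) : (0 < b)%R -> \int[leb]_(y in `]0%R, b[) (s y)%:E = (1 - (b + 1) `^ (- 1))%:E.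
  move=> b0; have dF (x : R) : (0 < x < b)%R ->
      is_derive x 1%R (fun x => - (x + 1) `^ (- 1))%R (s x).
    move=> /andP[x0 _]; have := is_derive_powR_shift (- 1) (_ : 0 < x + 1)%R.
    move=> /(_ (addr_gt0 x0 ltr01)) h; apply: (is_derive_eq (is_deriveN h)).
    by rewrite /s mulN1r opprK mul1r.
  have c (a : R) : (0 <= a)%R -> {for a, continuous (fun x : R => - (x + 1) `^ (- 1))%R}.
    move=> a0; apply: differentiable_continuous; apply/derivable1_diffP.
    have h := is_derive_powR_shift (- 1) (ltr_wpDl a0 ltr01).
    by have [] := is_deriveN h.
  rewrite (ftc_oo (A := (- (0 + 1) `^ (- 1))%R) (B := (- (b + 1) `^ (- 1))%R) b0 dF).
  - by rewrite add0r powR1 opprK addrC.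
  - move=> x /andP[x0 _]; apply: continuousM; first exact: cst_continuous.
    apply: differentiable_continuous; apply/derivable1_diffP.
    by have [] := is_derive_powR_shift (- 1 - 1) (addr_gt0 x0 ltr01).
  - by move=> x _; exact: s0.
  - by apply: cvg_at_right_filter; exact: c.
  - by apply: cvg_at_left_filter; apply: c; exact: ltW.
have tot : \int[leb]_y (w y)%:E = 1.
  under eq_integral do rewrite -[w _]mulr1.
  rewrite wE; under eq_integral do rewrite mulr1.
  by rewrite tailE// add0r powR1.
have rays a : wlaw leb w GRing.inv `]a, +oo[ = wlaw leb w id `]a, +oo[.
  rewrite !wlawE//; last exact: measurable_invr.
  rewrite !wE; have [a0|a0] := leP a 0%R.
    apply: eq_integral => y; rewrite inE/= in_itv/= andbT => y0.
    rewrite !indicE !mem_setE !in_itv/= !andbT (le_lt_trans a0 y0).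
    by rewrite (le_lt_trans a0)// invr_gt0.
  transitivity (\int[leb]_(y in `]0%R, a^-1%R[) (s y)%:E).
    rewrite [LHS]integral_mkcond [RHS]integral_mkcond; apply: eq_integral => y _.
    rewrite !patchE !mem_setE indicE mem_setE !in_itv/= !andbT.
    have [y0|y0] //= := ltP 0%R y.
    rewrite -[(a < _)%R](_ : (y < a^-1)%R = _); first by case: ifP; rewrite ?mulr1 ?mulr0.
    by rewrite -[a in RHS]invrK ltf_pV2 ?posrE ?invr_gt0.
  rewrite headE ?invr_gt0//.
  transitivity (\int[leb]_(y in `]a, +oo[) (s y)%:E); last first.
    rewrite [LHS]integral_mkcond [RHS]integral_mkcond; apply: eq_integral => y _.
    rewrite !patchE !mem_setE indicE mem_setE !in_itv/= !andbT.
    have [ay|ay] := ltP a y; first by rewrite (lt_trans a0 ay) mulr1.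
    by rewrite mulr0; case: ifP.
  rewrite tailE ?(ltW a0)//; congr EFin; rewrite !powR_inv1 ?addr_ge0 ?invr_ge0 ?(ltW a0)//.
  by field; rewrite !gt_eqF ?addr_gt0.
have weq := @eq_wlaw_rays R _ _ _ _ leb leb w GRing.inv w id mw (@measurable_invr R) w0 mw
  (@measurable_id _ _ _) w0.
rewrite tot in weq; have {}weq := weq (ltry _) erefl rays.
(* At [1/y] the square cancels the weight and leaves [k y]; at [x] the quotient
   [(1/x + 1)^2 / (x + 1)^2] is the Jacobian [x^(-2)]. *)
pose h (x : R) : R := (k x^-1 * (x^-1 + 1) ^+ 2)%R.
have mh : measurable_fun setT h.
  apply: measurable_funM; first exact: measurableT_comp mk (@measurable_invr R).
  by apply: measurable_funX; apply: measurable_funD => //; exact: measurable_invr.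
have h0 x : (0 <= h x)%R by rewrite mulr_ge0// sqr_ge0.
have := @eq_wlaw_integral R _ _ _ _ leb leb w GRing.inv w id h mw (@measurable_invr R) w0 mw (@measurable_id _ _ _) w0 mh h0 weq.
have sE y : (0 < y)%R -> s y = (((y + 1) ^+ 2)^-1)%R.
  move=> y0; have y1 : (0 < y + 1)%R by rewrite addr_gt0.
  by rewrite /s mul1r -opprD powRN (_ : 1 + 1 = 2%:R :> R)%R// powR_mulrn// ltW.
rewrite (wE (fun y => h y^-1%R)) (wE h).
move=> E; transitivity (\int[leb]_(y in `]0%R, +oo[) (s y * h y^-1%R)%:E).
  apply: eq_integral => y; rewrite inE/= in_itv/= andbT => y0; rewrite /h invrK sE//; congr EFin.
  have : (y + 1 != 0)%R by rewrite gt_eqF// addr_gt0.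
  by move: (k y) => q y1; field.
rewrite E; apply: eq_integral => x; rewrite inE/= in_itv/= andbT => x0.
rewrite /h sE// powRN powR_mulrn ?(ltW x0)//; congr EFin.
have : (x + 1 != 0)%R by rewrite gt_eqF// addr_gt0.
have : (x != 0)%R by rewrite gt_eqF.
by move: (k x^-1%R) => q x1 y1; field; rewrite x1.
Qed.

(** [D^(-t) (l + 1/D)^(-t) = l^(-t) (1/l + D)^(-t)], so [1/D] weighted by [C D^(-t)] has the
    transform of [DI]. In the density, [x^t] comes from the weight at [D = 1/x] and [x^(-2)] from
    the change of variables. *)
Lemma inversion_density (t C : R) d3 d4 (T3 : measurableType d3) (T4 : measurableType d4)
    (P3 : probability T3 R) (P4 : probability T4 R)
    (D : {RV P3 >-> R}) (DI : {RV P4 >-> R}) (f : R -> R) :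
  (0 < t)%R -> (0 <= C)%R -> positive_rv P3 D -> positive_rv P4 DI ->
  \int[P3]_w (`|D w| `^ (- t))%:E < +oo ->
  (forall l, (0 < l)%R -> \int[P4]_w ((l + `|DI w|) `^ (- t))%:E =
     (C * l `^ (- t))%:E * \int[P3]_w ((l^-1 + `|D w|) `^ (- t))%:E) ->
  has_density P3 D f ->
  has_density P4 DI (fun x => if (0 < x)%R then (x `^ (t - 2) * C * f x^-1)%R else 0%R).
Proof.
move=> t0 C0 D0 DI0 foo eqS fD; have [mf f0 fE] := fD.
have mD : measurable_fun setT D := measurable_funPT D.
have mDI : measurable_fun setT DI := measurable_funPT DI.
have mnD : measurable_fun setT (fun w => `|D w|%R) by exact: measurableT_comp.
have mnDI : measurable_fun setT (fun w => `|DI w|%R) by exact: measurableT_comp.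
have mfi : measurable_fun [set: R] (fun x : R => f x^-1%R) by exact: measurableT_comp mf (@measurable_invr R).
split.
- apply: measurable_fun_ifT => //; first exact: measurable_fun_ltr.
  by apply: measurable_funM => //; apply: measurable_funM => //; exact: measurable_powR.
- by move=> x; case: ifP => // _; rewrite !mulr_ge0 ?powR_ge0.
move=> B mB.
pose w2 w := (C * `|D w| `^ (- t))%R.
have mw2 : measurable_fun setT w2.
  by apply: measurable_funM => //; exact: measurableT_comp (measurable_powR _) mnD.
have w20 w : (0 <= w2 w)%R by rewrite mulr_ge0 ?powR_ge0.
have mX2 : measurable_fun setT (fun w => `|D w|^-1)%R.
  exact: measurableT_comp (@measurable_invr R) mnD.
rewrite law_norm//; last by apply: filterS DI0 => w /ltW.
transitivity (wlaw P3 w2 (fun w => `|D w|^-1)%R B).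
  apply: (@stieltjes_unique R _ _ _ _ P4 P3 (fun=> 1%R) (fun w => `|DI w|%R) w2
    (fun w => `|D w|^-1)%R _ _ _ _ _ _ _ _ _ _ t) => //.
  - by rewrite integral_cst// mul1e -ge0_fin_numE// fin_num_measure.
  - under eq_integral do rewrite EFinM.
    rewrite ge0_integralZl//; last first.
      by apply/measurable_EFinP; exact: measurableT_comp (measurable_powR _) mnD.
    by rewrite lte_mul_pinfty.
  move=> l l0; under eq_integral do rewrite mul1r.
  rewrite eqS//.
  have msh : measurable_fun setT (fun w => (l^-1 + `|D w|) `^ (- t))%R.
    by apply: (measurableT_comp (measurable_powR _)); exact: measurable_funD.
  transitivity (\int[P3]_w ((C * l `^ (- t))%:E * ((l^-1 + `|D w|) `^ (- t))%:E)).
    apply/esym/ge0_integralZl; rewrite ?lee_fin ?mulr_ge0 ?powR_ge0//.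
    - exact/measurable_EFinP.
    - by move=> w _; rewrite lee_fin powR_ge0.
  apply: ae_eq_integral => //.
  - by apply: emeasurable_funM => //; exact/measurable_EFinP.
  - apply/measurable_EFinP; apply: measurable_funM => //.
    by apply: (measurableT_comp (measurable_powR _)); exact: measurable_funD.
  apply: filterS D0 => w Dw _; rewrite gtr0_norm// -EFinM; congr EFin.
  rewrite /w2 gtr0_norm// -!mulrA; congr (_ * _)%R.
  rewrite -!powRM ?addr_ge0 ?invr_ge0 ?(ltW l0) ?(ltW Dw)//; congr (_ `^ _)%R.
  by field; rewrite !gt_eqF.
pose k (y : R) : R := (if (0 < y)%R then C * y `^ (- t) * \1_B y^-1 else 0)%R.
have mBi : measurable_fun [set: R] (fun y : R => \1_B y^-1%R : R).
  exact: measurableT_comp (measurable_indic mB) (@measurable_invr R).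
have mk : measurable_fun [set: R] k.
  apply: measurable_fun_ifT => //; first exact: measurable_fun_ltr.
  by apply: measurable_funM => //; apply: measurable_funM => //; exact: measurable_powR.
have k0 y : (0 <= k y)%R by rewrite /k; case: ifP => // _; rewrite !mulr_ge0 ?powR_ge0.
transitivity (\int[P3]_w (k (D w))%:E).
  rewrite wlawE//; apply: ae_eq_integral => //.
  - apply/measurable_EFinP; apply: measurable_funM => //.
    exact: (measurableT_comp (measurable_indic mB)).
  - by apply/measurable_EFinP; exact: measurableT_comp mk mD.
  - by apply: filterS D0 => w Dw _; rewrite /k Dw /w2 gtr0_norm.
rewrite (has_density_integral mD fD mk k0).
transitivity (\int[leb]_(y in `]0%R, +oo[) (f y * (C * y `^ (- t) * \1_B y^-1))%:E).
  rewrite [RHS]integral_mkcond; apply: eq_integral => y _.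
  by rewrite patchE mem_setE in_itv/= andbT /k; case: ifP; rewrite ?mulr0.
rewrite integral_inversion; last 2 first.
- by apply: measurable_funM => //; apply: measurable_funM => //; apply: measurable_funM.
- by move=> y; rewrite !mulr_ge0 ?powR_ge0.
rewrite [LHS]integral_mkcond [RHS]integral_mkcond; apply: eq_integral => x _.
rewrite !patchE mem_setE in_itv/= andbT invrK indicE.
case: (ltP 0%R x) => x0; last by case: ifP.
case: ifP => _; last by rewrite !mulr0 mul0r.
congr EFin; rewrite mulr1 powRD ?(gt_eqF x0) ?implybT//.
rewrite (_ : x^-1 `^ (- t) = x `^ t)%R; first by ring.
by rewrite -powR_inv1 ?(ltW x0)// -powRrM mulrNN mul1r.
Qed.

End inversion.

(** * The Stieltjes transform at [l = 0] *)

Section at_zero.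
Context {R : realType} d (T : measurableType d) (P : probability T R).
Variables (W : T -> R) (t : R).
Hypotheses (mW : measurable_fun setT W) (W0 : forall w, 0 < W w).
Hypothesis lnW : (\int[P]_w `|ln (W w)|%:E < +oo)%E.
Hypothesis t0 : 0 < t.

Lemma logm_le l : 0 <= l -> logm P W 0 <= logm P W l.
Proof.
move=> l0; apply: le_Rintegral => //.
- exact: integrable_logm.
- exact: integrable_logm.
- by move=> w _; rewrite ler_ln ?posrE ?add0r ?ltr_wpDl// lerDr.
Qed.

Lemma explogm_le0 l : 0 <= l -> explogm P W t l <= explogm P W t 0.
Proof.
move=> l0; rewrite /explogm ler_expR lerN2 ler_wpM2l ?(ltW t0)//.
exact: logm_le.
Qed.

Lemma explogm_cvg0 : explogm P W t (harmonic n) @[n --> \oo] --> explogm P W t 0.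
Proof.
have h0 n : 0 <= harmonic n :> R by rewrite invr_ge0.
have h1 n : harmonic n <= 1 :> R by rewrite invf_le1// ler1n.
have i0 := integrable_logm mW W0 lnW (lexx 0).
have i1 := integrable_logm mW W0 lnW ler01.
have c : logm P W (harmonic n) @[n --> \oo] --> logm P W 0.
  have dc : (\int[P]_w (ln (harmonic n + W w))%:E @[n --> \oo] --> \int[P]_w (ln (0 + W w))%:E)%E.
    apply: (@dominated_cvg_in R _ _ P setT (fun n w => ln (harmonic n + W w))
      (fun w => ln (0 + W w)) (fun w => `|ln (0 + W w)| + `|ln (1 + W w)|)) => //.
    - move=> n; apply: (measurableT_comp (@measurable_ln R)); exact: measurable_funD.
    - move=> w _; have Ww : 0 < 0 + W w by rewrite add0r.
      apply: (@cvg_comp _ _ _ (fun n => harmonic n + W w) (@ln R) _ (nbhs (0 + W w))).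
        by apply: cvgD; [exact: cvg_harmonic|exact: cvg_cst].
      exact: continuous_ln.
    - rewrite (_ : EFin \o _ = (fun w => `|(ln (0 + W w))%:E| + `|(ln (1 + W w))%:E|)%E)//.
      by apply: integrableD => //; exact: integrable_abse.
    - move=> n w _; have a : ln (0 + W w) <= ln (harmonic n + W w).
        by rewrite ler_ln ?posrE ?add0r ?ltr_wpDl// lerDr.
      have b : ln (harmonic n + W w) <= ln (1 + W w).
        by rewrite ler_ln ?posrE ?ltr_wpDl// lerD2r.
      rewrite ler_norml; apply/andP; split.
        have := ler_norm (- ln (0 + W w)); rewrite normrN.
        by have := normr_ge0 (ln (1 + W w)); lra.
      by have := ler_norm (ln (1 + W w)); have := normr_ge0 (ln (0 + W w)); lra.
  rewrite (logmE mW W0 lnW (lexx 0)) in dc; by move/fine_cvgP : dc => [].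
have ct : - (t * logm P W (harmonic n)) @[n --> \oo] --> - (t * logm P W 0).
  by apply: cvgN; exact: cvgMr.
exact: (@cvg_comp _ _ _ _ (@expR R) _ _ _ ct (@continuous_expR R _)).
Qed.

(** Monotone convergence along [l = harmonic n]. The conventional value of [0 ^ (- t)] is 0, not
    infinity, so the almost sure positivity of [Y] is essential for the pointwise limit. *)
Lemma stieltjes_at0 d' (T' : measurableType d') (Q : probability T' R) (Y : T' -> R) :
  measurable_fun [set: T'] Y -> (forall w, 0 <= Y w) -> {ae Q, forall w, 0 < Y w} ->
  (forall l, 0 < l -> (\int[Q]_w ((l + Y w) `^ (- t))%:E = (explogm P W t l)%:E)%E) ->
  (\int[Q]_w ((Y w) `^ (- t))%:E = (explogm P W t 0)%:E)%E.
Proof.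
move=> mY Y0 Ypos YE.
have h0 n : 0 < harmonic n :> R by rewrite invr_gt0.
pose g n w := (((harmonic n + Y w) `^ (- t))%:E : \bar R).
have mg n : measurable_fun [set: T'] (g n).
  by apply/measurable_EFinP; apply: (measurableT_comp (measurable_powR _)); exact: measurable_funD.
have g0 n w : [set: T'] w -> (0 <= g n w)%E by move=> _; rewrite lee_fin powR_ge0.
have ndg w : [set: T'] w -> {homo g^~ w : n m / (n <= m)%N >-> (n <= m)%E}.
  move=> _ n m nm; rewrite lee_fin !powRN lef_pV2 ?posrE ?powR_gt0 ?ltr_wpDr//.
  apply: ge0_ler_powR; rewrite ?nnegrE ?(ltW t0) ?addr_ge0 ?(ltW (h0 _))//.
  by rewrite lerD2r lef_pV2 ?posrE// ler_nat.
have := @cvg_monotone_convergence _ _ _ Q _ measurableT g mg g0 ndg.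
rewrite (_ : (fun n => _) = (fun n => (explogm P W t (harmonic n))%:E)); last first.
  by apply/funext => n; rewrite YE.
have c : ((explogm P W t (harmonic n))%:E @[n --> \oo] --> (explogm P W t 0)%:E)%E.
  by apply: cvg_EFin; [exact: nearW|exact: explogm_cvg0].
move/(cvg_unique _ c) => ->//; apply: ae_eq_integral => //.
- by apply/measurable_EFinP; exact: measurableT_comp (measurable_powR _) mY.
- apply: (emeasurable_fun_cvg g _ mg) => w _.
  by apply: ereal_nondecreasing_is_cvgn; exact: ndg.
apply: filterS Ypos => w Yw _; apply/esym/cvg_lim => //.
apply: cvg_EFin; first exact: nearW.
apply: (cvg_powR Yw).
by rewrite -[X in _ --> X]add0r; apply: cvgD; [exact: cvg_harmonic|exact: cvg_cst].
Qed.

(** An atom of mass [p] at 0 contributes [p l^(-t)] to the transform, which stays below its finite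
    value [explogm 0] as [l] tends to 0. *)
Lemma stieltjes_no_atom (mu : probability (measurableTypeR R) R) :
  (forall l, 0 < l -> stj mu (- t) l = (explogm P W t l)%:E) -> mu [set 0] = 0%E.
Proof.
move=> muE; have m0 : measurable ([set 0] : set (measurableTypeR R)) by exact: measurable_set1.
pose p := fine (mu [set 0]); have pE : mu [set 0] = p%:E by rewrite fineK// fin_num_measure.
have p0 : 0 <= p by exact: fine_ge0.
have le l : 0 < l -> p <= l `^ t * explogm P W t 0.
  move=> l0; have lt0 : 0 < l `^ t by rewrite powR_gt0.
  rewrite -ler_pdivrMl// -powRN; apply: (@le_trans _ _ (explogm P W t l)); last first.
    by apply: explogm_le0; exact: ltW.
  rewrite -lee_fin -muE// EFinM -pE -[X in mu X](setIT _) -integral_indic//.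
  rewrite -ge0_integralZl//; [|by apply/measurable_EFinP; exact: measurable_indic|by rewrite lee_fin powR_ge0].
  apply: ge0_le_integral => //.
  - by move=> y _; rewrite -EFinM lee_fin mulr_ge0 ?powR_ge0.
  - by apply: emeasurable_funM => //; apply/measurable_EFinP; exact: measurable_indic.
  - by apply/measurable_EFinP; exact: measurable_powR_shift_norm.
  - move=> y _; rewrite -EFinM lee_fin indicE mem_set1E.
    have [->|_] := eqVneq y 0; last by rewrite mulr0 powR_ge0.
    by rewrite normr0 addr0 mulr1.
have S0 : 0 < explogm P W t 0 by exact: expR_gt0.
rewrite pE; congr EFin; apply/eqP; rewrite eq_le p0 andbT leNgt; apply/negP => pp.
(* With [l = q ^ (1/t)] the bound [p <= l ^ t * explogm 0] reads [p <= p / 2]. *)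
pose q := p / (2 * explogm P W t 0).
have q0 : 0 < q by rewrite divr_gt0// mulr_gt0.
have := le (q `^ t^-1) (powR_gt0 _ q0).
rewrite -powRrM mulVf ?gt_eqF// powRr1 ?(ltW q0)// /q.
rewrite (_ : p / (2 * explogm P W t 0) * explogm P W t 0 = p / 2); first lra.
by field; rewrite gt_eqF.
Qed.

End at_zero.

(** * The density of [Gamma_t(1/G)] *)

Section mixture_density.
Context {R : realType}.
Local Notation mR := (measurableTypeR R).
Variables (mu : probability mR R) (t c : R).
Hypotheses (t0 : 0 < t) (c0 : 0 <= c) (mu0 : mu [set 0] = 0%E).

Definition norm_laplace (x : R) : R := wlaplace mu (fun=> 1) (fun y : mR => `|y|) x.

Lemma norm_laplaceE x : 0 <= x ->
  (\int[mu]_y (expR (- (x * `|y|)))%:E = (norm_laplace x)%:E)%E.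
Proof.
move=> x0; rewrite -wlaplaceE//.
- by apply: eq_integral => y _; rewrite mul1r.
- exact: measurable_norm.
- by rewrite integral_cst// mul1e -ge0_fin_numE// fin_num_measure.
Qed.

Lemma norm_laplace_ge0 x : 0 <= norm_laplace x.
Proof. by apply: fine_ge0; apply: integral_ge0 => y _; rewrite lee_fin mulr_ge0 ?expR_ge0. Qed.

(** The right-hand side of 3)(ii), with the constructed [mu] in place of the law of [D] and [c] in
    place of [e^(-t E log G)]. *)
Definition mix_density (x : R) : R :=
  if 0 < x then x `^ (t - 1) / Gamma_fun t * c * norm_laplace x else 0.

Lemma mix_density_ge0 x : 0 <= mix_density x.
Proof.
rewrite /mix_density; case: ifP => // _.
by rewrite !mulr_ge0 ?powR_ge0 ?norm_laplace_ge0// invr_ge0 ltW// Gamma_fun_gt0.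
Qed.

Lemma measurable_mix_density : measurable_fun [set: R] mix_density.
Proof.
apply: measurable_fun_ifT => //; first exact: measurable_fun_ltr.
apply: measurable_funM; last by apply: measurable_wlaplace => //; exact: measurable_norm.
by apply: measurable_funM => //; apply: measurable_funM => //; exact: measurable_powR.
Qed.

(** Tonelli and the gamma integral. The case [l = 0] gives the total mass; there the integral
    diverges at [y = 0], a point that [mu] does not charge. *)
Lemma mix_density_laplace l : 0 <= l ->
  (\int[lebesgue_measure]_x (mix_density x * expR (- (l * `|x|)))%:E =
   c%:E * \int[mu]_y ((l + `|y|) `^ (- t))%:E)%E.
Proof.
move=> l0; have G0 := Gamma_fun_gt0 t0.
have cG : 0 <= c / Gamma_fun t by rewrite divr_ge0// ltW.
pose F (x : R) (y : mR) : \bar R :=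
  ((c / Gamma_fun t) * (x `^ (t - 1) * expR (- ((l + `|y|) * x))))%:E.
have mF : measurable_fun [set: R * mR] (fun z => F z.1 z.2).
  apply/measurable_EFinP; apply: measurable_funM => //; apply: measurable_funM.
    exact: measurableT_comp (measurable_powR _) measurable_fst.
  apply: (measurableT_comp (@measurable_expR R)); apply: measurableT_comp => //.
  apply: measurable_funM; last exact: measurable_fst.
  by apply: measurable_funD => //; apply: (measurableT_comp (@measurable_norm R)); exact: measurable_snd.
have F0 x y : (0 <= F x y)%E.
  by rewrite lee_fin; apply: (mulr_ge0 cG); rewrite mulr_ge0 ?powR_ge0 ?expR_ge0.
transitivity (\int[lebesgue_measure]_(x in `]0%R, +oo[) \int[mu]_y F x y)%E.
  rewrite [RHS]integral_mkcond; apply: eq_integral => x _.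
  rewrite patchE mem_setE in_itv/= andbT /mix_density.
  have [x0|x0] := ltP 0 x; last by rewrite mul0r.
  rewrite gtr0_norm//.
  transitivity ((c / Gamma_fun t * x `^ (t - 1) * expR (- (l * x)))%:E *
    \int[mu]_y (expR (- (x * `|y|)))%:E)%E.
    by rewrite norm_laplaceE ?(ltW x0)// -EFinM; congr EFin; ring.
  have me : measurable_fun [set: mR] (fun y : mR => (expR (- (x * `|y|)))%:E).
    apply/measurable_EFinP; apply: (measurableT_comp (@measurable_expR R)).
    apply: (measurableT_comp (@oppr_measurable R setT)).
    by apply: measurable_funM => //; exact: (@measurable_norm R).
  rewrite -ge0_integralZl//; last first.
    by rewrite lee_fin -mulrA; apply: (mulr_ge0 cG); rewrite mulr_ge0 ?powR_ge0 ?expR_ge0.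
  apply: eq_integral => y _; rewrite -EFinM /F; congr EFin.
  rewrite -!mulrA -expRD; congr (_ * (_ * (_ * expR _))); ring.
have mpw : measurable_fun [set: mR] (fun y : mR => ((l + `|y|) `^ (- t))%:E).
  by apply/measurable_EFinP; exact: measurable_powR_shift_norm.
rewrite (tonelli_in (@lebesgue_measure R) mu F)//.
rewrite -ge0_integralZl//; last by move=> y _; rewrite lee_fin powR_ge0.
apply: ae_eq_integral => //.
- apply: (@measurable_integral_param R _ _ mR mR (@lebesgue_measure R)
    (`]0%R, +oo[%classic : set R) (fun y (x : mR) => F x y)) => //.
  exact: (measurableT_comp mF (@measurable_swap _ _ _ _)).
- exact: emeasurable_funM.
- exists [set 0]; split => // y /= /not_implyP[_ h]; apply: contrapT => /eqP y0; apply: h.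
  have ly : 0 < l + `|y| by rewrite ltr_wpDl// normr_gt0.
  rewrite /F; transitivity ((c / Gamma_fun t)%:E * (Gamma_fun t * (l + `|y|) `^ (- t))%:E)%E.
    rewrite -(integral_gamma_scale t0 ly) -ge0_integralZl//; last 2 first.
    - by apply/measurable_EFinP; exact: measurable_funTS (measurable_gamma_integrand _ _).
    - by move=> a _; rewrite lee_fin mulr_ge0 ?powR_ge0 ?expR_ge0.
  by rewrite -!EFinM; congr EFin; move: (Gamma_fun t) G0 => g g0; field; rewrite gt_eqF.
Qed.

Lemma mix_density_law d (T : measurableType d) (P : probability T R) (X : {RV P >-> R}) :
  {ae P, forall w, 0 <= X w} ->
  (c%:E * \int[mu]_y (`|y| `^ (- t))%:E = 1)%E ->
  (forall l, 0 < l -> (\int[P]_w (expR (- (l * X w)))%:E =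
     c%:E * \int[mu]_y ((l + `|y|) `^ (- t))%:E)%E) ->
  has_density P X mix_density.
Proof.
move=> X0 tot XE; have mX : measurable_fun setT X := measurable_funPT X.
have mnX : measurable_fun setT (fun w => `|X w|) by exact: measurableT_comp.
have mf := measurable_mix_density; have f0 := mix_density_ge0.
split => // B mB.
rewrite law_norm//.
transitivity (wlaw (@lebesgue_measure R) mix_density (fun x => `|x|) B).
  apply: (@laplace_unique R _ _ _ _ P (@lebesgue_measure R) (fun=> 1) (fun w => `|X w|)
    mix_density (fun x : R => `|x|)) => //.
  - exact: measurable_norm.
  - by rewrite integral_cst// mul1e -ge0_fin_numE// fin_num_measure.
  - have : (\int[lebesgue_measure]_x (mix_density x)%:E =
        \int[lebesgue_measure]_x (mix_density x * expR (- (0 * `|x|)))%:E)%E.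
      by apply: eq_integral => x _; rewrite mul0r oppr0 expR0 mulr1.
    rewrite (mix_density_laplace (lexx 0)) => ->.
    by under eq_integral do rewrite add0r; rewrite tot ltry.
  move=> l l0; rewrite mix_density_laplace ?(ltW l0)// -XE//.
  apply: ae_eq_integral => //.
  - apply/measurable_EFinP; apply: measurable_funM => //; apply: measurableT_comp => //.
    by apply: measurableT_comp => //; exact: measurable_funM.
  - apply/measurable_EFinP; apply: measurableT_comp => //.
    by apply: measurableT_comp => //; exact: measurable_funM.
  - by apply: filterS X0 => w h _; rewrite ger0_norm// mul1r.
rewrite wlawE//; last exact: measurable_norm.
rewrite [RHS]integral_mkcond; apply: eq_integral => x _.
rewrite patchE indicE /mix_density; have [x0|x0] := ltP 0 x.
  by rewrite gtr0_norm//; case: ifP => _; rewrite ?mulr1 ?mulr0.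
by rewrite mul0r; case: ifP.
Qed.

End mixture_density.

(** * Laplace transforms of the two subordinators in terms of [S] *)

Section gamma_subordinator.
Context {R : realType} d d' (T : measurableType d) (T' : measurableType d').
Variables (P : probability T R) (G : {RV P >-> R}) (P' : probability T' R).
Variable X : R -> {RV P' >-> R}.
Hypothesis G0 : positive_rv P G.
Hypothesis lnG : ('E_P[fun w => `|ln (G w)|%R] < +oo)%E.

Lemma Gamma_laplace (H : T -> R) t l r : is_Gamma_subordinator P H X -> 0 <= t -> 0 <= l ->
  psi P H l = r%:E -> (\int[P']_w (expR (- (l * X t w)))%:E = (expR (- (t * r)))%:E)%E.
Proof. by move=> [_ h] t0 l0 pr; have := h t l t0 l0; rewrite pr unlock. Qed.

Lemma Gamma_laplace_rv t l : is_Gamma_subordinator P G X -> 0 <= t -> 0 < l ->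
  (\int[P']_w (expR (- (l * X t w)))%:E = (l `^ (- t) * explogm P (recip G) t l^-1)%:E)%E.
Proof.
move=> h t0 l0; rewrite (Gamma_laplace h t0 (ltW l0) (psi_rv G0 lnG l0)).
rewrite /powR gt_eqF// /explogm -expRD; congr (expR _)%:E; ring.
Qed.

Lemma Gamma_laplace_inv_rv t l : is_Gamma_subordinator P (inv_rv G) X -> 0 <= t -> 0 <= l ->
  (\int[P']_w (expR (- (l * X t w)))%:E =
   (expR (- (t * mean_log P G)) * explogm P (recip G) t l)%:E)%E.
Proof.
move=> h t0 l0; rewrite (Gamma_laplace h t0 l0 (psi_inv_rv G0 lnG l0)).
by rewrite /explogm -expRD; congr (expR _)%:E; ring.
Qed.

End gamma_subordinator.

(** * The Bessel kernel evaluated at [Gamma_t(G)] *)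

Section bessel_limit.
Context {R : realType} d (T : measurableType d) (P : probability T R).
Variables (t x : R) (X : {RV P >-> R}).
Local Notation mR := (measurableTypeR R).
Variable mu : probability mR R.
Hypotheses (t0 : 0 < t) (x0 : 0 < x) (mu0 : mu [set 0] = 0%E).
Hypothesis XE : forall k : R -> R, measurable_fun [set: R] k -> (forall y, 0 <= k y) ->
  (\int[P]_w (k (X w))%:E =
   \int[mu]_y \int[lebesgue_measure]_a (gamma_pdf t a * k (a * `|y|))%:E)%E.

(** [X] has the law of a gamma variable times [|y|], with [y] almost surely nonzero. Hence the
    conventional values of the kernel at nonpositive arguments never matter. *)
Lemma mixture_positive : positive_rv P X.
Proof.
pose N : set R := `]-oo, 0]%classic; have mN : measurable N by exact: measurable_itv.
have mXN : measurable (X @^-1` N) by exact: measurable_funPTI.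
exists (X @^-1` N); split => //; last first.
  by move=> w /= /negP; rewrite -leNgt /N/= in_itv.
have N0 y : 0 <= \1_N y :> R by [].
have := XE (measurable_indic mN) N0.
rewrite -[X in P X](setIT _) -integral_indic// => ->.
transitivity (\int[mu]_y (cst 0%E y))%E; last by rewrite integral0.
apply: ae_eq_integral => //.
- apply: (@measurable_integral_param R _ _ mR mR (@lebesgue_measure R) setT
    (fun y (a : mR) => (gamma_pdf t a * \1_N (a * `|y|))%:E)) => //.
  + apply/measurable_EFinP; apply: measurable_funM.
      exact: measurableT_comp (measurable_gamma_pdf t) measurable_snd.
    apply: (measurableT_comp (measurable_indic mN)); apply: measurable_funM.
      exact: measurable_snd.
    by apply: (measurableT_comp (@measurable_norm R)); exact: measurable_fst.
  + by move=> y a; rewrite lee_fin mulr_ge0 ?gamma_pdf_ge0.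
- exists [set 0]; split => // y /= /not_implyP[_ h]; apply: contrapT => /eqP y0; apply: h.
  apply: integral0_eq => a _; rewrite /gamma_pdf; case: ifP => [a0|_]; last by rewrite mul0r.
  by rewrite indicE mem_setE /N in_itv/= leNgt mulr_gt0 ?normr_gt0//= mulr0.
Qed.

Definition bessel_kernel (y : R) : R :=
  (y / x) `^ ((1 - t) / 2) * bessel_J (t - 1) (2 * Num.sqrt (x * y)).

Lemma bessel_kernelE y : bessel_kernel y =
  if 0 < y then x `^ (t - 1) * phi t (x * y)
  else (y / x) `^ ((1 - t) / 2) * bessel_J (t - 1) 0.
Proof.
case: ifPn => [y0|]; first exact: bessel_J_phi.
rewrite -leNgt => y0; rewrite /bessel_kernel ler0_sqrtr ?mulr0//.
by rewrite mulr_ge0_le0// ltW.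
Qed.

Lemma measurable_bessel_kernel : measurable_fun [set: R] bessel_kernel.
Proof.
rewrite (funext bessel_kernelE); apply: measurable_fun_ifT.
- exact: measurable_fun_ltr.
- apply: measurable_funM => //; apply: measurableT_comp; first exact: measurable_phi.
  exact: measurable_funM.
- apply: measurable_funM => //; apply: (measurableT_comp (measurable_powR _)).
  exact: measurable_funM.
Qed.

(** From order [1/2] on, [phi_bound] makes the kernel bounded on positive arguments. *)
Lemma bessel_kernel_integrable : 2^-1 <= t ->
  P.-integrable [set: T] (fun w => (bessel_kernel (X w))%:E).
Proof.
move=> t12; pose k (y : R) : R := if 0 < y then x `^ (t - 1) * phi t (x * y) else 0.
have mk : measurable_fun [set: R] k.
  apply: measurable_fun_ifT => //; first exact: measurable_fun_ltr.
  apply: measurable_funM => //; apply: measurableT_comp; first exact: measurable_phi.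
  exact: measurable_funM.
have mX : measurable_fun [set: T] X := measurable_funPT X.
have mkX : measurable_fun [set: T] (fun w => k (X w)) by exact: measurableT_comp mk mX.
have mbX : measurable_fun [set: T] (fun w => bessel_kernel (X w)).
  exact: measurableT_comp measurable_bessel_kernel mX.
have /integrableP[_ fin] : P.-integrable [set: T] (EFin \o (fun w => k (X w))).
  apply: (@bounded_integrable R _ _ P _ (x `^ (t - 1) * (Gamma_fun t)^-1)) => // w.
  rewrite /k; case: ifP => [Xw|_].
    rewrite normrM ger0_norm ?powR_ge0// ler_wpM2l ?powR_ge0//.
    by apply: phi_bound => //; rewrite mulr_ge0// ltW.
  by rewrite normr0 mulr_ge0 ?powR_ge0// invr_ge0 ltW// Gamma_fun_gt0.
apply/integrableP; split; first exact/measurable_EFinP.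
rewrite (_ : (\int[P]_w _ = \int[P]_w `|(EFin \o (fun w => k (X w))) w|)%E)//.
apply: ae_eq_integral => //.
- by apply: measurableT_comp => //; exact/measurable_EFinP.
- by apply: measurableT_comp => //; exact/measurable_EFinP.
- by apply: filterS mixture_positive => w Xw _; rewrite /= bessel_kernelE /k Xw.
Qed.

Lemma bessel_kernel_cut A : 0 < A ->
  (\int[P]_w (if X w <= A then bessel_kernel (X w) else 0)%:E =
   (x `^ (t - 1) * \int[mu]_y cut_mean t x A y)%:E)%E.
Proof.
move=> A0; rewrite EFinM -(expectation_cut t0 x0 XE A0).
have mX : measurable_fun [set: T] X := measurable_funPT X.
have mc : measurable_fun [set: T] (fun w => cut_phi t x A (X w)).
  exact: measurableT_comp (measurable_cut_phi x t0 A) mX.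
rewrite -integralZl//; last first.
  apply: (@bounded_integrable R _ _ P _ (cut_bound t x A)) => // w.
  exact: cut_phi_le.
apply: ae_eq_integral => //.
- apply/measurable_EFinP; apply: measurable_fun_ifT => //.
    exact: measurable_fun_ler.
  exact: measurableT_comp measurable_bessel_kernel mX.
- by apply: emeasurable_funM => //; exact/measurable_EFinP.
- apply: filterS mixture_positive => w Xw _; rewrite bessel_kernelE /cut_phi Xw/=.
  by case: ifP => _; rewrite -EFinM ?mulr0.
Qed.

Lemma bessel_kernel_cvg (c : R) :
  (c%:E * \int[P]_w (if X w <= A then bessel_kernel (X w) else 0)%:E)%E @[A --> +oo] -->
  (mix_density mu t c x)%:E.
Proof.
have cv : ((c * (x `^ (t - 1) * \int[mu]_y cut_mean t x A y))%:E) @[A --> +oo] -->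
    (mix_density mu t c x)%:E.
  apply: cvg_EFin; first exact: nearW.
  rewrite /mix_density x0 (_ : _ * norm_laplace mu x = c * (x `^ (t - 1) *
    ((Gamma_fun t)^-1 * \int[mu]_y expR (- (x * `|y|))))).
    by apply: cvgMr; apply: cvgMr; exact: cut_mean_cvg.
  by rewrite /Rintegral norm_laplaceE ?(ltW x0)//=; ring.
apply: cvg_trans cv; apply: near_eq_cvg; near=> A.
by rewrite bessel_kernel_cut -?EFinM.
Unshelve. all: by end_near. Qed.

(** Under integrability the truncated means also converge to the full expectation, so the two limits
    coincide. *)
Lemma bessel_kernel_mean (c : R) :
  P.-integrable [set: T] (fun w => (bessel_kernel (X w))%:E) ->
  ((mix_density mu t c x)%:E = c%:E * \int[P]_w (bessel_kernel (X w))%:E)%E.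
Proof.
move=> ib; pose g n w : R := if X w <= n%:R then bessel_kernel (X w) else 0.
have mX : measurable_fun [set: T] X := measurable_funPT X.
have dc : (\int[P]_w (g n w)%:E @[n --> \oo] --> \int[P]_w (bessel_kernel (X w))%:E)%E.
  apply: (@dominated_cvg_in R _ _ P setT g (fun w => bessel_kernel (X w))
    (fun w => `|bessel_kernel (X w)|)) => //.
  - move=> n; apply: measurable_fun_ifT => //; first exact: measurable_fun_ler.
    exact: measurableT_comp measurable_bessel_kernel mX.
  - move=> w _; apply: cvg_near_cst; near=> n; rewrite /g ifT//.
    by near: n; exact: nbhs_infty_ger.
  - exact: integrable_norm ib.
  - by move=> n w _; rewrite /g; case: ifP => // _; rewrite normr0.
have := @cvg_comp _ _ _ (fun n : nat => n%:R : R) _ _ _ _ (@cvgr_idn R) (@bessel_kernel_cvg c).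
move/(cvg_unique _); apply => //.
by apply: cvgeZl.
Unshelve. all: by end_near. Qed.

End bessel_limit.

(** * Every admissible [D] has the constructed law *)

Section laws_of_D.
Context {R : realType} d (T : measurableType d) (P : probability T R).
Variables (W : T -> R) (t : R).
Hypotheses (mW : measurable_fun setT W) (W0 : forall w, 0 < W w).
Hypothesis lnW : (\int[P]_w `|ln (W w)|%:E < +oo)%E.
Hypothesis t0 : 0 < t.
Variable mu : probability (measurableTypeR R) R.
Hypothesis muE : forall l, 0 < l -> stj mu (- t) l = (explogm P W t l)%:E.
Context d3 (T3 : measurableType d3) (P3 : probability T3 R) (D : {RV P3 >-> R}).
Hypothesis D0 : positive_rv P3 D.
Hypothesis DE : forall l, 0 < l ->
  (\int[P3]_w ((l + `|D w|) `^ (- t))%:E = (explogm P W t l)%:E)%E.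

Lemma measurable_norm_rv : measurable_fun [set: T3] (fun w => `|D w|).
Proof. by apply: measurableT_comp => //; exact: measurable_funPT. Qed.

Let mnD := measurable_norm_rv.

Lemma total_prob d' (T' : measurableType d') (Q : probability T' R) :
  (\int[Q]_w (1:R)%:E < +oo)%E.
Proof. by rewrite integral_cst// mul1e -ge0_fin_numE// fin_num_measure. Qed.

Lemma same_stieltjes l : 0 < l ->
  (\int[P3]_w (1 * (l + `|D w|) `^ (- t))%:E = \int[mu]_y (1 * (l + `|y|) `^ (- t))%:E)%E.
Proof.
move=> l0; under eq_integral do rewrite mul1r; under [RHS]eq_integral do rewrite mul1r.
by rewrite DE// -muE.
Qed.

Lemma law_D_mixing (B : set R) : measurable B ->
  P3 (D @^-1` B) = mu ((fun y => `|y|) @^-1` B).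
Proof.
move=> mB; have mD : measurable_fun [set: T3] D := measurable_funPT D.
rewrite law_norm//; last by apply: filterS D0 => w /ltW.
rewrite -wlaw_prob//; last exact: measurable_norm.
apply: (@stieltjes_unique R _ _ _ _ P3 mu (fun=> 1) (fun w => `|D w|) (fun=> 1)
  (fun y => `|y|) _ _ _ _ _ _ _ _ _ _ t) => //.
- exact: measurable_norm.
- exact: total_prob.
- exact: total_prob.
- exact: same_stieltjes.
Qed.

Lemma laplace_D_mixing x : 0 < x ->
  (\int[P3]_w (expR (- (x * D w)))%:E = (norm_laplace mu x)%:E)%E.
Proof.
move=> x0; have mD : measurable_fun [set: T3] D := measurable_funPT D.
rewrite -norm_laplaceE ?(ltW x0)//.
transitivity (\int[P3]_w (1 * expR (- (x * `|D w|)))%:E)%E.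
  apply: ae_eq_integral => //.
  - apply/measurable_EFinP; apply: measurableT_comp => //.
    by apply: measurableT_comp => //; exact: measurable_funM.
  - apply/measurable_EFinP; apply: measurable_funM => //; apply: measurableT_comp => //.
    by apply: measurableT_comp => //; exact: measurable_funM.
  - by apply: filterS D0 => w h _; rewrite gtr0_norm// mul1r.
rewrite (@stieltjes_unique_laplace R _ _ _ _ P3 mu (fun=> 1) (fun w => `|D w|) (fun=> 1)
  (fun y => `|y|) _ mnD _ _ _ (@measurable_norm R) _ _ _ _ t t0 same_stieltjes)//.
- by under eq_integral do rewrite mul1r.
- exact: total_prob.
- exact: total_prob.
Qed.

Lemma stieltjes_D l : 0 <= l ->
  (\int[P3]_w ((l + D w) `^ t)^-1%:E = (explogm P W t l)%:E)%E.
Proof.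
move=> l0; have mD : measurable_fun [set: T3] D := measurable_funPT D.
transitivity (\int[P3]_w ((l + `|D w|) `^ (- t))%:E)%E.
  apply: ae_eq_integral => //.
  - apply/measurable_EFinP; apply: (measurableT_comp (@measurable_invr R)).
    by apply: (measurableT_comp (measurable_powR _)); exact: measurable_funD.
  - apply/measurable_EFinP; apply: (measurableT_comp (measurable_powR _)).
    exact: measurable_funD.
  - by apply: filterS D0 => w h _; rewrite gtr0_norm// powRN.
move: l0; rewrite le_eqVlt => /predU1P[<-|l0]; last exact: DE.
under eq_integral do rewrite add0r.
apply: (stieltjes_at0 mW W0 lnW t0 mnD) => //.
by apply: filterS D0 => w h; rewrite normr_gt0 gt_eqF.
Qed.

End laws_of_D.

(** For [t < 1/2] the expectation in 3)(i) need not converge absolutely; it is therefore a limit of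
    truncations in general, and a genuine expectation whenever the integrand is integrable. If [G]
    is a constant [c], then [D_t(G) = 1/c] has no density, which explains the proviso in 4)(ii). *)
Theorem theorem2p1 (R : realType)
    (d : measure_display) (T : measurableType d) (P : probability T R)
    (G : {RV P >-> R}) :
  positive_rv P G ->
  ('E_P[fun w => `|ln (G w)|%R] < +oo)%E ->
  let m : R := mean_log P G in
  {ae (@lebesgue_measure R), forall y : R, 0 <= y <= 1 ->
     cdf_inv (inv_rv G) y * cdf_inv G (1 - y) = 1} /\
  (forall l : R, 0 < l ->
     (psi P (inv_rv G) l - psi P G l^-1)%E = (m + ln l)%:E) /\
  forall (d1 : measure_display) (T1 : measurableType d1) (P1 : probability T1 R)
    (GamG : R -> {RV P1 >-> R})
    (d2 : measure_display) (T2 : measurableType d2) (P2 : probability T2 R)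
    (GamI : R -> {RV P2 >-> R}),
  is_Gamma_subordinator P G GamG ->
  is_Gamma_subordinator P (inv_rv G) GamI ->
  forall t : R, 0 < t ->
  (exists f : R -> R,
     has_density P2 (GamI t) f /\
     (forall x : R, 0 < x ->
        let h : R -> R := fun y =>
          (y / x) `^ ((1 - t) / 2) * bessel_J (t - 1) (2 * Num.sqrt (x * y)) in
        [/\ 2^-1 <= t ->
              P1.-integrable [set: T1] (fun w => (h (GamG t w))%:E),
            P1.-integrable [set: T1] (fun w => (h (GamG t w))%:E) ->
              (f x)%:E =
              ((expR (- (t * m)))%:E * 'E_P1[fun w => h (GamG t w)])%E
          & ((expR (- (t * m)))%:E *
             'E_P1[fun w => (if GamG t w <= A then h (GamG t w) else 0)%R])%E
              @[A --> +oo] --> (f x)%:E]) /\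
     (forall (d3 : measure_display) (T3 : measurableType d3)
        (P3 : probability T3 R) (D : {RV P3 >-> R}),
      is_D t P1 (GamG t) D ->
      forall x : R, 0 < x ->
        (f x)%:E =
        ((x `^ (t - 1) / Gamma_fun t * expR (- (t * m)))%:E *
         'E_P3[fun w => expR (- (x * D w))%R])%E)) /\
  forall (d3 : measure_display) (T3 : measurableType d3)
    (P3 : probability T3 R) (D : {RV P3 >-> R}),
  is_D t P1 (GamG t) D ->
  [/\ ('E_P3[fun w => ((D w `^ t)^-1)%R] = (expR (t * m))%:E)%E,
      (forall l : R, 0 <= l ->
         ('E_P3[fun w => (((l + D w) `^ t)^-1)%R] =
          expeR (- (t%:E * (psi P (inv_rv G) l - m%:E))))%E)
    & ((~ exists c : R, {ae P, forall w, G w = c}) ->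
         exists f : R -> R, has_density P3 D f) /\
      forall (d4 : measure_display) (T4 : measurableType d4)
        (P4 : probability T4 R) (DI : {RV P4 >-> R}),
      is_D t P2 (GamI t) DI ->
      forall f : R -> R, has_density P3 D f ->
      exists g : R -> R,
        has_density P4 DI g /\
        forall x : R, 0 < x ->
          g x = x `^ (t - 2) * expR (- (t * m)) * f x^-1].
Proof.
move=> G0 lnG m; split; first exact: ae_cdf_inv_mul.
split; first by move=> l l0; exact: psi_duality.
move=> d1 T1 P1 GamG d2 T2 P2 GamI GG GI t t0.
have mW := measurable_recip G; have W0 := recip_gt0 G.
have lnW := integral_norm_ln_recip G0 lnG.
(* A law of [D_t(G)] that is available before any [D] is given; the density in 3) is built from
   it. *)
have [mu muE] := exists_mixing_law mW W0 lnW t0.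
have mu0 := stieltjes_no_atom mW W0 lnW t0 muE.
set S := explogm P (recip G) t in muE.
have S0 : S 0 = expR (t * m).
  by rewrite /S /explogm /m mean_log_recip// mulrN.
pose c := expR (- (t * m)).
have c0 : 0 <= c by exact: expR_ge0.
have cS : c * S 0 = 1 by rewrite S0 -expRD addNr expR0.
have XG0 := subordinator_ge0 (ltW t0) (proj1 GG).
have XI0 := subordinator_ge0 (ltW t0) (proj1 GI).
have mutot : (\int[mu]_y (`|y| `^ (- t))%:E = (S 0)%:E)%E.
  apply: (stieltjes_at0 mW W0 lnW t0 (@measurable_norm R)) => //.
  exists [set 0]; split => // y /= h; apply: contrapT => /eqP y0; apply: h.
  by rewrite normr_gt0.
have GE l : 0 < l -> (\int[P1]_w (expR (- (l * GamG t w)))%:E =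
    \int[mu]_y ((1 + l * `|y|) `^ (- t))%:E)%E.
  move=> l0; rewrite (Gamma_laplace_rv G0 lnG GG (ltW t0) l0) EFinM -muE ?invr_gt0//.
  have mpw : measurable_fun [set: measurableTypeR R] (fun y : R => ((l^-1 + `|y|) `^ (- t))%:E).
    by apply/measurable_EFinP; exact: measurable_powR_shift_norm.
  rewrite /stj -ge0_integralZl//; last 2 first.
  - by move=> y _; rewrite lee_fin powR_ge0.
  - by rewrite lee_fin powR_ge0.
  apply: eq_integral => y _; rewrite -EFinM; congr EFin.
  rewrite -powRM ?addr_ge0 ?invr_ge0 ?(ltW l0)//; congr (_ `^ _).
  by rewrite mulrDr divff ?gt_eqF.
have IE l : 0 < l -> (\int[P2]_w (expR (- (l * GamI t w)))%:E =
    c%:E * \int[mu]_y ((l + `|y|) `^ (- t))%:E)%E.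
  move=> l0; rewrite (Gamma_laplace_inv_rv G0 lnG GI (ltW t0) (ltW l0)) EFinM.
  by rewrite -[X in (_ = _ * X)%E]/(stj mu (- t) l) muE.
have mix k := gamma_mixture_integral (k := k) t0 XG0 GE.
(* Every [D] allowed by [is_D] has the transform [S], so uniqueness gives it the law [mu] and the
   results about [mu] apply to it. *)
have Dst d3 (T3 : measurableType d3) (P3 : probability T3 R) (D : {RV P3 >-> R}) :
    is_D t P1 (GamG t) D -> forall l, 0 < l ->
    (\int[P3]_w ((l + `|D w|) `^ (- t))%:E = (S l)%:E)%E.
  move=> GD l l0; have li0 : 0 < l^-1 by rewrite invr_gt0.
  rewrite (is_D_stieltjes t0 l0 GD) (Gamma_laplace_rv G0 lnG GG (ltW t0) li0) invrK.
  rewrite -EFinM mulrA -powRM ?invr_ge0 ?(ltW l0)// divff ?gt_eqF//.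
  by rewrite powR1 mul1r.
split.
  exists (mix_density mu t c); split; last split.
  - apply: (mix_density_law t0 c0 mu0 XI0) => //.
    by rewrite mutot -EFinM cS.
  - move=> x x0 h; split.
    + by move=> t12; exact: (bessel_kernel_integrable t0 x0 mu0 mix).
    + by move=> ih; rewrite unlock; exact: (bessel_kernel_mean t0 x0 mu0 mix).
    + rewrite unlock; exact: (bessel_kernel_cvg t0 x0 mu0 mix).
  - move=> d3 T3 P3 D GD x x0; have [D0 _] := GD.
    rewrite unlock (laplace_D_mixing t0 muE D0 (Dst _ _ _ _ GD) x0).
    by rewrite /mix_density x0 EFinM.
move=> d3 T3 P3 D GD; have [D0 _] := GD; have DE := Dst _ _ _ _ GD.
have SD l : 0 <= l -> (\int[P3]_w ((l + D w) `^ t)^-1%:E = (S l)%:E)%E.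
  exact: (stieltjes_D mW W0 lnW t0 D0 DE).
have mD : measurable_fun [set: T3] D := measurable_funPT D.
split.
- rewrite unlock -S0 -SD//; apply: eq_integral => w _; by rewrite add0r.
- move=> l l0; rewrite unlock SD// psi_inv_rv// /S /explogm /=; congr (expR _)%:E.
  by rewrite addrK.
split.
  move=> nc; have Wnc := recip_not_cst G0 nc.
  have [f [mf f0 fE]] := exists_mixing_density mW W0 lnW t0 muE Wnc.
  exists f; split => // B mB.
  by rewrite (law_D_mixing t0 muE D0 DE mB) fE.
move=> d4 T4 P4 DI GDI f fD.
(* A density is determined only almost everywhere, so 4)(ii) is proved by exhibiting the version for
   which the identity holds at every [x > 0]. *)
exists (fun x => if 0 < x then x `^ (t - 2) * c * f x^-1 else 0); split; last first.
  by move=> x x0; rewrite x0.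
have [DI0 _] := GDI.
apply: (inversion_density t0 c0 D0 DI0 _ _ fD).
- rewrite (_ : (\int[P3]_w _ = (S 0)%:E)%E) ?ltry//.
  apply: (stieltjes_at0 mW W0 lnW t0) => //; first exact: measurable_norm_rv.
  by apply: filterS D0 => w h; rewrite normr_gt0 gt_eqF.
- move=> l l0; have li0 : 0 < l^-1 by rewrite invr_gt0.
  rewrite (is_D_stieltjes t0 l0 GDI) (Gamma_laplace_inv_rv G0 lnG GI (ltW t0) (ltW li0)).
  by rewrite DE// -!EFinM; congr EFin; rewrite -/c -/S; ring.
Qed.
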